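(* Let $q$ be a large prime, let $\mathcal{X}$ be the group of Dirichlet characters modulo $q$, let $\mathcal{L}=\sqrt{\log q/\log\log q}$, and let $H\le\mathcal{X}$ be a subgroup satisfying $\log[\mathcal{X}:H]=o(\mathcal{L})$ as $q\to\infty$. Then $$\max_{\chi\in H}|L(\chi,1/2)|\ \ge\ \exp\left(\left(\frac{1}{\sqrt{3}}+o(1)\right)\mathcal{L}\right).$$
   Context: For a Dirichlet character $\chi$ modulo $q$, $L(\chi,s)=\sum_{n\ge1}\chi(n)n^{-s}$ for $\Re s>1$, continued meromorphically to $\mathbb{C}$ (entire if $\chi$ is not principal, with a pole only at $s=1$ if $\chi$ is principal); $L(\chi,1/2)$ is the value of this continuation at $s=1/2$. $\log$ is the natural logarithm and $[\mathcal{X}:H]$ is the index of $H$ in $\mathcal{X}$. Asymptotic notation refers to $q\to\infty$ through primes, with $H=H_q$ depending on $q$. Explicitly: for every function $\varepsilon(q)\to0$ there is a function $\eta(q)\to0$ such that for all sufficiently large primes $q$ and all subgroups $H\le\mathcal{X}$ with $\log[\mathcal{X}:H]\le\varepsilon(q)\mathcal{L}$, the bound holds with $o(1)$ replaced by $\eta(q)$. *)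

(* Defs.v *)
(* The complex numbers are [R[i]] for an arbitrary [R : realType], with the
   topology and the complex derivatives of [R[i]^o]. *)
From HB Require Import structures.
From mathcomp Require Import all_boot all_order all_algebra all_fingroup cyclic.
From mathcomp Require Import all_classical all_reals all_analysis.
From mathcomp Require Import complex.

Set Implicit Arguments.
Unset Strict Implicit.
Unset Printing Implicit Defensive.

Import Order.TTheory GRing.Theory Num.Theory.
Import numFieldNormedType.Exports.

Local Open Scope classical_set_scope.
Local Open Scope ring_scope.
Local Open Scope complex_scope.

Definition is_dirichlet_char (R : realType) (q : nat) (f : nat -> R[i]) : Prop :=
  [/\ forall m n : nat, f (m * n)%N = f m * f n,
      forall n : nat, f (n + q)%N = f n &
      forall n : nat, (f n != 0) = coprime n q].

Record dirichlet_char (R : realType) (q : nat) := DirichletChar {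
  dirichlet_char_fun :> nat -> R[i];
  dirichlet_char_funP : `[< is_dirichlet_char q dirichlet_char_fun >] }.

HB.instance Definition _ (R : realType) (q : nat) :=
  [isSub for @dirichlet_char_fun R q].
HB.instance Definition _ (R : realType) (q : nat) :=
  [Choice of dirichlet_char R q by <:].

(* [dirichlet_char R q] is a finite group: the values of a character are zero
   or roots of unity, and they are determined by the residues modulo [q]. *)
Section DirichletCharGroup.
Variables (R : realType) (q : nat).
Implicit Types chi psi : dirichlet_char R q.

Lemma dirichlet_charP chi : is_dirichlet_char q chi.
Proof. exact/asboolP/dirichlet_char_funP. Qed.

Lemma dirichlet_charM chi m n : chi (m * n)%N = chi m * chi n.
Proof. by case: (dirichlet_charP chi). Qed.

Lemma dirichlet_char_period chi n : chi (n + q)%N = chi n.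
Proof. by case: (dirichlet_charP chi). Qed.

Lemma dirichlet_char_neq0 chi n : (chi n != 0) = coprime n q.
Proof. by case: (dirichlet_charP chi). Qed.

Lemma dirichlet_char0 chi n : ~~ coprime n q -> chi n = 0.
Proof. by rewrite -(dirichlet_char_neq0 chi) negbK => /eqP. Qed.

Lemma dirichlet_char1 chi : chi 1%N = 1.
Proof.
have chi1_neq0 : chi 1%N != 0 by rewrite dirichlet_char_neq0 coprime1n.
by apply: (mulfI chi1_neq0); rewrite -dirichlet_charM muln1 mulr1.
Qed.

Lemma dirichlet_char_mod chi n : chi (n %% q)%N = chi n.
Proof.
rewrite [in RHS](divn_eq n q) addnC.
by elim: (n %/ q)%N => [|k ->]; rewrite ?mul0n ?addn0 // mulSnr addnA
  dirichlet_char_period.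
Qed.

Lemma dirichlet_charX chi n k : chi (n ^ k)%N = chi n ^+ k.
Proof.
by elim: k => [|k IHk]; rewrite ?expn0 ?dirichlet_char1 // expnS exprS
  dirichlet_charM IHk.
Qed.

Let e := (totient q).-1.+1.

Let unity_roots : seq R[i] :=
  sval (closed_field_poly_normal ('X^e - 1 : {poly R[i]})).

Lemma dirichlet_char_val_subproof chi n : chi n \in 0 :: unity_roots.
Proof.
have [cnq|ncnq] := boolP (coprime n q); last first.
  by rewrite dirichlet_char0 ?mem_head.
suff chi_e : chi n ^+ e = 1.
  have e_gt0 : (0 < e)%N by [].
  rewrite inE; apply/orP; right; rewrite /unity_roots.
  case: closed_field_poly_normal => r /= def_r.
  move: def_r; rewrite (monicP (monicXnsubC _ e_gt0)) scale1r => def_r.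
  rewrite -root_prod_XsubC -def_r; apply/rootP.
  by rewrite !hornerE chi_e subrr.
case: (posnP q) => [q0|q_gt0].
  have -> : n = 1%N by apply/eqP; rewrite -[n]gcdn0 -[X in gcdn n X]q0.
  by rewrite dirichlet_char1 expr1n.
rewrite /e prednK ?totient_gt0 // -dirichlet_charX -dirichlet_char_mod.
by rewrite Euler_exp_totient // dirichlet_char_mod dirichlet_char1.
Qed.

Let code chi : {ffun 'I_q -> seq_sub (0 :: unity_roots)} :=
  [ffun i : 'I_q => SeqSub (dirichlet_char_val_subproof chi i)].

Lemma dirichlet_char_eqP chi psi : (forall n, chi n = psi n) <-> chi = psi.
Proof. by split=> [eq_cp|-> //]; apply/val_inj/funext. Qed.

Lemma dirichlet_char_code_inj : injective code.
Proof.
move=> chi psi /ffunP eq_code; apply/dirichlet_char_eqP => n.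
have [cnq|ncnq] := boolP (coprime n q); last by rewrite !dirichlet_char0.
case: (posnP q) => [q0|q_gt0].
  have -> : n = 1%N by apply/eqP; rewrite -[n]gcdn0 -[X in gcdn n X]q0.
  by rewrite !dirichlet_char1.
rewrite -(dirichlet_char_mod chi) -(dirichlet_char_mod psi).
have := eq_code (Ordinal (ltn_pmod n q_gt0)).
by rewrite !ffunE => /(congr1 val).
Qed.

Definition dirichlet_char_decode y : option (dirichlet_char R q) :=
  if pselect (exists chi, code chi = y) is left ex then Some (projT1 (cid ex))
  else None.

Lemma dirichlet_char_codeK : pcancel code dirichlet_char_decode.
Proof.
move=> chi; rewrite /dirichlet_char_decode; case: pselect => [ex|[]].
  by case: cid => psi /= /dirichlet_char_code_inj ->.
by exists chi.
Qed.

HB.instance Definition _ : isCountable (dirichlet_char R q) :=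
  PCanIsCountable dirichlet_char_codeK.
HB.instance Definition _ := fintype.isFinite.Build (dirichlet_char R q)
  (pcan_enumP dirichlet_char_codeK).

Lemma dirichlet_char_one_subproof :
  `[< is_dirichlet_char q (fun n => (coprime n q)%:R : R[i]) >].
Proof.
apply/asboolP; split=> [m n|n|n].
- by rewrite coprimeMl -mulnb natrM.
- by rewrite coprime_sym /coprime gcdnDr -/(coprime q n) coprime_sym.
- by case: coprime; rewrite ?oner_eq0 ?eqxx.
Qed.

Lemma dirichlet_char_mul_subproof chi psi :
  `[< is_dirichlet_char q (fun n => chi n * psi n) >].
Proof.
apply/asboolP; split=> [m n|n|n].
- by rewrite !dirichlet_charM mulrACA.
- by rewrite !dirichlet_char_period.
- by rewrite mulf_eq0 negb_or !dirichlet_char_neq0 andbb.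
Qed.

Lemma dirichlet_char_inv_subproof chi :
  `[< is_dirichlet_char q (fun n => (chi n)^-1) >].
Proof.
apply/asboolP; split=> [m n|n|n].
- by rewrite dirichlet_charM invfM.
- by rewrite dirichlet_char_period.
- by rewrite invr_eq0 dirichlet_char_neq0.
Qed.

Definition dirichlet_char_one : dirichlet_char R q :=
  DirichletChar dirichlet_char_one_subproof.
Definition dirichlet_char_mul chi psi : dirichlet_char R q :=
  DirichletChar (dirichlet_char_mul_subproof chi psi).
Definition dirichlet_char_inv chi : dirichlet_char R q :=
  DirichletChar (dirichlet_char_inv_subproof chi).

Lemma dirichlet_char_mulA : associative dirichlet_char_mul.
Proof. by move=> f g h; apply/dirichlet_char_eqP => n /=; rewrite mulrA. Qed.

Lemma dirichlet_char_mul1 : left_id dirichlet_char_one dirichlet_char_mul.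
Proof.
move=> f; apply/dirichlet_char_eqP => n /=.
have [cnq|ncnq] := boolP (coprime n q); first by rewrite mul1r.
by rewrite mul0r dirichlet_char0.
Qed.

Lemma dirichlet_char_mulV :
  left_inverse dirichlet_char_one dirichlet_char_inv dirichlet_char_mul.
Proof.
move=> f; apply/dirichlet_char_eqP => n /=.
have [cnq|ncnq] := boolP (coprime n q).
  by rewrite mulVf // dirichlet_char_neq0.
by rewrite (dirichlet_char0 f) // mulr0.
Qed.

HB.instance Definition _ := Finite_isGroup.Build (dirichlet_char R q)
  dirichlet_char_mulA dirichlet_char_mul1 dirichlet_char_mulV.

End DirichletCharGroup.

Definition entire (R : realType) (f : R[i] -> R[i]) : Prop :=
  forall z : R[i], derivable (f : R[i]^o -> R[i]^o) z 1.

(* n^(-s) = exp(- s log n), for n >= 1. *)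
Definition nat_cpowN (R : realType) (n : nat) (s : R[i]) : R[i] :=
  let t := - complex.Im s * ln n%:R in
  (expR (- complex.Re s * ln n%:R))%:C * (cos t +i* sin t).

(* [F] is the meromorphic continuation of the Dirichlet series of [chi]. By the
   identity theorem [F] is unique, up to its junk value at s = 1 when [chi] is
   principal. The principal character is [1%g]; the last clause says that
   [F] is then meromorphic on the whole plane with s = 1 as its only pole. *)
Definition is_dirichlet_L (R : realType) (q : nat) (chi : dirichlet_char R q)
    (F : R[i] -> R[i]) : Prop :=
  [/\ forall s : R[i], 1 < complex.Re s ->
        series (fun n : nat => chi n.+1 * nat_cpowN n.+1 s) @ \oo
          --> (F s : R[i]^o),
      chi <> 1%g -> entire F &
      chi = 1%g -> exists (k : nat) (G : R[i] -> R[i]),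
        [/\ (0 < k)%N, entire G, G 1 <> 0 &
            forall s : R[i], s != 1 -> F s = G s / (s - 1) ^+ k]].

Definition calL (R : realType) (q : nat) : R :=
  Num.sqrt (ln q%:R / ln (ln q%:R)).

(* Main.v *)
Require Import Defs.
From mathcomp Require Import all_boot all_order all_algebra all_fingroup cyclic.
From mathcomp Require Import all_classical all_reals all_analysis.
From mathcomp Require Import complex.
From mathcomp Require Import ring lra zify.
Set Implicit Arguments.
Unset Strict Implicit.
Unset Printing Implicit Defensive.
Import Order.TTheory GRing.Theory Num.Theory.
Import numFieldNormedType.Exports.
Import ComplexField.Normc.
Local Open Scope classical_set_scope.
Local Open Scope ring_scope.
Local Open Scope complex_scope.

(** The proof is a resonance argument.  Let [q] be a prime and [H] a subgroup of
   index [h].  Take nonnegative weights [r m] on the integers [m <= N], where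
   [N < q], and let [S x chi] be the sum of [chi n / sqrt n] over [n <= x].  Consider

     the sum over [chi] in [H] of [S x chi * normc (sum_m r m * chi m) ^ 2].

   Expanded, it is a combination with nonnegative coefficients of the sums over [H]
   of [chi (n * m)] times the conjugate of [chi m'].  By orthogonality these are
   [#|H|] or 0, hence never negative, so the whole is at least [#|H| * V], where [V]
   collects the terms with [n * m = m'] ([resonance_lower]).  On the other hand, with
   [S x chi] replaced by the central value, it is at most the maximum of the central
   values over [H] times the sum of the squares of the resonator over ALL characters,
   which is [(q - 1) * W] with [W] the sum of the [r m ^ 2] ([sum_rho]).  As
   [q - 1 = h * #|H|], the maximum is at least [V / (h * W)] up to a bounded error
   ([main_inequality]).  The index enters only through this division, and costs a
   factor [exp (o(calL))].

   Two analytic facts enter.  First, the L-functions have to be constructed.  The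
   Euler-Maclaurin formula for a periodic sequence compares a sum over one period
   with the increment of a boundary term; the defects are summable once enough
   derivatives are taken into account, the regularized sums converge, and since the
   error of the linear approximation in [s] is quadratic and uniform, the limit is
   entire ([em_limit_qdiff]).  For a nonprincipal character this is the L-function;
   for the principal one it is applied to a derivative, which brings in the factor
   [1 - s] and the pole ([Lfun_is_dirichlet_L]).  Second, the central value has to be
   replaced by partial sums.  Averages of partial sums over [X <= x < 2 X] approach it
   within [8 * q ^ 2 / X ^ (3/2)], by two summations by parts, since the sums of a
   periodic sequence of mean zero are again periodic ([smoothed_psum]).

   The principal character lies in [H] and has no small central value, but its
   partial sums are at most [2 * sqrt x], and its resonator at most [N * W].  With
   [X] about [q ^ (4/3)] and [N] about [q ^ (1/3)] this contribution is [O(q * W)] like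
   the error of the average.

   There remains the ratio [V / W].  Soundararajan's resonator lives on squarefree
   integers, with multiplicative weights [r p = lam / (sqrt p * ln p)], on the primes
   between [y], slightly more than [ln q], and a large power of [y].  Then [V / W] is
   about the product of the [1 + r p / sqrt p], that is [exp (lam * sg)] with [sg] the
   sum of [1 / (p ln p)] ([resonator_gain]), as long as [lam ^ 2 * sg] stays below
   [ln N] so that Rankin's trick controls the integers above [N].  Mertens' estimate
   gives [sg] about [1 / ln (ln q)] ([sigma_lower]), so that the best [lam] leads to
   [lam * sg] about [sqrt (ln N / ln (ln q))], which is [calL / sqrt 3]
   ([resonator_exists]).

   All this is carried out with a fixed relative loss, for [q] large in terms of it
   ([maxL_large]); letting the loss tend to 0 slowly with [q] gives the function [eta]
   ([eventually_diagonal]). *)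

(** * Complex numbers, curves and their derivatives *)

Section Modulus.
Variable R : realType.
Implicit Types z w : R[i].

Lemma normcE_norm z : `|z| = (normc z)%:C.
Proof. by []. Qed.

Lemma normc_ge0 z : 0 <= normc z.
Proof. by rewrite -ler0c -normcE_norm. Qed.

Lemma normcB z w : normc (z - w) <= normc z + normc w.
Proof. by rewrite -(normcN w); exact: le_normcD. Qed.

Lemma normc_distC z w : normc (z - w) = normc (w - z).
Proof. by rewrite -normcN opprB. Qed.

Lemma normc_real (x : R) : normc x%:C = `|x|.
Proof. by rewrite /normc/= expr0n/= addr0 sqrtr_sqr. Qed.

Lemma normc_nat n : normc (n%:R : R[i]) = n%:R.
Proof. by rewrite -[n%:R](rmorph_nat (real_complex R)) normc_real normr_nat. Qed.

Lemma normc_sum (I : Type) (s : seq I) (P : pred I) (F : I -> R[i]) :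
  normc (\sum_(i <- s | P i) F i) <= \sum_(i <- s | P i) normc (F i).
Proof.
elim/big_ind2: _ => [|a b c d ab cd|//]; first by rewrite normc0.
by apply: le_trans (le_normcD _ _) _; exact: lerD.
Qed.

Lemma normcX z n : normc (z ^+ n) = normc z ^+ n.
Proof. by elim: n => [|n IH]; rewrite ?expr0 ?normc1// !exprS normcM IH. Qed.

Lemma normRe_le z : `|complex.Re z| <= normc z.
Proof. by have := normc_ge_Re z; rewrite normcE_norm lecR. Qed.

Lemma normIm_le z : `|complex.Im z| <= normc z.
Proof. by have := normRe_le (z * 'i%C); rewrite ReiNIm normrN normcM /= expr0n expr1n /= add0r sqrtr1 mulr1. Qed.

Lemma normc_le_ReIm z : normc z <= `|complex.Re z| + `|complex.Im z|.
Proof.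
case: z => a b /=; apply: le_trans (ler_norm _) _.
rewrite -ler_sqr ?nnegrE ?addr_ge0// real_normK ?num_real// sqr_sqrtr ?addr_ge0 ?sqr_ge0//.
rewrite sqrrD !real_normK ?num_real//.
by rewrite lerD2r lerDl mulrn_wge0// mulr_ge0.
Qed.

Lemma ReM z w : complex.Re (z * w) =
  complex.Re z * complex.Re w - complex.Im z * complex.Im w.
Proof. by case: z => a b; case: w. Qed.

Lemma ImM z w : complex.Im (z * w) =
  complex.Re z * complex.Im w + complex.Im z * complex.Re w.
Proof. by case: z => a b; case: w. Qed.

Lemma ReD z w : complex.Re (z + w) = complex.Re z + complex.Re w.
Proof. by case: z => a b; case: w. Qed.
Lemma ImD z w : complex.Im (z + w) = complex.Im z + complex.Im w.
Proof. by case: z => a b; case: w. Qed.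
Lemma ReN z : complex.Re (- z) = - complex.Re z.
Proof. by case: z. Qed.
Lemma ImN z : complex.Im (- z) = - complex.Im z.
Proof. by case: z. Qed.

Lemma complex_eq z w : complex.Re z = complex.Re w ->
  complex.Im z = complex.Im w -> z = w.
Proof. by case: z => a b; case: w => c d /= -> ->. Qed.

End Modulus.

Section RealDerivative.
Variable R : realType.
Implicit Types (f g : R -> R[i]) (x : R).

(** Curves in the complex plane are differentiated componentwise: the mean value
   theorem and the derivatives of [expR], [cos], [sin] and [ln] are then available. *)
Definition rder f (x : R) (l : R[i]) : Prop :=
  is_derive x 1 (fun t => complex.Re (f t)) (complex.Re l) /\
  is_derive x 1 (fun t => complex.Im (f t)) (complex.Im l).

Lemma rder_eq f x l l' : rder f x l -> l = l' -> rder f x l'.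
Proof. by move=> + <-. Qed.

Lemma rder_ext f g x l : f =1 g -> rder f x l -> rder g x l.
Proof. by move=> /funext ->. Qed.

Lemma rder_real (f : R -> R) x l : is_derive x 1 f l -> rder (fun t => (f t)%:C) x l%:C.
Proof. by move=> fl; split => //=; exact: is_derive_cst. Qed.

Lemma rder_cst (c : R[i]) x : rder (fun=> c) x 0.
Proof. by split; exact: is_derive_cst. Qed.

Lemma rderD f g x a b : rder f x a -> rder g x b -> rder (fun t => f t + g t) x (a + b).
Proof.
move=> [fa fa'] [gb gb']; split.
  under eq_fun do rewrite ReD.
  by rewrite ReD; exact: is_deriveD.
under eq_fun do rewrite ImD.
by rewrite ImD; exact: is_deriveD.
Qed.

Lemma rderM f g x a b : rder f x a -> rder g x b ->
  rder (fun t => f t * g t) x (a * g x + f x * b).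
Proof.
move=> [fa fa'] [gb gb']; split.
  under eq_fun do rewrite ReM.
  apply: (is_derive_eq (is_deriveB (is_deriveM fa gb) (is_deriveM fa' gb'))).
  by rewrite ReD !ReM; rewrite /GRing.scale /=; ring.
under eq_fun do rewrite ImM.
apply: (is_derive_eq (is_deriveD (is_deriveM fa gb') (is_deriveM fa' gb))).
by rewrite ImD !ImM; rewrite /GRing.scale /=; ring.
Qed.

Lemma rderZ (c : R[i]) f x a : rder f x a -> rder (fun t => c * f t) x (c * a).
Proof. by move=> fa; apply: (rder_eq (rderM (rder_cst c x) fa)); rewrite mul0r add0r. Qed.

Lemma rderN f x a : rder f x a -> rder (fun t => - f t) x (- a).
Proof.
move=> fa; rewrite -mulN1r; apply: rder_ext (rderZ (-1) fa) => t.
by rewrite mulN1r.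
Qed.

Lemma rderB f g x a b : rder f x a -> rder g x b -> rder (fun t => f t - g t) x (a - b).
Proof. by move=> fa gb; exact: rderD fa (rderN gb). Qed.

Lemma rder_sum (I : Type) (s : seq I) (F : I -> R -> R[i]) (l : I -> R[i]) x :
  (forall i, rder (F i) x (l i)) ->
  rder (fun t => \sum_(i <- s) F i t) x (\sum_(i <- s) l i).
Proof.
move=> Fl; elim: s => [|i s IH].
  rewrite big_nil; apply: rder_ext (rder_cst 0 x) => t.
  by rewrite big_nil.
rewrite big_cons; apply: rder_ext (rderD (Fl i) IH) => t.
by rewrite big_cons.
Qed.

Lemma rder_comp f (h : R -> R) x l b : rder f (h x) l -> is_derive x 1 h b ->
  rder (fun t => f (h t)) x (l * b%:C).
Proof.
move=> [fl fl'] hb; split.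
  apply: (is_derive_eq (is_derive1_comp fl hb)).
  by rewrite ReM /= mulr0 subr0.
apply: (is_derive_eq (is_derive1_comp fl' hb)).
by rewrite ImM /= mulr0 add0r.
Qed.

(** The constant 2 is lost because the mean value theorem is applied to the real
   and imaginary parts separately. *)
Lemma rder_mvt f (g : R -> R[i]) (a b B : R) : a <= b ->
  (forall x, a <= x <= b -> rder f x (g x)) ->
  (forall x, a <= x <= b -> normc (g x) <= B) ->
  normc (f b - f a) <= 2 * B * (b - a).
Proof.
move=> ab fg gB.
have mvt (h dh : R -> R) : (forall x, a <= x <= b -> is_derive x 1 h (dh x)) ->
    (forall x, a <= x <= b -> `|dh x| <= B) -> `|h b - h a| <= B * (b - a).
  move=> hdh dhB.
  have hc : {within `[a, b], continuous h}.
    apply: derivable_within_continuous => x /[!in_itv]/= xab.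
    by have [] := hdh x xab.
  have hd x : x \in `]a, b[ -> is_derive x 1 h (dh x).
    by rewrite in_itv/= => /andP[ax xb]; apply: hdh; rewrite !ltW.
  have [c + ->] := MVT_segment ab hd hc; rewrite in_itv/= => cab.
  rewrite normrM (ger0_norm (_ : 0 <= b - a)) ?subr_ge0//.
  by rewrite ler_wpM2r ?subr_ge0// dhB.
apply: le_trans (normc_le_ReIm _) _.
rewrite !ReD !ImD !ReN !ImN -mulrA mulr_natl mulr2n; apply: lerD.
  apply: (mvt (fun x => complex.Re (f x)) (fun x => complex.Re (g x))).
    by move=> x /fg[].
  by move=> x /gB; apply: le_trans; exact: normRe_le.
apply: (mvt (fun x => complex.Im (f x)) (fun x => complex.Im (g x))).
  by move=> x /fg[].
by move=> x /gB; apply: le_trans; exact: normIm_le.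
Qed.

End RealDerivative.

(** * The complex exponential and Taylor expansion *)

Section ComplexExp.
Variable R : realType.
Implicit Types (z w : R[i]) (x t : R).

Definition cexp z : R[i] :=
  (expR (complex.Re z))%:C * (cos (complex.Im z) +i* sin (complex.Im z)).

Lemma cexpD z w : cexp (z + w) = cexp z * cexp w.
Proof.
rewrite /cexp; apply: complex_eq.
  rewrite !ReM !ImM /= ReD ImD expRD cosD; ring.
rewrite !ImM !ReM /= ReD ImD expRD sinD; ring.
Qed.

Lemma cexp0 : cexp 0 = 1.
Proof. by rewrite /cexp /= expR0 cos0 sin0 mul1r. Qed.

Lemma normc_cexp z : normc (cexp z) = expR (complex.Re z).
Proof.
rewrite normcM normc_real ger0_norm ?expR_ge0//= cos2Dsin2 sqrtr1 mulr1.
by [].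
Qed.

Lemma rder_cexp (f : R -> R[i]) x l : rder f x l ->
  rder (fun t => cexp (f t)) x (l * cexp (f x)).
Proof.
move=> [fl fl']; split.
  under eq_fun do rewrite ReM /= mul0r subr0.
  have He := is_derive1_comp (is_derive_expR (complex.Re (f x))) fl.
  have Hc := is_derive1_comp (is_derive_cos (complex.Im (f x))) fl'.
  apply: (is_derive_eq (is_deriveM He Hc)).
  by rewrite /= /cexp !ReM !ImM /GRing.scale /=; ring.
under eq_fun do rewrite ImM /= mul0r addr0.
have He := is_derive1_comp (is_derive_expR (complex.Re (f x))) fl.
have Hc := is_derive1_comp (is_derive_sin (complex.Im (f x))) fl'.
apply: (is_derive_eq (is_deriveM He Hc)).
by rewrite /= /cexp ImM !ReM !ImM /GRing.scale /=; ring.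
Qed.

Let path z x : rder (fun t => t%:C * z) x z.
Proof.
apply: (rder_eq (rderM (rder_real (is_derive_id x 1)) (rder_cst z x))).
by rewrite mulr0 addr0 mul1r.
Qed.

Lemma normc_cexp_path z x : 0 <= x <= 1 -> normc (cexp (x%:C * z)) <= expR (normc z).
Proof.
move=> /andP[x0 x1]; rewrite normc_cexp ler_expR ReM /= mul0r subr0.
apply: le_trans (ler_norm _) _; rewrite normrM (ger0_norm x0).
apply: le_trans (_ : 1 * `|complex.Re z| <= _); first exact: ler_wpM2r.
by rewrite mul1r normRe_le.
Qed.

Lemma normc_cexpB1_path z x : 0 <= x <= 1 ->
  normc (cexp (x%:C * z) - 1) <= 2 * (normc z * expR (normc z)).
Proof.
move=> /andP[x0 x1].
have := @rder_mvt R (fun t => cexp (t%:C * z)) (fun t => z * cexp (t%:C * z)) 0 x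
  (normc z * expR (normc z)) x0.
rewrite mul0r cexp0 subr0 => H.
apply: le_trans (H _ _) _.
- by move=> t _; apply: rder_cexp; exact: path.
- move=> t /andP[t0 tx]; rewrite normcM ler_wpM2l ?normc_ge0//.
  by rewrite normc_cexp_path// t0 (le_trans tx x1).
- by rewrite ler_piMr// mulr_ge0// mulr_ge0 ?normc_ge0// expR_ge0.
Qed.

Lemma normc_cexpB1 z : normc (cexp z - 1) <= 2 * (normc z * expR (normc z)).
Proof. by have := @normc_cexpB1_path z 1; rewrite mul1r; apply; rewrite ler01 lexx. Qed.

Lemma normc_cexpB1D z :
  normc (cexp z - 1 - z) <= 4 * (normc z ^+ 2 * expR (normc z)).
Proof.
have := @rder_mvt R (fun t => cexp (t%:C * z) - 1 - t%:C * z)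
   (fun t => z * (cexp (t%:C * z) - 1)) 0 1
  (normc z * (2 * (normc z * expR (normc z)))) ler01.
rewrite mul0r cexp0 subrr !subr0 mul1r => H.
apply: le_trans (H _ _) _.
- move=> t _; apply: (rder_eq (rderB (rderB (rder_cexp (path z t)) (rder_cst 1 t)) (path z t))).
  by rewrite subr0 mulrBr mulr1.
- move=> t t01; rewrite normcM ler_wpM2l ?normc_ge0//.
  exact: normc_cexpB1_path.
- by rewrite le_eqVlt; apply/orP; left; apply/eqP; ring.
Qed.

Lemma cexp_real x : cexp x%:C = (expR x)%:C.
Proof.
rewrite /cexp /= sin0 cos0.
by rewrite -[X in _ * X]/(1%:C) -rmorphM mulr1.
Qed.

(** Euler's form of [n ^ (- s)]; it gives access to the functional equation of the
   exponential. *)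
Lemma nat_cpowNE n (s : R[i]) : nat_cpowN n s = cexp (- s * (ln n%:R)%:C).
Proof. by rewrite /nat_cpowN /cexp ReM ImM /= ReN ImN !mulr0 subr0 add0r. Qed.

End ComplexExp.

#[global] Opaque cexp.

Section TaylorChain.
Variable R : realType.
Implicit Types (u : nat -> R -> R[i]) (x t b : R).

(** A function is carried together with all its derivatives, as powers of [x] are
   known only through closed formulas for their derivatives. *)
Definition chain u := forall i t, 0 < t -> rder (u i) t (u i.+1 t).

Lemma chain_shift k u : chain u -> chain (fun i => u (i + k)%N).
Proof. by move=> uc i t t0; exact: uc. Qed.

Definition taylor n u x (r : R) : R[i] := \sum_(i < n) u i x * (r ^+ i / i`!%:R)%:C.

Lemma is_derive_monomial i (r : R) :
  is_derive r 1 (fun t : R => t ^+ i.+1 / i.+1`!%:R) (r ^+ i / i`!%:R).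
Proof.
have H := is_deriveZ (i.+1`!%:R^-1 : R) (@is_deriveX R R id i.+1 r 1 1 (is_derive_id r 1)).
have -> : (fun t : R => t ^+ i.+1 / i.+1`!%:R) =
    (i.+1`!%:R^-1 : R) \*: ((@id R) ^+ i.+1 : R -> R).
  by apply/funext => t; rewrite mulrC /= exprfctE.
apply: (is_derive_eq H).
rewrite /GRing.scale/= factS natrM invfM mulr1.
by rewrite mulrACA mulVf ?pnatr_eq0// mul1r mulrC.
Qed.

(** Each derivative costs one use of the mean value inequality, and its factor 2;
   this is harmless, since [n] stays fixed. *)
Lemma taylor_bound n u x b (r : R) : chain u -> 0 < x -> 0 <= r ->
  (forall t, x <= t -> normc (u n t) <= b) ->
  normc (u 0%N (x + r) - taylor n u x r) <= 2 ^+ n * r ^+ n * b.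
Proof.
elim: n u r => [|n IH] u r uc x0 r0 ub.
  by rewrite /taylor big_ord0 subr0 !mul1r; apply: ub; rewrite lerDl.
have b0 : 0 <= b by apply: le_trans (ub x (lexx x)); exact: normc_ge0.
have := @rder_mvt R (fun t => u 0%N (x + t) - taylor n.+1 u x t)
  (fun t => u 1%N (x + t) - taylor n (fun i => u (i + 1)%N) x t) 0 r
  (2 ^+ n * r ^+ n * b) r0.
have -> : taylor n.+1 u x 0 = u 0%N x.
  rewrite /taylor big_ord_recl big1 => [|i _].
    by rewrite expr0 fact0 divr1 mulr1 addr0.
  by rewrite /= expr0n /= mul0r mulr0.
rewrite addr0 subrr subr0 => H; apply: le_trans (H _ _) _.
- move=> t /andP[t0 tr]; apply: rderB.
    have := rder_comp (uc 0%N (x + t) (ltr_pwDl x0 t0)) (_ : is_derive t 1 (fun t => x + t) 1).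
    rewrite mulr1; apply.
    by apply: (is_derive_eq (is_deriveD (is_derive_cst x t 1) (is_derive_id t 1))); rewrite add0r.
  rewrite /taylor; apply: rder_ext (fun t => u 0%N x + \sum_(i < n) u i.+1 x * (t ^+ i.+1 / i.+1`!%:R)%:C) _ _ _ _ _.
    by move=> y; rewrite big_ord_recl /= expr0 fact0 divr1 mulr1.
  rewrite -[X in rder _ _ X]add0r; apply: rderD; first exact: rder_cst.
  apply: rder_sum => i; rewrite addn1; apply: rderZ; apply: rder_real.
  exact: is_derive_monomial.
- move=> t /andP[t0 tr].
  apply: le_trans (IH (fun i => u (i + 1)%N) t _ _ t0 _) _ => //.
  + exact: chain_shift.
  + by move=> y xy; rewrite addn1; exact: ub.
  + by rewrite ler_wpM2r// ler_wpM2l ?exprn_ge0// lerXn2r// nnegrE.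
- by rewrite le_eqVlt; apply/orP; left; apply/eqP; rewrite !exprS; ring.
Qed.

End TaylorChain.

(** * Euler-Maclaurin summation with periodic coefficients *)

Section EulerMaclaurin.
Variable R : realType.
Variables (q : nat) (f : nat -> R[i]) (d : nat).
Hypothesis q_gt0 : (0 < q)%N.
Implicit Types (u : nat -> R -> R[i]) (x t b : R).

Definition taylor_mono i (r : R) : R[i] := (r ^+ i / i`!%:R)%:C.

Lemma taylor_bound_at k n u x b r : chain u -> (k <= n)%N -> 0 < x -> 0 <= r ->
  (forall t, x <= t -> normc (u n t) <= b) ->
  normc (u k (x + r) - \sum_(k <= i < n) u i x * taylor_mono (i - k) r)
    <= 2 ^+ (n - k) * r ^+ (n - k) * b.
Proof.
move=> uc kn x0 r0 ub.
have := @taylor_bound R (n - k) (fun i => u (i + k)%N) x b r (chain_shift k uc) x0 r0.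
rewrite subnK// => /(_ ub); congr (normc (_ - _) <= _).
rewrite /taylor -[in RHS](add0n k) big_addn big_mkord add0n.
by apply: eq_bigr => i _; rewrite addnK.
Qed.

(** The derivative of order [d] of [u 0] is summed.  With [d = 1] the boundary terms
   involve the antiderivative [u 0], which accounts for sequences whose mean is not
   zero. *)
Definition block u x : R[i] := \sum_(r < q) f r.+1 * u d (x + r%:R).

(** The coefficient of [u i x] in the Taylor expansion of [block u x] at [x]. *)
Definition block_coef i : R[i] :=
  \sum_(r < q) f r.+1 * (if (d <= i)%N then taylor_mono (i - d) r%:R else 0).

(** The coefficients solve, degree by degree, the equations that make the increment
   of the boundary term over one period and the block of one period have the same
   Taylor expansion (see [em_coefE]).  Each equation involves all earlier
   coefficients, so the recursion carries their list. *)
Fixpoint em_coefs n : seq R[i] :=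
  if n is m.+1 then
    let s := em_coefs m in
    rcons s ((block_coef m.+1 - \sum_(k < m) s`_k * taylor_mono (m.+1 - k) q%:R) / q%:R)
  else [::].

Definition em_coef k : R[i] := (em_coefs k.+1)`_k.

Lemma size_em_coefs n : size (em_coefs n) = n.
Proof. by elim: n => //= n IH; rewrite size_rcons IH. Qed.

Lemma nth_em_coefs n k : (k < n)%N -> (em_coefs n)`_k = em_coef k.
Proof.
elim: n => // n IH; rewrite ltnS leq_eqVlt => /orP[/eqP -> //|kn].
by rewrite /= nth_rcons size_em_coefs kn IH.
Qed.

Lemma em_coefE i : \sum_(k < i.+1) em_coef k * taylor_mono (i.+1 - k) q%:R = block_coef i.+1.
Proof.
rewrite big_ord_recr /= subSnn {2}/em_coef /= nth_rcons size_em_coefs ltnn eqxx.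
under eq_bigr do rewrite -(nth_em_coefs (ltn_ord _)).
rewrite /taylor_mono expr1 (_ : 1`! = 1)%N// divr1 rmorph_nat divfK ?pnatr_eq0 -?lt0n//.
by rewrite addrC subrK.
Qed.

Definition em_boundary N u x : R[i] := \sum_(k < N) em_coef k * u k x.

(** Over one period the block is compared with the increment of the boundary term
   [em_boundary]; the Euler-Maclaurin formula is the telescoping sum of these
   comparisons. *)
Definition em_defect N u x : R[i] :=
  block u x - (em_boundary N u (x + q%:R) - em_boundary N u x).

Hypothesis block_coef0 : block_coef 0 = 0.

Let block_main n u x :
  \sum_(r < q) f r.+1 * (\sum_(d <= i < n) u i x * taylor_mono (i - d) r%:R)
  = \sum_(0 <= i < n) u i x * block_coef i.
Proof.
under [RHS]eq_bigr do rewrite big_distrr.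
rewrite [RHS]exchange_big; apply: eq_bigr => r _ /=.
rewrite (big_nat_widenl _ 0%N)// big_mkcond /= big_distrr /=.
apply: eq_bigr => i _; case: ifP => _; last by rewrite !mulr0.
by rewrite mulrCA.
Qed.

Let em_boundary_main N u x :
  \sum_(k < N) em_coef k * (\sum_(k.+1 <= i < N.+1) u i x * taylor_mono (i - k) q%:R)
  = \sum_(0 <= i < N.+1) u i x * block_coef i.
Proof.
transitivity (\sum_(0 <= i < N.+1) u i x * \sum_(0 <= k < i) em_coef k * taylor_mono (i - k) q%:R).
  rewrite -(big_mkord xpredT (fun k => em_coef k *
     (\sum_(k.+1 <= i < N.+1) u i x * taylor_mono (i - k) q%:R))).
  transitivity (\sum_(0 <= k < N) \sum_(0 <= i < N.+1)
       if (k < i)%N then u i x * (em_coef k * taylor_mono (i - k) q%:R) else 0).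
    apply: eq_bigr => k _.
    rewrite (big_nat_widenl _ 0%N)// big_mkcond /= big_distrr /=.
    by apply: eq_bigr => i _; case: ifP => _; rewrite ?mulr0// mulrCA.
  rewrite exchange_big; apply: eq_big_nat => i /andP[_]; rewrite ltnS => iN.
  rewrite (big_nat_widen _ _ _ _ _ iN) [in RHS]big_mkcond big_distrr /=.
  by apply: eq_bigr => k _; case: ifP => _; rewrite ?mulr0.
apply: eq_bigr => -[|i] _; first by rewrite big_geq// block_coef0.
by rewrite big_mkord em_coefE.
Qed.

(** By the choice of the coefficients, the Taylor polynomials of the block and of
   the increment of the boundary term coincide up to degree [N]: only the two
   remainders are left.  The term of degree 0 is the hypothesis that [block_coef 0]
   vanishes, for no boundary term can produce it. *)
Lemma em_defect_bound N : (d <= N.+1)%N -> exists2 C, 0 <= C &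
  forall u x b, chain u -> 0 < x ->
    (forall t, x <= t -> normc (u N.+1 t) <= b) ->
    normc (em_defect N u x) <= C * b.
Proof.
move=> dN.
exists (\sum_(r < q) normc (f r.+1) * (2 ^+ (N.+1 - d) * r%:R ^+ (N.+1 - d)) +
        \sum_(k < N) normc (em_coef k) * (2 ^+ (N.+1 - k) * q%:R ^+ (N.+1 - k))).
  by apply: addr_ge0; apply: sumr_ge0 => i _;
    rewrite !mulr_ge0 ?normc_ge0 ?exprn_ge0.
move=> u x b uc x0 ub.
have -> : em_defect N u x =
   \sum_(r < q) f r.+1 * (u d (x + r%:R) -
      \sum_(d <= i < N.+1) u i x * taylor_mono (i - d) r%:R) -
   \sum_(k < N) em_coef k * (u k (x + q%:R) -
      \sum_(k <= i < N.+1) u i x * taylor_mono (i - k) q%:R).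
  under eq_bigr do rewrite mulrBr.
  rewrite sumrB block_main -(em_boundary_main N u x) /em_defect /em_boundary /block -sumrB.
  rewrite -addrA -opprD -big_split /=; congr (_ - _); apply: eq_bigr => k _.
  rewrite [in RHS](big_ltn (_ : (k < N.+1)%N)); last by rewrite ltnW// ltnS ltn_ord.
  rewrite subnn /taylor_mono expr0 fact0 divr1 rmorph1; ring.
apply: le_trans (normcB _ _) _; rewrite mulrDl; apply: lerD.
  apply: le_trans (normc_sum _ _ _) _; rewrite big_distrl; apply: ler_sum => r _ /=.
  rewrite normcM -mulrA; apply: ler_wpM2l; first exact: normc_ge0.
  exact: taylor_bound_at.
apply: le_trans (normc_sum _ _ _) _; rewrite big_distrl; apply: ler_sum => k _ /=.
rewrite normcM -mulrA; apply: ler_wpM2l; first exact: normc_ge0.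
by apply: taylor_bound_at => //; rewrite ltnW// ltnS ltnW.
Qed.

Lemma sum_blocksE N u M :
  \sum_(m < M) block u ((m * q).+1%:R) =
  \sum_(m < M) em_defect N u ((m * q).+1%:R) +
    (em_boundary N u ((M * q).+1%:R) - em_boundary N u 1).
Proof.
elim: M => [|M IH]; first by rewrite !big_ord0 mul0n subrr addr0.
rewrite !big_ord_recr /= IH /em_defect.
have -> : ((M * q).+1%:R + q%:R : R) = (M.+1 * q).+1%:R.
  by rewrite -natrD mulSn addSn addnC.
ring.
Qed.

End EulerMaclaurin.

(** * The powers of x as functions of the exponent *)

Section PowerChains.
Variable R : realType.
Implicit Types (w h : R[i]) (p : {poly R[i]}) (t y : R).

(** The [i]-th derivative of [x ^ (- w)] is [x ^ (- w - i)] times the value at [w] of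
   this polynomial, the product of the [- (w + j)] for [j < i]. *)
Fixpoint pow_coef i : {poly R[i]} :=
  if i is j.+1 then pow_coef j * (- ('X + (j%:R)%:P)) else 1.

Definition pw w i t : R[i] := (pow_coef i).[w] * cexp (- (w + i%:R) * (ln t)%:C).

(** The derivative of [pw w i t] with respect to [w]. *)
Definition dpw w i t : R[i] :=
  ((pow_coef i)^`().[w] - (pow_coef i).[w] * (ln t)%:C) * cexp (- (w + i%:R) * (ln t)%:C).

(** The remainder of the first order expansion in [h].  It is itself a chain, so the
   Euler-Maclaurin estimates apply to it and yield differentiability in [w]. *)
Definition psi w h i t : R[i] := pw (w + h) i t - pw w i t - h * dpw w i t.

Let rder_ln t : 0 < t -> rder (fun t => (ln t)%:C) t (t^-1)%:C.
Proof. by move=> t0; apply: rder_real; exact: is_derive1_ln. Qed.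

Let rder_cexp_ln w i t : 0 < t ->
  rder (fun t => cexp (- (w + i%:R) * (ln t)%:C)) t
    (- (w + i%:R) * cexp (- (w + i.+1%:R) * (ln t)%:C)).
Proof.
move=> t0; apply: rder_eq (rder_cexp (rderZ _ (rder_ln t0))) _.
have -> : - (w + i.+1%:R) * (ln t)%:C = - (w + i%:R) * (ln t)%:C + (- (ln t))%:C.
  by rewrite -natr1 rmorphN /=; ring.
rewrite [in RHS]cexpD; suff -> : cexp (- ln t)%:C = (t^-1)%:C :> R[i] by ring.
by rewrite cexp_real expRN lnK ?posrE.
Qed.

Lemma chain_pw w : chain (pw w).
Proof.
move=> i t t0; apply: rder_eq (rderZ _ (rder_cexp_ln w i t0)) _.
by rewrite /pw /= !(hornerM, hornerN, hornerD, hornerX, hornerC); ring.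
Qed.

Lemma chain_dpw w : chain (dpw w).
Proof.
move=> i t t0.
have H := rderM (rderB (rder_cst (pow_coef i)^`().[w] t) (rderZ (pow_coef i).[w] (rder_ln t0)))
  (rder_cexp_ln w i t0).
apply: rder_eq H _; rewrite /dpw /= derivM derivN derivD derivX derivC.
rewrite !(hornerM, hornerN, hornerD, hornerX, hornerC).
have -> : cexp (- (w + i%:R) * (ln t)%:C) = t%:C * cexp (- (w + i.+1%:R) * (ln t)%:C).
  have -> : - (w + i%:R) * (ln t)%:C = (ln t)%:C - (w + i.+1%:R) * (ln t)%:C.
    by rewrite -natr1; ring.
  rewrite cexpD mulNr; congr (_ * _).
  by rewrite cexp_real lnK ?posrE.
have tt : (t^-1)%:C * t%:C = 1 :> R[i] by rewrite -rmorphM mulVf ?gt_eqF.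
rewrite /= sub0r mulNr -!mulrA (mulrA (t^-1)%:C) tt; ring.
Qed.

Lemma chain_psi w h : chain (psi w h).
Proof.
move=> i t t0; apply: rderB; first by apply: rderB; exact: chain_pw.
by apply: rderZ; exact: chain_dpw.
Qed.

Lemma poly_taylor2 p w : exists2 C, 0 <= C & forall h, normc h <= 1 ->
  normc (p.[w + h] - p.[w] - h * p^`().[w]) <= C * normc h ^+ 2.
Proof.
elim/poly_ind: p => [|p c [C C0 IH]].
  exists 0 => // h _; rewrite deriv0 !horner0 subrr mulr0 subrr normc0.
  by rewrite mul0r.
exists (C * (normc w + 1) + normc (p^`().[w])).
  by rewrite addr_ge0 ?mulr_ge0 ?addr_ge0 ?normc_ge0.
move=> h h1; rewrite derivD derivM derivX derivC.
rewrite !(hornerM, hornerN, hornerD, hornerX, hornerC).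
set a := p.[w + h]; set b := p.[w]; set e := p^`().[w].
have -> : a * (w + h) + c - (b * w + c) - h * (e * w + b * 1 + 0) =
  (a - b - h * e) * (w + h) + h ^+ 2 * e by ring.
apply: le_trans (le_normcD _ _) _; rewrite !normcM.
rewrite [leRHS](_ : _ = C * normc h ^+ 2 * (normc w + 1) + normc h * normc h * normc e); last by ring.
apply: lerD => //; apply: ler_pM; rewrite ?normc_ge0//; first exact: IH.
by apply: le_trans (le_normcD _ _) _; rewrite lerD2l.
Qed.

Lemma normc_cexp_ln w i t :
  normc (cexp (- (w + i%:R) * (ln t)%:C)) = expR (- (complex.Re w + i%:R) * ln t).
Proof.
rewrite normc_cexp ReM /= mulr0 subr0 ReN ReD.
by rewrite -(rmorph_nat (real_complex R) i).
Qed.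

Lemma normc_pw w i t : normc (pw w i t) =
  normc (pow_coef i).[w] * expR (- (complex.Re w + i%:R) * ln t).
Proof. by rewrite normcM normc_cexp_ln. Qed.

Lemma ler_expR_id y : y <= expR y.
Proof. by apply: le_trans (expR_ge1Dx y); rewrite lerDr. Qed.

Lemma normc_dpw w i : exists2 C, 0 <= C & forall t, 1 <= t ->
  normc (dpw w i t) <= C * expR ((3 - (complex.Re w + i%:R)) * ln t).
Proof.
exists (normc (pow_coef i)^`().[w] + normc (pow_coef i).[w]).
  by rewrite addr_ge0 ?normc_ge0.
move=> t t1; have y0 : 0 <= ln t by exact: ln_ge0.
rewrite /dpw normcM normc_cexp_ln [(3 - _) * _]mulrDl expRD mulrA.
apply: ler_wpM2r; first exact: expR_ge0.
apply: le_trans (normcB _ _) _; rewrite mulrDl; apply: lerD.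
  by rewrite ler_peMr ?normc_ge0// -expR0 ler_expR mulr_ge0.
rewrite normcM normc_real ger0_norm// ler_wpM2l ?normc_ge0//.
by apply: le_trans (ler_expR_id _) _; rewrite ler_expR ler_peMl//; lra.
Qed.

(** The factor [ln t ^ 2] of the second derivative in [w], and the size of
   [t ^ (- h)], are bounded crudely by [t ^ 3]: a larger order [N] makes up for it. *)
Lemma normc_psi w i : exists2 C, 0 <= C & forall h t, normc h <= 1 -> 1 <= t ->
  normc (psi w h i t) <= C * normc h ^+ 2 * expR ((3 - (complex.Re w + i%:R)) * ln t).
Proof.
have [C C0 HC] := poly_taylor2 (pow_coef i) w.
exists (C + normc (pow_coef i).[w] * 4 + normc (pow_coef i)^`().[w] * 2).
  by rewrite !addr_ge0 ?mulr_ge0 ?normc_ge0.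
move=> h t h1 t1; set y := ln t; have y0 : 0 <= y by exact: ln_ge0.
set B := cexp (- (w + i%:R) * y%:C).
set e := cexp (- h * y%:C).
have -> : psi w h i t = B * (((pow_coef i).[w + h] - (pow_coef i).[w] - h * (pow_coef i)^`().[w]) * e
   + (pow_coef i).[w] * (e - 1 - (- h * y%:C)) + h * (pow_coef i)^`().[w] * (e - 1)).
  have -> : psi w h i t = (pow_coef i).[w + h] * (B * e) - (pow_coef i).[w] * B
     - h * (((pow_coef i)^`().[w] - (pow_coef i).[w] * y%:C) * B).
    rewrite /psi /pw /dpw -/y -/B /B /e -cexpD; congr (_ * cexp _ - _ - _); ring.
  ring.
rewrite normcM normc_cexp_ln -/y [(3 - _) * _]mulrDl expRD.
rewrite [X in _ <= X]mulrA [X in X <= _]mulrC.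
apply: ler_wpM2r; first exact: expR_ge0.
have nhy : normc (- h * y%:C) = normc h * y.
  by rewrite normcM normcN normc_real ger0_norm.
have hy : normc h * y <= y by rewrite ler_piMl.
have ehy : expR (normc h * y) <= expR y by rewrite ler_expR.
have h0 := normc_ge0 h.
have e1 : 1 <= expR y by rewrite -expR0 ler_expR.
have E3 : expR (3 * y) = expR y * expR y * expR y by rewrite -!expRD; congr expR; ring.
have ye := ler_expR_id y.
have en : normc e <= expR (3 * y).
  rewrite normc_cexp ler_expR; apply: le_trans (ler_norm _) _.
  apply: le_trans (normRe_le _) _; rewrite nhy; apply: le_trans hy _.
  by rewrite ler_peMl//; lra.
have en1 : normc (e - 1) <= 2 * normc h * expR (3 * y).
  apply: le_trans (normc_cexpB1 _) _; rewrite nhy -!mulrA; apply: ler_wpM2l => //.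
  apply: ler_wpM2l => //; rewrite E3 -mulrA.
  apply: ler_pM; rewrite ?expR_ge0//.
  by apply: le_trans ehy _; rewrite ler_peMl// ?expR_ge0.
have en2 : normc (e - 1 - (- h * y%:C)) <= 4 * normc h ^+ 2 * expR (3 * y).
  apply: le_trans (normc_cexpB1D _) _; rewrite nhy.
  rewrite [leLHS](_ : _ = 4 * normc h ^+ 2 * (y * y * expR (normc h * y))); last by ring.
  apply: ler_wpM2l; first by rewrite mulr_ge0 ?exprn_ge0.
  rewrite E3; apply: ler_pM; rewrite ?mulr_ge0 ?expR_ge0//.
  by apply: ler_pM.
apply: le_trans (le_normcD _ _) _.
rewrite [leRHS](_ : _ = C * normc h ^+ 2 * expR (3 * y)
  + normc (pow_coef i).[w] * (4 * normc h ^+ 2 * expR (3 * y))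
  + normc h * normc (pow_coef i)^`().[w] * (2 * normc h * expR (3 * y))); last by ring.
apply: lerD.
  apply: le_trans (le_normcD _ _) _; apply: lerD.
    by rewrite normcM; apply: ler_pM; rewrite ?normc_ge0//; exact: HC.
  by rewrite normcM; apply: ler_wpM2l => //; exact: normc_ge0.
by rewrite !normcM; apply: ler_wpM2l => //; rewrite mulr_ge0 ?normc_ge0.
Qed.

End PowerChains.

(** * Regularized sums and their limits *)

Section ComplexLimits.
Variable R : realType.
Implicit Types (a b : nat -> R[i]) (l : R[i]) (e : nat -> R).

(** Convergence through real distances, which makes squeezing arguments
   elementary. *)
Definition ccvg a l : Prop := normc (a n - l) @[n --> \oo] --> (0 : R).

Let cvgD0 (x y : nat -> R) : x n @[n --> \oo] --> (0 : R) ->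
  y n @[n --> \oo] --> (0 : R) -> x n + y n @[n --> \oo] --> (0 : R).
Proof. by move=> x0 y0; rewrite -[0](addr0 0); exact: cvgD. Qed.

Lemma ccvg_bound a e l : (forall n, normc (a n - l) <= e n) ->
  e n @[n --> \oo] --> (0 : R) -> ccvg a l.
Proof.
move=> ae e0; apply: (squeeze_cvgr _ (cvg_cst (0 : R)) e0); near=> n.
by rewrite normc_ge0/=.
Unshelve. all: by end_near. Qed.

Lemma ccvg_squeeze a b e l : (forall n, normc (a n - b n) <= e n) ->
  e n @[n --> \oo] --> (0 : R) -> ccvg b l -> ccvg a l.
Proof.
move=> ab e0 bl; apply: ccvg_bound (cvgD0 e0 bl) => n.
have -> : a n - l = (a n - b n) + (b n - l) by ring.
by apply: le_trans (le_normcD _ _) _; apply: lerD.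
Qed.

Lemma ccvg_cst l : ccvg (fun=> l) l.
Proof. by rewrite /ccvg subrr normc0; exact: cvg_cst. Qed.

Lemma ccvgD a b l l' : ccvg a l -> ccvg b l' -> ccvg (fun n => a n + b n) (l + l').
Proof.
move=> al bl; apply: ccvg_bound (cvgD0 al bl) => n.
have -> : a n + b n - (l + l') = (a n - l) + (b n - l') by ring.
exact: le_normcD.
Qed.

Lemma ccvgZ c a l : ccvg a l -> ccvg (fun n => c * a n) (c * l).
Proof.
move=> al; apply: (@ccvg_bound _ (fun n => normc c * normc (a n - l))) => [n|].
  by rewrite -mulrBr normcM.
by rewrite -[0](mulr0 (normc c)); apply: cvgM => //; exact: cvg_cst.
Qed.

Lemma ccvgB a b l l' : ccvg a l -> ccvg b l' -> ccvg (fun n => a n - b n) (l - l').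
Proof.
move=> al bl; have := ccvgD al (ccvgZ (-1) bl); rewrite mulN1r.
by under eq_fun do rewrite mulN1r.
Qed.

Lemma ccvg_le a l (B : R) : (forall n, normc (a n) <= B) -> ccvg a l -> normc l <= B.
Proof.
move=> aB al; rewrite -subr_le0.
have : normc l - B <= lim (normc (a n - l) @[n --> \oo]).
  apply: limr_ge; first by apply/cvg_ex; exists 0.
  near=> n; rewrite lerBlDr; have {1}-> : l = a n - (a n - l) by ring.
  by apply: le_trans (normcB _ _) _; rewrite addrC lerD2l.
by rewrite (cvg_lim (@Rhausdorff R) al).
Unshelve. all: by end_near. Qed.

Lemma ccvg_uniq a l l' : ccvg a l -> ccvg a l' -> l = l'.
Proof.
move=> al al'; have := ccvgB al al'; under eq_fun do rewrite subrr.
move=> H; have : normc (l - l') <= 0 by apply: ccvg_le H => n; rewrite normc0.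
move=> le0; apply/eqP; rewrite -subr_eq0; apply/eqP/eq0_normc/eqP.
by rewrite eq_le normc_ge0 andbT.
Qed.

Lemma ccvg_ReIm a (x y : R) : complex.Re (a n) @[n --> \oo] --> x ->
  complex.Im (a n) @[n --> \oo] --> y -> ccvg a (x +i* y).
Proof.
have H0 (b : nat -> R) z : b n @[n --> \oo] --> z ->
    `|b n - z| @[n --> \oo] --> (0 : R).
  move=> bz; rewrite -(@normr0 _ R) -(subrr z).
  by apply: cvg_norm; apply: cvgB => //; exact: cvg_cst.
move=> /H0 ax /H0 ay; apply: ccvg_bound (cvgD0 ax ay) => n.
apply: le_trans (normc_le_ReIm _) _.
by rewrite ReD ImD ReN ImN.
Qed.

Lemma sum_inv_sqr_le (n : nat) : \sum_(m < n.+1) (m.+1%:R ^+ 2)^-1 <= 2 - n.+1%:R^-1 :> R.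
Proof.
elim: n => [|n IH]; first by rewrite big_ord1 expr1n invr1; lra.
rewrite big_ord_recr /=; apply: le_trans (lerD IH (lexx _)) _.
have n0 : 0 < n.+1%:R :> R by rewrite ltr0n.
have -> : n.+2%:R = n.+1%:R + 1 :> R by rewrite natr1.
move: (n.+1%:R : R) n0 => x x0.
rewrite -subr_ge0 [leRHS](_ : _ = (x * (x + 1) ^+ 2)^-1); last by field; lra.
by rewrite invr_ge0 mulr_ge0 ?exprn_ge0 ?addr_ge0// ltW.
Qed.

Lemma is_cvg_sum_le_inv_sqr (x : nat -> R) A : (forall m, `|x m| <= A / m.+1%:R ^+ 2) ->
  cvgn (series x).
Proof.
move=> xA; apply: normed_cvg.
have A0 : 0 <= A.
  by have := xA 0%N; rewrite expr1n divr1; apply: le_trans.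
have v0 n : 0 <= A / n.+1%:R ^+ 2 by rewrite divr_ge0 ?exprn_ge0.
apply: (@series_le_cvg _ _ (fun m => A / m.+1%:R ^+ 2)) => // [n|].
  exact: normr_ge0.
apply: nondecreasing_is_cvgn.
  by apply: nondecreasing_series => n _.
exists (A * 2) => _ [[|n] _ <-].
  by rewrite /series/= big_nil mulr_ge0.
rewrite /series/= big_mkord -mulr_sumr ler_wpM2l//.
by apply: le_trans (sum_inv_sqr_le n) _; rewrite gerBl invr_ge0.
Qed.

Lemma ccvg_sum_le_inv_sqr a A : (forall m, normc (a m) <= A / m.+1%:R ^+ 2) ->
  exists l, ccvg (fun M => \sum_(m < M) a m) l.
Proof.
move=> aA.
have /cvg_ex[x Hx] := @is_cvg_sum_le_inv_sqr (fun m => complex.Re (a m)) A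
  (fun m => le_trans (normRe_le _) (aA m)).
have /cvg_ex[y Hy] := @is_cvg_sum_le_inv_sqr (fun m => complex.Im (a m)) A
  (fun m => le_trans (normIm_le _) (aA m)).
exists (x +i* y); apply: ccvg_ReIm.
  suff -> : (fun n => complex.Re (\sum_(m < n) a m)) = series (fun m => complex.Re (a m)) by [].
  apply/funext => n; rewrite /series /= big_mkord; elim/big_ind2: _ => // ? ? ? ? <- <-.
  by rewrite ReD.
suff -> : (fun n => complex.Im (\sum_(m < n) a m)) = series (fun m => complex.Im (a m)) by [].
apply/funext => n; rewrite /series /= big_mkord; elim/big_ind2: _ => // ? ? ? ? <- <-.
by rewrite ImD.
Qed.

Lemma sum_le_inv_sqr a A M : (forall m, normc (a m) <= A / m.+1%:R ^+ 2) ->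
  normc (\sum_(m < M) a m) <= A * 2.
Proof.
move=> aA; have A0 : 0 <= A.
  by have := aA 0%N; rewrite expr1n divr1; apply: le_trans; exact: normc_ge0.
apply: le_trans (normc_sum _ _ _) _.
apply: le_trans (ler_sum _ (fun (m : 'I_M) _ => aA m)) _; rewrite -mulr_sumr ler_wpM2l//.
case: M => [|n]; first by rewrite big_ord0.
by apply: le_trans (sum_inv_sqr_le n) _; rewrite gerBl invr_ge0.
Qed.

Lemma expR_ln_cvg0 (c : R) (k : nat) : 0 < c -> (0 < k)%N ->
  expR (- c * ln ((n * k).+1%:R)) @[n --> \oo] --> (0 : R).
Proof.
move=> c0 k0; apply/cvgrPdist_le => e e0; near=> n.
rewrite sub0r normrN ger0_norm ?expR_ge0//.
rewrite -[leRHS]lnK ?posrE// ler_expR mulNr lerNl -ler_pdivrMl//.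
rewrite -ler_expR lnK ?posrE//.
apply: (@le_trans _ _ n%:R); last by rewrite ler_nat ltnW// ltnS leq_pmulr.
by near: n; exact: nbhs_infty_ger.
Unshelve. all: by end_near. Qed.

End ComplexLimits.

Section EulerMaclaurinLimit.
Variable R : realType.

(** A quadratic error estimate for the linear approximation: it implies complex
   differentiability and passes easily to limits. *)
Definition qdiff (F : R[i] -> R[i]) z := exists D (C : R), forall h : R[i],
  normc h <= 1 -> normc (F (z + h) - F z - h * D) <= C * normc h ^+ 2.

Variables (q : nat) (f : nat -> R[i]) (d : nat).
Hypothesis q_gt0 : (0 < q)%N.
Hypothesis block_coef0 : block_coef q f d 0 = 0.

Definition em_sum N (u : nat -> R -> R[i]) M : R[i] :=
  \sum_(m < M) block q f d u ((m * q).+1%:R) - em_boundary q f d N u ((M * q).+1%:R).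

Lemma em_sumE N u M : em_sum N u M =
  \sum_(m < M) em_defect q f d N u ((m * q).+1%:R) - em_boundary q f d N u 1.
Proof. by rewrite /em_sum (sum_blocksE q f d N u M); ring. Qed.

(** If the derivative of order [N.+1] is [O(t ^ (- 2))], then the defects are
   summable over the periods. *)
Lemma em_defect_inv_sqr N : (d <= N.+1)%N -> exists2 C, 0 <= C &
  forall u A, chain u -> 0 <= A ->
    (forall t, 1 <= t -> normc (u N.+1 t) <= A * expR (-2 * ln t)) ->
    forall m, normc (em_defect q f d N u ((m * q).+1%:R)) <= C * A / m.+1%:R ^+ 2.
Proof.
move=> dN; have [C C0 HC] := em_defect_bound q_gt0 block_coef0 dN.
exists C => // u A uc A0 uA m; rewrite -mulrA.
have m0 : 0 < m.+1%:R :> R by rewrite ltr0n.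
apply: HC => //.
move=> t mt; have t1 : 1 <= t by apply: le_trans mt; rewrite ler1n.
apply: le_trans (uA t t1) _; apply: ler_wpM2l => //.
have mt' : m.+1%:R <= t.
  by apply: le_trans mt; rewrite ler_nat ltnS leq_pmulr.
have t0 : 0 < t by exact: lt_le_trans mt'.
rewrite mulNr expRN lef_pV2 ?posrE ?expR_gt0 ?exprn_gt0//.
rewrite expRM_natl lnK ?posrE//.
by rewrite lerXn2r ?nnegrE// ltW.
Qed.

Lemma em_sum_cvg N u A : (d <= N.+1)%N -> chain u -> 0 <= A ->
    (forall t, 1 <= t -> normc (u N.+1 t) <= A * expR (-2 * ln t)) ->
  exists l, ccvg (em_sum N u) l.
Proof.
move=> dN uc A0 uA; have [C C0 /(_ u A uc A0 uA) HC] := em_defect_inv_sqr dN.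
have [l Hl] := ccvg_sum_le_inv_sqr HC.
exists (l - em_boundary q f d N u 1).
rewrite (funext (em_sumE N u)).
by apply: ccvgB => //; exact: ccvg_cst.
Qed.

(** Uniformity in [M] and linearity in [A]: this is the form in which the second
   order remainder in [h] passes to the limit. *)
Lemma em_sum_bound N : (d <= N.+1)%N -> exists2 C, 0 <= C &
  forall u A M, chain u -> 0 <= A ->
    (forall t, 1 <= t -> normc (u N.+1 t) <= A * expR (-2 * ln t)) ->
    (forall k, (k < N)%N -> normc (u k 1) <= A) ->
    normc (em_sum N u M) <= C * A.
Proof.
move=> dN; have [C C0 HC] := em_defect_inv_sqr dN.
exists (C * 2 + \sum_(k < N) normc (em_coef q f d k)).
  by rewrite addr_ge0 ?mulr_ge0 ?sumr_ge0// => k _; exact: normc_ge0.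
move=> u A M uc A0 uA uA1; rewrite em_sumE mulrDl.
apply: le_trans (normcB _ _) _; apply: lerD.
  by rewrite mulrAC; apply: (@sum_le_inv_sqr _ (fun m => em_defect q f d N u (m * q).+1%:R) (C * A)); exact: HC.
apply: le_trans (normc_sum _ _ _) _; rewrite big_distrl; apply: ler_sum => k _ /=.
by rewrite normcM ler_wpM2l ?normc_ge0// uA1.
Qed.

Let expR_dec (c c' y : R) : c <= c' -> 0 <= y -> expR (c * y) <= expR (c' * y).
Proof. by move=> cc y0; rewrite ler_expR ler_wpM2r. Qed.

Lemma em_sum_pw_cvg w N : (d <= N.+1)%N -> 2 <= complex.Re w + N.+1%:R ->
  exists l, ccvg (em_sum N (pw w)) l.
Proof.
move=> dN w5; apply: (@em_sum_cvg _ _ (normc (pow_coef R N.+1).[w])) => //.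
- exact: chain_pw.
- exact: normc_ge0.
- move=> t t1; rewrite normc_pw; apply: ler_wpM2l; first exact: normc_ge0.
  by apply: expR_dec; [lra | exact: ln_ge0].
Qed.

Lemma em_boundary_pw_cvg0 w N : (0 < complex.Re w) -> ccvg (fun M => em_boundary q f d N (pw w) ((M * q).+1%:R)) 0.
Proof.
move=> w0; rewrite /em_boundary; elim: N => [|N IH].
  have -> : (fun M => \sum_(k < 0) em_coef q f d k * pw w k (M * q).+1%:R) = fun=> 0.
    by apply/funext => M; rewrite big_ord0.
  exact: ccvg_cst.
have -> : (fun M => \sum_(k < N.+1) em_coef q f d k * pw w k (M * q).+1%:R) =
    fun M => \sum_(k < N) em_coef q f d k * pw w k (M * q).+1%:R + em_coef q f d N * pw w N (M * q).+1%:R.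
  by apply/funext => M; rewrite big_ord_recr.
rewrite -[X in ccvg _ X](addr0 0); apply: ccvgD => //.
rewrite -(mulr0 (em_coef q f d N)); apply: ccvgZ; rewrite /ccvg.
under eq_fun do rewrite subr0 normc_pw.
rewrite -[0](mulr0 (normc (pow_coef R N).[w])); apply: cvgM; first exact: cvg_cst.
by apply: expR_ln_cvg0 => //; rewrite ltr_wpDr.
Qed.

Lemma em_sum_pw_step w N l : 0 < complex.Re w + N%:R -> ccvg (em_sum N (pw w)) l ->
  ccvg (em_sum N.+1 (pw w)) l.
Proof.
move=> w0 wl; rewrite -[l]subr0.
have -> : em_sum N.+1 (pw w) = fun M => em_sum N (pw w) M - em_coef q f d N * pw w N ((M * q).+1%:R).
  by apply/funext => M; rewrite /em_sum /em_boundary big_ord_recr /=; ring.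
apply: ccvgB => //; rewrite -(mulr0 (em_coef q f d N)); apply: ccvgZ; rewrite /ccvg.
under eq_fun do rewrite subr0 normc_pw.
rewrite -[0](mulr0 (normc (pow_coef R N).[w])); apply: cvgM; first exact: cvg_cst.
exact: expR_ln_cvg0.
Qed.

(** All large truncation orders [N] give the same limit, because passing from [N]
   to [N.+1] subtracts a term tending to 0.  Hence one function of [w] serves every
   half-plane, and the regularized sum is defined on the whole plane. *)
Lemma em_limit_exists w : exists l, forall N, (d <= N.+1)%N ->
  2 <= complex.Re w + N.+1%:R -> ccvg (em_sum N (pw w)) l.
Proof.
have [[N0 [dN0 wN0]]|noN] := pselect (exists N, (d <= N.+1)%N /\ 2 <= complex.Re w + N.+1%:R); last first.
  by exists 0 => N dN wN; case: noN; exists N.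
have up N k l : 2 <= complex.Re w + N.+1%:R -> ccvg (em_sum N (pw w)) l ->
    ccvg (em_sum (N + k)%N (pw w)) l.
  move=> wN Nl; elim: k => [|k IH]; first by rewrite addn0.
  rewrite addnS; apply: em_sum_pw_step => //.
  rewrite natrD; move: wN; rewrite -natr1.
  by have : 0 <= k%:R :> R by []; lra.
have [l Hl] := em_sum_pw_cvg dN0 wN0.
exists l => N dN wN.
have [l' Hl'] := em_sum_pw_cvg dN wN.
suff -> : l = l' by [].
apply: (@ccvg_uniq _ (em_sum (N0 + N)%N (pw w))); first exact: up.
by rewrite addnC; exact: up.
Qed.

(** The continuation in [w] of the sum over [n >= 1] of [f n] times the [d]-th
   derivative of [x ^ (- w)] at [x = n]. *)
Definition em_limit w : R[i] := projT1 (cid (em_limit_exists w)).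

Lemma em_limit_cvg w N : (d <= N.+1)%N -> 2 <= complex.Re w + N.+1%:R ->
  ccvg (em_sum N (pw w)) (em_limit w).
Proof. by move=> dN wN; exact: (projT2 (cid (em_limit_exists w))). Qed.

Lemma em_limit_sum w : 0 < complex.Re w ->
  ccvg (fun M => \sum_(m < M) block q f d (pw w) ((m * q).+1%:R)) (em_limit w).
Proof.
move=> w0; rewrite -[em_limit w]addr0.
have H : ccvg (em_sum (d.+1) (pw w)) (em_limit w).
  apply: em_limit_cvg => //; first by rewrite ltnW.
  have : (2 <= d.+2)%N by [].
  rewrite -(ler_nat R); lra.
have := ccvgD H (em_boundary_pw_cvg0 d.+1 w0); congr (ccvg _ _).
by apply/funext => M; rewrite /em_sum subrK.
Qed.

(** The regularized sums are linear in the chain.  So the remainder of the first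
   order expansion of the limit is the limit of the regularized sums of [psi],
   which are [O(normc h ^+ 2)] uniformly. *)
Lemma em_limit_qdiff z : qdiff em_limit z.
Proof.
pose N := (Num.bound `|complex.Re z| + d + 6)%N.
have zN : 6 <= complex.Re z + N.+1%:R.
  have := archi_boundP (normr_ge0 (complex.Re z)).
  have : - complex.Re z <= `|complex.Re z| by rewrite -normrN ler_norm.
  have NE : N%:R = (Num.bound `|complex.Re z|)%:R + d%:R + 6 :> R by rewrite !natrD.
  rewrite -(natr1 N) NE; have : 0 <= d%:R :> R by []; lra.
have dN : (d <= N.+1)%N by rewrite /N; lia.
have [Cd Cd0 HCd] := @normc_dpw R z N.+1.
have [D HD] : exists D, ccvg (em_sum N (dpw z)) D.
  apply: (@em_sum_cvg _ _ Cd) => //; first exact: chain_dpw.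
  move=> t t1; apply: le_trans (HCd t t1) _; apply: ler_wpM2l => //.
  by apply: expR_dec; [lra | exact: ln_ge0].
pose Cpsi k := projT1 (cid2 (@normc_psi R z k)).
have Cpsi0 k : 0 <= Cpsi k by rewrite /Cpsi; case: cid2.
have HCpsi k h t : normc h <= 1 -> 1 <= t -> normc (psi z h k t) <=
    Cpsi k * normc h ^+ 2 * expR ((3 - (complex.Re z + k%:R)) * ln t).
  by rewrite /Cpsi; case: cid2 => /= C _; exact.
pose A := \sum_(k < N.+2) Cpsi k.
have CA k : (k < N.+2)%N -> Cpsi k <= A.
  by move=> kN; rewrite /A (bigD1 (Ordinal kN))//= lerDl sumr_ge0.
have [C C0 HC] := em_sum_bound dN.
exists D, (C * A) => h h1.
have h2 : 0 <= normc h ^+ 2 by rewrite exprn_ge0 ?normc_ge0.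
have A0 : 0 <= A by rewrite sumr_ge0.
have zhN : 5 <= complex.Re (z + h) + N.+1%:R.
  rewrite ReD; have := le_trans (normRe_le h) h1; rewrite ler_norml; lra.
have L : ccvg (em_sum N (psi z h)) (em_limit (z + h) - em_limit z - h * D).
  have -> : em_sum N (psi z h) = fun M => em_sum N (pw (z + h)) M - em_sum N (pw z) M - h * em_sum N (dpw z) M.
    apply/funext => M; rewrite /em_sum /em_boundary /block !mulrBr !big_distrr /=.
    have E (I J K L I' J' : R[i]) : I - J - (I' - J') - (K - L) = (I - I' - K) - (J - J' - L) by ring.
    rewrite E -!sumrB; congr (_ - _); apply: eq_bigr => m _.
      rewrite big_distrr -!sumrB; apply: eq_bigr => r _ /=.
      by rewrite /psi; ring.
    by rewrite /psi; ring.
  apply: ccvgB; last exact: ccvgZ.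
  by apply: ccvgB; apply: em_limit_cvg => //; lra.
apply: ccvg_le L => M; rewrite -mulrA; apply: HC.
- exact: chain_psi.
- exact: mulr_ge0.
- move=> t t1; apply: le_trans (HCpsi N.+1 h t h1 t1) _.
  apply: ler_pM; [exact: mulr_ge0 | exact: expR_ge0 | by rewrite ler_wpM2r// CA |].
  by apply: expR_dec; [lra | exact: ln_ge0].
- move=> k kN; apply: le_trans (HCpsi k h 1 h1 (lexx _)) _.
  by rewrite ln1 mulr0 expR0 mulr1 ler_wpM2r// CA// ltnS ltnW// ltnW.
Qed.

End EulerMaclaurinLimit.

(** * Differentiability and sums over full periods *)

Section EntireFromQuadratic.
Variable R : realType.
Implicit Types (F : R[i] -> R[i]) (z : R[i]).

Lemma qdiff_shift F c z : qdiff F (z + c) -> qdiff (fun s => F (s + c)) z.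
Proof.
move=> [D [C H]]; exists D, C => h h1.
by rewrite (addrAC z h c); exact: H.
Qed.

Lemma qdiffN F z : qdiff F z -> qdiff (fun s => - F s) z.
Proof.
move=> [D [C H]]; exists (- D), C => h h1.
rewrite -normcN [X in normc X](_ : _ = F (z + h) - F z - h * D); last by ring.
exact: H.
Qed.

Lemma qdiff_derivable F z : qdiff F z -> derivable (F : R[i]^o -> R[i]^o) z 1.
Proof.
move=> [D [C H]]; apply/cvg_ex; exists (D : R[i]^o).
apply/cvgrPdist_le => /= eps eps0.
have [e e0 eE] : exists2 e : R, 0 < e & eps = e%:C.
  exists (complex.Re eps); last by rewrite RRe_real// gtr0_real.
  by rewrite -ltcR RRe_real// gtr0_real.
pose C' := `|C| + 1.
have C'0 : 0 < C' by rewrite ltr_wpDl.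
near=> h.
have h0 : h != 0 by near: h; exact: (@nbhs_dnbhs_neq R[i]^o 0).
have h1 : normc h < 1.
  rewrite -ltcR -normcE_norm; near: h; apply: (@dnbhs0_lt _ R[i]^o 1%:C).
  by rewrite ltcR.
have hC : normc h < e / C'.
  rewrite -ltcR -normcE_norm; near: h; apply: (@dnbhs0_lt _ R[i]^o (e / C')%:C).
  by rewrite ltcR divr_gt0.
rewrite eE normcE_norm lecR.
have -> : D - h^-1 *: ((F \o shift z) (h *: (1 : R[i]^o)) - F z) =
    - (h^-1 * (F (z + h) - F z - h * D)).
  rewrite /= /shift /= [h *: 1]mulr1 (addrC h).
  by rewrite [in RHS]mulrBr mulKf// opprB.
rewrite normcN normcM normcV ler_pdivrMl; last first.
  rewrite lt_def normc_ge0 andbT; apply: contra_neq h0; exact: eq0_normc.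
apply: le_trans (H h (ltW h1)) _; rewrite expr2 mulrA mulrC.
apply: ler_wpM2l; first exact: normc_ge0.
apply: (@le_trans _ _ (C' * normc h)); last by rewrite -ler_pdivlMl// mulrC ltW.
apply: ler_wpM2r; first exact: normc_ge0.
by rewrite /C' (le_trans (ler_norm C))// lerDl.
Unshelve. all: by end_near. Qed.

End EntireFromQuadratic.

Section BlockSums.
Variable R : realType.
Implicit Types (a : nat -> R[i]).

Lemma sum_by_blocks a q M :
  \sum_(m < M) \sum_(r < q) a (m * q + r)%N = \sum_(n < M * q) a n.
Proof.
elim: M => [|M IH]; first by rewrite !big_ord0.
rewrite big_ord_recr /= IH mulSnr -!(big_mkord xpredT a).
rewrite [in RHS](big_cat_nat (n := (M * q)%N)) ?leq_addr//=; congr (_ + _).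
rewrite -[in RHS](add0n (M * q)%N) big_addn addnC addnK big_mkord.
by apply: eq_bigr => r _; rewrite addnC.
Qed.

Let cvg_sum0 q (x : nat -> nat -> R) : (forall r, x r n @[n --> \oo] --> (0 : R)) ->
  \sum_(r < q) x r n @[n --> \oo] --> (0 : R).
Proof.
move=> x0; elim: q => [|q IH].
  by under eq_fun do rewrite big_ord0; exact: cvg_cst.
under eq_fun do rewrite big_ord_recr /=.
have H : (fun n => \sum_(i < q) x i n + x q n) @ \oo --> (0 + 0 : R) by exact: cvgD.
by rewrite addr0 in H.
Qed.

(** A partial sum differs from the one that stops at the last complete period by
   fewer than [q] terms. *)
Lemma ccvg_sum_of_blocks a q l : (0 < q)%N ->
  normc (a n) @[n --> \oo] --> (0 : R) ->
  ccvg (fun M => \sum_(n < M * q) a n) l -> ccvg (fun N => \sum_(n < N) a n) l.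
Proof.
move=> q0 a0 al.
apply: (@ccvg_squeeze R _ (fun N => \sum_(n < N %/ q * q) a n)
    (fun N => \sum_(r < q) normc (a (N %/ q * q + r)%N))) => [N| |].
- rewrite [in X in normc (X - _)](divn_eq N q).
  rewrite -!(big_mkord xpredT a) (big_cat_nat (n := N %/ q * q)%N) ?leq_addr//=.
  rewrite addrAC subrr add0r -[in X in normc X](add0n (N %/ q * q)%N) big_addn add0n addKn.
  apply: le_trans (normc_sum _ _ _) _; rewrite -(big_mkord xpredT (fun r => normc (a (N %/ q * q + r)%N))).
  rewrite [in X in _ <= X](big_cat_nat (n := (N %% q)%N)) ?(ltnW (ltn_pmod _ _))//=.
  under eq_bigr do rewrite addnC.
  by rewrite lerDl sumr_ge0// => i _; exact: normc_ge0.
- apply: (@cvg_sum0 _ (fun r n => normc (a (n %/ q * q + r)%N))) => r.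
  apply: (cvg_comp (fun N => N %/ q * q + r)%N (fun n => normc (a n)) _ a0).
  apply/cvgnyPge => A; near=> n; rewrite (leq_trans _ (leq_addr _ _))//.
  apply: leq_trans (_ : n %/ q <= _)%N; last by rewrite leq_pmulr.
  by near: n; move: A; apply/cvgnyPge; exact: cvg_divnr.
- rewrite /ccvg.
  apply: (@cvg_comp _ _ _ (fun N => N %/ q)%N (fun M => normc (\sum_(n < M * q) a n - l)) \oo \oo); last exact: al.
  exact: cvg_divnr.
Unshelve. all: by end_near. Qed.

End BlockSums.

Section PeriodicDirichletSeries.
Variable R : realType.
Variables (q : nat) (f : nat -> R[i]) (d : nat).
Hypothesis q_gt0 : (0 < q)%N.
Hypothesis f_per : forall n, f (n + q)%N = f n.
Hypothesis f_le1 : forall n, normc (f n) <= 1.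
Hypothesis block_coef0 : block_coef q f d 0 = 0.

Let f_perM n m : f (m * q + n)%N = f n.
Proof. by elim: m => [|m IH]; rewrite ?mul0n// mulSnr addnAC f_per. Qed.

Lemma em_limit_series w : 0 < complex.Re w ->
  ccvg (fun N => \sum_(n < N) f n.+1 * pw w d n.+1%:R) (em_limit q_gt0 block_coef0 w).
Proof.
move=> w0; apply: (@ccvg_sum_of_blocks R (fun n => f n.+1 * pw w d n.+1%:R) q) => //.
  apply: (squeeze_cvgr _ (cvg_cst (0 : R))
    (_ : normc (pow_coef R d).[w] * expR (- (complex.Re w + d%:R) * ln n.+1%:R) @[n --> \oo] --> (0 : R))).
    near=> n; rewrite normc_ge0/= normcM normc_pw ler_piMl//.
    by rewrite mulr_ge0 ?normc_ge0 ?expR_ge0.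
  rewrite -[0](mulr0 (normc (pow_coef R d).[w])); apply: cvgM; first exact: cvg_cst.
  under eq_fun do rewrite -[n in n.+1]muln1.
  by apply: expR_ln_cvg0 => //; rewrite ltr_wpDr.
have := em_limit_sum q_gt0 block_coef0 w0; congr (ccvg _ _); apply/funext => M.
rewrite -(sum_by_blocks (fun n => f n.+1 * pw w d n.+1%:R)); apply: eq_bigr => m _; apply: eq_bigr => r _.
by rewrite -addnS f_perM -natrD addnS addSn.
Unshelve. all: by end_near. Qed.

End PeriodicDirichletSeries.

(** * Dirichlet L-functions of prime modulus *)

Section DirichletCharacters.
Variables (R : realType) (q : nat).
Hypothesis q_prime : prime q.
Implicit Types (chi psi : dirichlet_char R q).

Let q_gt0 : (0 < q)%N := prime_gt0 q_prime.
Let q_gt1 : (1 < q)%N := prime_gt1 q_prime.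

Lemma normc_char1 chi n : coprime n q -> normc (chi n) = 1.
Proof.
move=> cnq.
have chi_e : chi n ^+ totient q = 1.
  rewrite -dirichlet_charX -dirichlet_char_mod Euler_exp_totient//.
  by rewrite dirichlet_char_mod dirichlet_char1.
have := congr1 (@normc R) chi_e; rewrite normcX normc1 => /eqP.
by rewrite pexpr_eq1 ?totient_gt0 ?normc_ge0// => /eqP.
Qed.

Lemma normc_char_le1 chi n : normc (chi n) <= 1.
Proof.
have [cnq|ncnq] := boolP (coprime n q); first by rewrite normc_char1.
by rewrite dirichlet_char0// normc0.
Qed.

Lemma char_mulJ chi n : coprime n q -> chi n * (chi n)^*%C = 1.
Proof. by move=> cnq; rewrite -sqr_normc normcE_norm normc_char1// expr1n. Qed.

Lemma char_neq1 chi : chi <> 1%g -> exists2 a, coprime a q & chi a != 1.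
Proof.
move=> chi1; apply: contrapT => noa; apply: chi1; apply/dirichlet_char_eqP => n.
have [cnq|ncnq] := boolP (coprime n q); last by rewrite !dirichlet_char0.
rewrite /= cnq; apply/eqP; apply: contrapT => /negP chin; apply: noa.
by exists n.
Qed.

(** Multiplication by [a] permutes the residues modulo [q]. *)
Lemma sum_char_full chi (g : nat -> R[i]) a : coprime a q ->
  (forall n, g (n %% q)%N = g n) ->
  \sum_(i < q) g (a * i)%N = \sum_(i < q) g i.
Proof.
move=> caq gq.
pose h (i : 'I_q) : 'I_q := Ordinal (ltn_pmod (a * i) q_gt0).
have hinj : injective h.
  move=> i j /(congr1 val)/= /eqP.
  wlog ij : i j / (i <= j)%N.
    move=> W; case: (leqP i j) => [|/ltnW] ij E; first exact: W.
    by apply/esym/W; rewrite // eq_sym.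
  rewrite eq_sym eqn_mod_dvd ?leq_mul2l ?ij ?orbT// -mulnBr Gauss_dvdr//; last by rewrite coprime_sym.
  move=> /dvdnP[k jik]; apply/val_inj/eqP; rewrite eqn_leq ij /= -subn_eq0 jik.
  case: k jik => // k jik; have := ltn_ord j.
  have : (q <= j)%N by apply: leq_trans (leq_subr i j); rewrite jik mulSn leq_addr.
  by move=> /leq_ltn_trans/[apply]; rewrite ltnn.
rewrite [RHS](reindex_inj hinj); apply: eq_bigr => i _ /=.
by rewrite gq.
Qed.

Lemma sum_char chi : chi <> 1%g -> \sum_(i < q) chi i = 0.
Proof.
move=> /char_neq1[a caq chia].
have := sum_char_full chi caq (dirichlet_char_mod chi).
under eq_bigr do rewrite dirichlet_charM.
rewrite -mulr_sumr => /eqP; rewrite -subr_eq0 -[X in _ - X]mul1r -mulrBl mulf_eq0.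
by rewrite subr_eq0 (negbTE chia) => /eqP.
Qed.

Lemma sum_char1 : \sum_(i < q) (1%g : dirichlet_char R q) i = q.-1%:R.
Proof.
rewrite /= -[in LHS](prednK q_gt0) big_ord_recl /= prednK//.
rewrite [coprime 0 q]/coprime gcd0n gtn_eqF// add0r.
under eq_bigr => i _.
  rewrite /bump leq0n add1n coprime_sym prime_coprime//.
  rewrite gtnNdvd//; last by rewrite -[X in (_ < X)%N](prednK q_gt0) ltnS.
  over.
by rewrite sumr_const card_ord.
Qed.

Lemma sum_charS chi : \sum_(r < q) chi r.+1 = \sum_(r < q) chi r.
Proof.
have shift n (a : nat -> R[i]) : a n = a 0%N -> \sum_(r < n) a r.+1 = \sum_(r < n) a r.
  case: n => [|n] an; first by rewrite !big_ord0.
  by rewrite big_ord_recr [RHS]big_ord_recl /= an addrC.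
by apply: shift; exact: (dirichlet_char_period chi 0).
Qed.

End DirichletCharacters.

Section DirichletLFunction.
Variables (R : realType) (q : nat).
Hypothesis q_prime : prime q.
Implicit Types (chi psi : dirichlet_char R q).
Let q_gt0 : (0 < q)%N := prime_gt0 q_prime.

Lemma block_coef_nonprincipal chi : chi <> 1%g -> block_coef q chi 0 0 = 0.
Proof.
move=> chi1; rewrite /block_coef /taylor_mono /=.
under eq_bigr do rewrite expr0 fact0 divr1 rmorph1 mulr1.
by rewrite sum_charS// sum_char.
Qed.

Lemma block_coef_principal (f : nat -> R[i]) : block_coef q f 1 0 = 0.
Proof. by rewrite /block_coef big1// => i _; rewrite mulr0. Qed.

Definition Lnonprincipal chi (chi1 : chi <> 1%g) : R[i] -> R[i] :=
  em_limit q_gt0 (block_coef_nonprincipal chi1).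

(** Regularizing [x ^ (- s)] itself would require its integral over a period.
   With [d = 1] one sums the derivative of [x ^ (1 - s)] instead, which is
   [(1 - s) * x ^ (- s)]; the factor [1 - s] becomes the pole. *)
Definition Lprincipal_num : R[i] -> R[i] :=
  fun s => - em_limit q_gt0 (block_coef_principal (1%g : dirichlet_char R q)) (s - 1).

Definition Lfun chi : R[i] -> R[i] :=
  if pselect (chi = 1%g) is right chi1 then Lnonprincipal chi1
  else fun s => Lprincipal_num s / (s - 1).

Lemma pw0E (w : R[i]) t : pw w 0 t = cexp (- w * (ln t)%:C).
Proof. by rewrite /pw /= hornerC mul1r addr0. Qed.

Lemma pw1E (s : R[i]) t : pw (s - 1) 1 t = (1 - s) * cexp (- s * (ln t)%:C).
Proof.
rewrite /pw /= mul1r hornerN hornerD hornerX hornerC subrK.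
by congr (_ * _); ring.
Qed.

Lemma ccvg_cvg (a : nat -> R[i]) l : ccvg a l -> a n @[n --> \oo] --> (l : R[i]^o).
Proof.
move=> al; apply/(@cvgrPdist_le R[i] R[i]^o) => /= eps eps0.
have [e e0 eE] : exists2 e : R, 0 < e & eps = e%:C.
  exists (complex.Re eps); last by rewrite RRe_real// gtr0_real.
  by rewrite -ltcR RRe_real// gtr0_real.
move/cvgrPdist_le : al => /(_ e e0); apply: filterS => n.
rewrite sub0r normrN ger0_norm ?normc_ge0// => H.
by rewrite eE normcE_norm lecR normc_distC.
Qed.

(** The sum of a nonprincipal character over a period vanishes, so the
   Euler-Maclaurin formula applies to [x ^ (- s)] itself ([d = 0]), and the boundary
   terms tend to 0 for [Re s > 0]: this reaches the central point. *)
Lemma Lfun_series chi s : chi <> 1%g -> 0 < complex.Re s ->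
  ccvg (fun N => \sum_(n < N) chi n.+1 * nat_cpowN n.+1 s) (Lfun chi s).
Proof.
move=> chi1 s0; rewrite /Lfun; case: pselect => // {}chi1.
have := em_limit_series q_gt0 (dirichlet_char_period chi) (normc_char_le1 q_prime chi)
  (block_coef_nonprincipal chi1) s0.
congr (ccvg _ _); apply/funext => N; apply: eq_bigr => n _.
by rewrite pw0E nat_cpowNE.
Qed.

Lemma Lprincipal_num_qdiff z : qdiff Lprincipal_num z.
Proof.
apply: qdiffN; apply: (@qdiff_shift _ (em_limit q_gt0 _) (-1)); exact: em_limit_qdiff.
Qed.

(** At [w = 0] all derivatives of [x ^ (- w)] vanish and only the first boundary term
   is left.  It is the mean of the principal character over a period, [(q - 1) / q],
   which is the residue. *)
Lemma Lprincipal_num1 : Lprincipal_num 1 <> 0.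
Proof.
rewrite /Lprincipal_num subrr.
set f := (1%g : dirichlet_char R q).
have pp0 i : (pow_coef R i.+1).[0] = 0.
  elim: i => [|i IH]; first by rewrite /= mul1r addr0 hornerN hornerX oppr0.
  by rewrite /= hornerM -/(pow_coef R i.+1) IH mul0r.
have q0 : (q%:R : R[i]) != 0 by rewrite pnatr_eq0 -lt0n.
have tau0 : em_coef q f 1 0 * q%:R = q.-1%:R.
  have := em_coefE f 1 q_gt0 0.
  rewrite big_ord1 /block_coef /taylor_mono /= expr1 divr1 rmorph_nat => ->.
  under eq_bigr do rewrite expr0 divr1 rmorph1 mulr1.
  by rewrite (sum_charS f) sum_char1.
have C : ccvg (em_sum q f 1 1 (pw 0)) (- em_coef q f 1 0).
  have -> : em_sum q f 1 1 (pw 0) = fun=> - em_coef q f 1 0.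
    apply/funext => M; rewrite /em_sum /em_boundary big_ord1 pw0E oppr0 mul0r cexp0 mulr1.
    rewrite big1 ?sub0r// => m _; rewrite /block big1// => r _.
    by rewrite /pw pp0 mul0r mulr0.
  exact: ccvg_cst.
have := ccvg_uniq C (em_limit_cvg q_gt0 (block_coef_principal f) _ _).
move=> <-//; last by rewrite add0r.
rewrite opprK => tau0'; move: tau0; rewrite tau0' mul0r => /esym/eqP.
by rewrite pnatr_eq0 -subn1 subn_eq0 leqNgt prime_gt1.
Qed.

Lemma Lfun_principal s : s != 1 -> Lfun 1%g s = Lprincipal_num s / (s - 1).
Proof. by move=> s1; rewrite /Lfun; case: pselect. Qed.

Lemma Lfun_principal_series s : 1 < complex.Re s ->
  ccvg (fun N => \sum_(n < N) (1%g : dirichlet_char R q) n.+1 * nat_cpowN n.+1 s) (Lfun 1%g s).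
Proof.
move=> s1.
have s1' : s - 1 != 0.
  rewrite subr_eq0; apply: contraTneq s1 => ->; by rewrite /= ltxx.
have w0 : 0 < complex.Re (s - 1) by rewrite ReD ReN /= subr_gt0.
rewrite Lfun_principal; last by rewrite -subr_eq0.
rewrite /Lprincipal_num mulrC mulrN -mulNr.
have := ccvgZ (- (s - 1)^-1) (em_limit_series q_gt0 (dirichlet_char_period _)
  (normc_char_le1 q_prime _) (block_coef_principal (1%g : dirichlet_char R q)) w0).
congr (ccvg _ _); apply/funext => N; rewrite big_distrr; apply: eq_bigr => n _ /=.
rewrite pw1E nat_cpowNE -/(dirichlet_char_one R q).
by field.
Qed.

Lemma Lfun_is_dirichlet_L chi : is_dirichlet_L chi (Lfun chi).
Proof.
split.
- move=> s s1.
  have -> : series (fun n => chi n.+1 * nat_cpowN n.+1 s) =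
      fun N => \sum_(n < N) chi n.+1 * nat_cpowN n.+1 s.
    by apply/funext => N; rewrite /series/= big_mkord.
  apply: ccvg_cvg; have [->|chi1] := pselect (chi = 1%g).
    exact: Lfun_principal_series.
  by apply: Lfun_series => //; exact: lt_trans s1.
- move=> chi1 z; apply: qdiff_derivable.
  rewrite /Lfun; case: pselect => // {}chi1; exact: em_limit_qdiff.
- move=> ->; exists 1%N, Lprincipal_num; split => //.
  + by move=> z; apply: qdiff_derivable; exact: Lprincipal_num_qdiff.
  + exact: Lprincipal_num1.
  + by move=> s s1; rewrite expr1 Lfun_principal.
Qed.

End DirichletLFunction.

(** * Orthogonality of characters over subgroups *)

Section Orthogonality.
Variables (R : realType) (q : nat).
Hypothesis q_prime : prime q.
Local Notation dchar := (dirichlet_char R q).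
Implicit Types (chi psi : dchar) (H : {group dchar}).

Let q_gt0 : (0 < q)%N := prime_gt0 q_prime.
Let q_gt1 : (1 < q)%N := prime_gt1 q_prime.

Lemma sum_subgroup_neq H a b psi : coprime a q -> coprime b q ->
  psi \in H -> psi a != psi b -> \sum_(chi in H) chi a * (chi b)^*%C = 0.
Proof.
move=> caq cbq psiH psiab; set S := \sum_(chi in H) _.
have SE : S = psi a * (psi b)^*%C * S.
  rewrite mulr_sumr {1}/S (reindex_inj (mulgI psi)) /=.
  apply: eq_big => [chi|chi _]; first by rewrite groupMl.
  by rewrite rmorphM mulrACA.
apply/eqP; move: SE => /eqP; rewrite -subr_eq0 -[X in X - _]mul1r -mulrBl mulf_eq0.
case/orP => //; rewrite subr_eq0 => /eqP psi1.
case/eqP: psiab; rewrite -[LHS]mulr1 -(char_mulJ q_prime psi cbq) mulrCA -psi1.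
by rewrite mulr1.
Qed.

Lemma sum_subgroup_eq H a b : coprime a q -> coprime b q ->
  (forall psi, psi \in H -> psi a = psi b) ->
  \sum_(chi in H) chi a * (chi b)^*%C = #|H|%:R.
Proof.
move=> caq cbq ab; rewrite -sumr_const; apply: eq_bigr => chi chiH.
by rewrite ab// char_mulJ.
Qed.

(** The sum over a subgroup is [#|H|] or 0 by orthogonality.  That it is never
   negative is what allows the restriction to [H] below. *)
Lemma sum_subgroup_ge0 H a b : coprime a q -> coprime b q ->
  0 <= \sum_(chi in H) chi a * (chi b)^*%C.
Proof.
move=> caq cbq.
have [ab|/existsNP[psi /not_implyP[psiH /eqP psiab]]] :=
    pselect (forall psi, psi \in H -> psi a = psi b).
  by rewrite sum_subgroup_eq// ler0n.
by rewrite (sum_subgroup_neq caq cbq psiH).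
Qed.

Let exp_Fq (x : 'F_q) : x ^+ q = x.
Proof. by have := finfield.expf_card x; rewrite card_Fp. Qed.

Let primroot_Fq : exists g : 'F_q, q.-1.-primitive_root g.
Proof.
pose rs := enum (predC1 (0 : 'F_q)).
have n0 : (0 < q.-1)%N by rewrite -subn1 subn_gt0.
have all1 : all q.-1.-unity_root rs.
  apply/allP => x; rewrite mem_enum inE => x0.
  apply/unity_rootP; apply: (mulfI x0); rewrite -exprS prednK// mulr1.
  exact: exp_Fq.
have szrs : (q.-1 <= size rs)%N by rewrite -cardE cardC1 card_Fp.
have urs : uniq rs by exact: enum_uniq.
by have /hasP[g _ gp] := has_prim_root n0 all1 urs szrs; exists g.
Qed.

Let primroot_C : exists z : R[i], q.-1.-primitive_root z.
Proof.
have n0 : (0 < q.-1)%N by rewrite -subn1 subn_gt0.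
have [r Dp] := closed_field_poly_normal ('X^(q.-1) - 1 : {poly R[i]}).
rewrite (monicP _) ?monicXnsubC // scale1r in Dp.
have rn1 : all q.-1.-unity_root r by apply/allP=> z; rewrite -root_prod_XsubC -Dp.
have sz_r : (q.-1 < (size r).+1)%N.
  by rewrite -(size_prod_XsubC r id) -Dp size_XnsubC.
have [|z _ zp] := hasP (has_prim_root n0 rn1 _ sz_r); last by exists z.
by rewrite -separable.separable_prod_XsubC -Dp cyclotomic.separable_Xn_sub_1 // pnatr_eq0 -lt0n.
Qed.

(** A primitive root modulo [q] is sent to a primitive complex root of unity of
   order [q - 1]. *)
Lemma faithful_character : exists chi : dchar, forall a b,
  coprime a q -> coprime b q -> chi a = chi b -> a = b %[mod q].
Proof.
have [g gp] := primroot_Fq; have [z zp] := primroot_C.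
have n0 := prim_order_gt0 gp.
have Fq0 n : (n%:R == 0 :> 'F_q) = ~~ coprime n q.
  by rewrite coprime_sym prime_coprime// negbK -(dvdn_pcharf (pchar_Fp q_prime)).
have ind_ex n : exists i, coprime n q -> n%:R = g ^+ i.
  have [cnq|ncnq] := boolP (coprime n q); last by exists 0%N.
  have n1 : (n%:R : 'F_q) ^+ q.-1 = 1.
    have nz : (n%:R : 'F_q) != 0 by rewrite Fq0 cnq.
    apply: (mulfI nz); rewrite -exprS prednK// mulr1.
    exact: exp_Fq.
  by have [i ->] := prim_rootP gp n1; exists i.
pose ind n := projT1 (cid (ind_ex n)).
have indP n : coprime n q -> n%:R = g ^+ ind n.
  by rewrite /ind; case: cid.
have eq_ind m n : coprime m q -> coprime n q ->
    m = n %[mod q] <-> ind m = ind n %[mod q.-1].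
  move=> cm cn; split => [mn|].
    apply/eqP; rewrite -(eq_prim_root_expr gp) -!indP//.
    by apply/eqP; rewrite -Fp_nat_mod// mn Fp_nat_mod.
  move=> /eqP; rewrite -(eq_prim_root_expr gp) -!indP// => /eqP mn.
  have := congr1 (@nat_of_ord _) mn; rewrite !val_Fp_nat//.
pose f n : R[i] := if coprime n q then z ^+ ind n else 0.
have fP : is_dirichlet_char q f.
  split.
  - move=> m n; rewrite /f coprimeMl; case: ifP => [/andP[cm cn]|]; last first.
      by case: coprime => //=; case: coprime; rewrite ?mulr0 ?mul0r.
    rewrite cm cn -exprD; apply/eqP; rewrite (eq_prim_root_expr zp).
    rewrite -(eq_prim_root_expr gp) exprD -!indP// ?coprimeMl ?cm//.
    by rewrite natrM.
  - move=> n; rewrite /f.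
    have -> : coprime (n + q) q = coprime n q by rewrite /coprime gcdnC gcdnDr gcdnC.
    case: ifP => // cn; apply/eqP; rewrite (eq_prim_root_expr zp); apply/eqP.
    apply/eq_ind => //; last by rewrite modnDr.
    by rewrite /coprime gcdnC gcdnDr gcdnC.
  - move=> n; rewrite /f; case: ifP => _; last by rewrite eqxx.
    apply/expf_neq0/eqP => z0; have := prim_expr_order zp.
    by rewrite z0 expr0n gtn_eqF// => /eqP; rewrite eq_sym oner_eq0.
exists (DirichletChar (asboolT fP)) => a b ca cb /=; rewrite /f ca cb => /eqP.
by rewrite (eq_prim_root_expr zp) => /eqP /(eq_ind a b ca cb).
Qed.

Lemma sum_all_characters a b : coprime a q -> coprime b q -> a <> b %[mod q] ->
  \sum_(chi : dchar) chi a * (chi b)^*%C = 0.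
Proof.
move=> ca cb ab; have [psi psiP] := faithful_character.
have := @sum_subgroup_neq [set: dchar]%G a b psi ca cb.
under eq_bigl do rewrite finset.in_setT.
apply; first by rewrite finset.in_setT.
by apply/eqP => /(psiP _ _ ca cb).
Qed.

(** Both sides of the double sum of [chi i] over all [chi] and [i < q] are
   evaluated, by orthogonality in [chi] and in [i]. *)
Lemma card_dirichlet_char : #|{: dchar}| = q.-1.
Proof.
apply/eqP; rewrite -(eqr_nat R[i]); apply/eqP.
transitivity (\sum_(chi : dchar) \sum_(i < q) chi i * (chi 1%N)^*%C).
  rewrite exchange_big /= (bigD1 (Ordinal q_gt1))//= [X in _ + X]big1 ?addr0.
    by under eq_bigr do rewrite char_mulJ ?coprime1n//; rewrite sumr_const.
  move=> i i1; have [ci|nci] := boolP (coprime i q); last first.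
    by rewrite big1// => chi _; rewrite dirichlet_char0// mul0r.
  apply: sum_all_characters => //; first by rewrite coprime1n.
  by rewrite !modn_small// => i1'; case/eqP: i1; apply: val_inj.
rewrite (bigD1 (1%g : dchar))//= [X in _ + X]big1 ?addr0.
  under eq_bigr do rewrite coprime1n rmorph1 mulr1.
  exact: (sum_char1 R q_prime).
by move=> chi /eqP chi1; rewrite -mulr_suml sum_char// mul0r.
Qed.

End Orthogonality.

(** * Averaged partial sums at the central point *)

Section AbelSummation.
Variable R : realType.

Lemma ccvg_le_eps (a : nat -> R[i]) (e : nat -> R) l (B : R) :
  (forall n, normc (a n) <= e n + B) -> e n @[n --> \oo] --> (0 : R) ->
  ccvg a l -> normc l <= B.
Proof.
move=> aB e0 al; rewrite -subr_le0.
have el : (fun n => e n + normc (a n - l)) @ \oo --> (0 + 0 : R) by exact: cvgD.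
have : normc l - B <= lim (e n + normc (a n - l) @[n --> \oo]).
  apply: limr_ge; first by apply/cvg_ex; exists (0 + 0).
  near=> n; rewrite lerBlDr; have {1}-> : l = a n - (a n - l) by ring.
  apply: le_trans (normcB _ _) _; rewrite addrAC lerD2r; exact: aB.
by rewrite (cvg_lim (@Rhausdorff R) el) addr0.
Unshelve. all: by end_near. Qed.


(** Summation by parts: the increments of decreasing weights telescope, so bounded
   sums of the [b i] cost only the first weight. *)
Lemma abel_bound (b : nat -> R[i]) (w : nat -> R) (B : R) m :
  (forall k, normc (\sum_(i < k) b i) <= B) ->
  (forall i, w i.+1 <= w i) -> (forall i, 0 <= w i) ->
  normc (\sum_(i < m) b i * (w i)%:C) <= B * w 0%N.
Proof.
move=> bB wd w0.
pose s k := \sum_(i < k) b i.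
have sS k : s k.+1 = s k + b k by rewrite /s big_ord_recr.
have -> : \sum_(i < m) b i * (w i)%:C = s m * (w m)%:C +
    \sum_(k < m) s k.+1 * (w k - w k.+1)%:C.
  elim: m => [|m IH]; first by rewrite !big_ord0 /s big_ord0 mul0r addr0.
  rewrite !big_ord_recr /= IH sS !rmorphB /=; ring.
have -> : B * w 0%N = B * w m + \sum_(k < m) B * (w k - w k.+1).
  elim: m => [|m IH]; first by rewrite big_ord0 addr0.
  by rewrite big_ord_recr /= IH; ring.
apply: le_trans (le_normcD _ _) _; apply: lerD.
  by rewrite normcM normc_real ger0_norm//; apply: ler_wpM2r => //; exact: bB.
apply: le_trans (normc_sum _ _ _) _; apply: ler_sum => k _.
rewrite normcM normc_real ger0_norm ?subr_ge0//; apply: ler_wpM2r; last exact: bB.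
by rewrite subr_ge0.
Qed.

End AbelSummation.

Section SmoothedPartialSums.
Variable R : realType.

Definition invsqrt (n : nat) : R := (Num.sqrt n%:R)^-1.

Lemma invsqrt_ge0 n : 0 <= invsqrt n. Proof. by rewrite invr_ge0 sqrtr_ge0. Qed.

(** The coefficients [1 / sqrt n] are the values of [n ^ (- s)] at [s = 1 / 2]. *)
Lemma invsqrtE n : invsqrt n.+1 = expR (- 2^-1 * ln n.+1%:R).
Proof.
rewrite mulNr expRN /invsqrt; congr (_^-1).
have E : n.+1%:R = expR (2^-1 * ln n.+1%:R) ^+ 2 :> R.
  rewrite -expRM_natl; have -> : 2%:R * (2^-1 * ln n.+1%:R) = ln n.+1%:R :> R by field.
  by rewrite lnK ?posrE.
by rewrite [in LHS]E sqrtr_sqr ger0_norm ?expR_ge0.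
Qed.

Lemma invsqrt_le m n : (0 < m)%N -> (m <= n)%N -> invsqrt n <= invsqrt m.
Proof.
move=> m0 mn; rewrite lef_pV2 ?posrE ?sqrtr_gt0 ?ltr0n//; last exact: leq_trans mn.
by rewrite ler_sqrt ?ler_nat.
Qed.

Definition dinvsqrt (n : nat) : R := invsqrt n - invsqrt n.+1.

Lemma dinvsqrtE n : (0 < n)%N -> dinvsqrt n =
  (Num.sqrt n%:R * Num.sqrt n.+1%:R * (Num.sqrt n%:R + Num.sqrt n.+1%:R))^-1.
Proof.
move=> n0; rewrite /dinvsqrt /invsqrt.
set a := Num.sqrt n%:R; set b := Num.sqrt n.+1%:R.
have a0 : 0 < a by rewrite sqrtr_gt0 ltr0n.
have b0 : 0 < b by rewrite sqrtr_gt0 ltr0n.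
have ab : b ^+ 2 = a ^+ 2 + 1 by rewrite !sqr_sqrtr// natr1.
have -> : a^-1 - b^-1 = (b - a) / (a * b) by field; lra.
have -> : b - a = (a + b)^-1.
  have s0 : a + b != 0 by rewrite gt_eqF ?addr_gt0.
  apply: (mulIf s0); rewrite mulVf//.
  by rewrite -[RHS](addrK (a ^+ 2)) [1 + _]addrC -ab; ring.
by field; lra.
Qed.

Lemma dinvsqrt_ge0 n : (0 < n)%N -> 0 <= dinvsqrt n.
Proof. by move=> n0; rewrite subr_ge0 invsqrt_le. Qed.

Lemma dinvsqrt_dec n : (0 < n)%N -> dinvsqrt n.+1 <= dinvsqrt n.
Proof.
move=> n0; rewrite !dinvsqrtE//.
have s0 m : (0 < m)%N -> 0 < Num.sqrt m%:R :> R by move=> m0; rewrite sqrtr_gt0 ltr0n.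
have sm m : Num.sqrt m%:R <= Num.sqrt m.+1%:R :> R by rewrite ler_sqrt ?ler_nat.
have := s0 _ n0; have := s0 n.+1 isT; have := s0 n.+2 isT.
move=> H2 H1 H0; rewrite lef_pV2 ?posrE ?mulr_gt0 ?addr_gt0//.
apply: ler_pM; [by rewrite mulr_ge0 ?ltW | by rewrite addr_ge0 ?ltW | | by rewrite lerD].
by apply: ler_pM; rewrite ?sm// ltW.
Qed.

Lemma dinvsqrt_le n : (0 < n)%N -> dinvsqrt n <= invsqrt n / n%:R.
Proof.
move=> n0; rewrite dinvsqrtE//; set a := Num.sqrt n%:R; set b := Num.sqrt n.+1%:R.
have a0 : 0 < a by rewrite sqrtr_gt0 ltr0n.
have ab : a <= b by rewrite ler_sqrt ?ler_nat.
have b0 : 0 < b by exact: lt_le_trans ab.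
have -> : n%:R = a * a by rewrite -expr2 sqr_sqrtr.
rewrite /invsqrt -/a -invfM lef_pV2 ?posrE ?mulr_gt0 ?addr_gt0//.
have -> : a * (a * a) = a * a * a by rewrite mulrA.
apply: ler_pM; [by rewrite mulr_ge0 ?ltW | exact: ltW | by rewrite ler_pM2l |].
by rewrite lerDl ltW.
Qed.

Variables (q : nat) (f : nat -> R[i]).
Hypothesis q_gt0 : (0 < q)%N.
Hypothesis f_per : forall n, f (n + q)%N = f n.
Hypothesis f_le1 : forall n, normc (f n) <= 1.
Hypothesis f_mean0 : \sum_(r < q) f r.+1 = 0.

(** Antidifferences of a mean zero periodic sequence are periodic, hence bounded. *)
Let sum_periodic (h : nat -> R[i]) n : (forall n, h (n + q)%N = h n) ->
  \sum_(r < q) h r = 0 -> \sum_(i < n + q) h i = \sum_(i < n) h i.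
Proof.
move=> hper h0; elim: n => [|n IH]; first by rewrite add0n big_ord0.
by rewrite addSn !big_ord_recr /= IH hper.
Qed.

Let bound_periodic (h : nat -> R[i]) (B : R) n : (forall n, h (n + q)%N = h n) ->
  (forall n, (n < q)%N -> normc (h n) <= B) -> normc (h n) <= B.
Proof.
move=> hper hB; rewrite (divn_eq n q); elim: (n %/ q)%N => [|k IH].
  by rewrite mul0n add0n; apply: hB; rewrite ltn_pmod.
by rewrite mulSnr addnAC hper.
Qed.

Let bound_sum_periodic (h : nat -> R[i]) (B : R) n : (forall n, h (n + q)%N = h n) ->
  \sum_(r < q) h r = 0 -> 0 <= B -> (forall n, normc (h n) <= B) ->
  normc (\sum_(i < n) h i) <= q%:R * B.
Proof.
move=> hper h0 B0 hB; apply: (bound_periodic (h := fun n => \sum_(i < n) h i)).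
  by move=> m; exact: sum_periodic.
move=> m mq; apply: le_trans (normc_sum _ _ _) _.
apply: (@le_trans _ _ (\sum_(i < m) B)); first by apply: ler_sum.
by rewrite sumr_const card_ord -[_ *+ m]mulr_natl ler_wpM2r// ler_nat ltnW.
Qed.

Let A n : R[i] := \sum_(i < n) f i.+1.
Let c : R[i] := (\sum_(n < q) A n) / q%:R.
Let B n : R[i] := A n - c.
Let fS_per n : f (n + q).+1 = f n.+1. Proof. by rewrite -addSn f_per. Qed.
Let q0 : q%:R != 0 :> R[i]. Proof. by rewrite pnatr_eq0 -lt0n. Qed.

Let A_le n : normc (A n) <= q%:R.
Proof.
rewrite -[leRHS]mulr1; apply: (bound_sum_periodic (h := fun n => f n.+1)) => //.
Qed.

Let A_per n : A (n + q)%N = A n.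
Proof. exact: (sum_periodic n (h := fun n => f n.+1)). Qed.

Let c_le : normc c <= q%:R.
Proof.
rewrite normcM normcV normc_nat ler_pdivrMr ?ltr0n//.
apply: le_trans (normc_sum _ _ _) _.
apply: (@le_trans _ _ (\sum_(n < q) q%:R)); first by apply: ler_sum => i _; exact: A_le.
by rewrite sumr_const card_ord -[_ *+ q]mulr_natl.
Qed.

Let B_le n : normc (B n) <= 2 * q%:R.
Proof.
by apply: le_trans (normcB _ _) _; rewrite mulr_natl mulr2n lerD.
Qed.

Let B_per n : B (n + q)%N = B n. Proof. by rewrite /B A_per. Qed.

Let B_mean0 : \sum_(n < q) B n = 0.
Proof.
rewrite sumrB sumr_const card_ord -[_ *+ q]mulr_natl /c mulrC divfK//.
by rewrite subrr.
Qed.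

Let sumB_le x m : normc (\sum_(i < m) B (x + i)%N) <= q%:R * (2 * q%:R) *+ 2.
Proof.
have -> : \sum_(i < m) B (x + i)%N = \sum_(i < x + m) B i - \sum_(i < x) B i.
  rewrite -!(big_mkord xpredT B) (@big_cat_nat _ _ _ x) ?leq_addr//=.
  rewrite addrAC subrr add0r -[in RHS](add0n x) big_addn add0n addKn big_mkord.
  by apply: eq_bigr => i _; rewrite addnC.
apply: le_trans (normcB _ _) _; rewrite mulr2n; apply: lerD;
  by apply: bound_sum_periodic => //; rewrite mulr_ge0.
Qed.

Definition psum x : R[i] := \sum_(n < x) f n.+1 * (invsqrt n.+1)%:C.

Let psum_diff x m : psum (x + m) - psum x =
  B (x + m)%N * (invsqrt (x + m).+1)%:C - B x * (invsqrt x.+1)%:C +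
  \sum_(i < m) B (x.+1 + i)%N * (dinvsqrt (x.+1 + i))%:C.
Proof.
elim: m => [|m IH]; first by rewrite addn0 !subrr big_ord0 add0r.
have psumS n : psum n.+1 = psum n + f n.+1 * (invsqrt n.+1)%:C by rewrite /psum big_ord_recr.
rewrite big_ord_recr /= addnS psumS.
have -> : f (x + m).+1 = B (x + m).+1 - B (x + m)%N.
  by rewrite /B /A big_ord_recr /=; ring.
have -> : psum (x + m) = psum (x + m) - psum x + psum x by ring.
rewrite IH; have -> : (x.+1 + m = (x + m).+1)%N by rewrite addSn.
rewrite /dinvsqrt rmorphB /=; ring.
Qed.

(** The partial sums converge to [l] only at the rate [q / sqrt X].  Summing by parts
   twice, the fluctuation [B] of the character sums around their mean [c] has mean
   zero, so that averaging over [X <= x < 2 X] gains a further factor [q / X]. *)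
Lemma smoothed_psum X l : (0 < X)%N -> ccvg psum l ->
  normc (l - (\sum_(x < X) psum (X + x)) / X%:R) <= 8 * (q%:R ^+ 2 * (invsqrt X / X%:R)).
Proof.
move=> X0 Hl.
have X0' : X%:R != 0 :> R[i] by rewrite pnatr_eq0 -lt0n.
pose K : R := 8 * (q%:R ^+ 2 * (invsqrt X / X%:R)).
pose D Y := (\sum_(x < X) (psum (X + X + Y) - psum (X + x))) / X%:R.
have HD : ccvg D (l - (\sum_(x < X) psum (X + x)) / X%:R).
  have H1 : ccvg (fun Y => psum (X + X + Y)) l.
    apply: (@cvg_comp _ _ _ (fun Y => (X + X) + Y)%N (fun n => normc (psum n - l)) \oo \oo) => //.
    exact: cvg_addnl.
  have := ccvgB H1 (ccvg_cst ((\sum_(x < X) psum (X + x)) / X%:R)).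
  congr (ccvg _ _); apply/funext => Y; rewrite /D sumrB sumr_const card_ord.
  by rewrite mulrBl -[psum _ *+ X]mulr_natr mulfK.
have q0r : 0 <= q%:R :> R by [].
have HB Y : normc (D Y) <= 2 * q%:R * invsqrt (X + X + Y).+1 + K.
  have -> : D Y = B (X + X + Y)%N * (invsqrt (X + X + Y).+1)%:C
      + (- (\sum_(x < X) B (X + x)%N * (invsqrt (X + x).+1)%:C)
      + \sum_(x < X) \sum_(i < (X - x) + Y) B ((X + x).+1 + i)%N * (dinvsqrt ((X + x).+1 + i))%:C) / X%:R.
    rewrite /D; apply: (mulIf X0'); rewrite mulrDl !divfK//.
    rewrite -[B (X + X + Y)%N * _ * _]mulrC mulr_natl -[X in _ *+ X]card_ord -sumr_const.
    rewrite -sumrN -!big_split /=; apply: eq_bigr => x _.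
    have -> : (X + X + Y = X + x + (X - x + Y))%N by have := ltn_ord x; lia.
    by rewrite psum_diff; ring.
  apply: le_trans (le_normcD _ _) _; apply: lerD.
    by rewrite normcM normc_real ger0_norm ?invsqrt_ge0// ler_wpM2r ?invsqrt_ge0.
  rewrite normcM normcV normc_nat ler_pdivrMr ?ltr0n//.
  have -> : K * X%:R = 4 * q%:R ^+ 2 * invsqrt X + X%:R * (4 * q%:R ^+ 2 * (invsqrt X / X%:R)).
    by rewrite /K; field; rewrite pnatr_eq0 -lt0n.
  apply: le_trans (le_normcD _ _) _; apply: lerD.
    rewrite normcN.
    apply: le_trans (@abel_bound _ (fun i => B (X + i)%N) (fun i => invsqrt (X + i).+1) _ X (sumB_le X) _ _) _.
    - by move=> i; rewrite addnS invsqrt_le.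
    - by move=> i; exact: invsqrt_ge0.
    rewrite addn0 -mulr_natl; apply: (@le_trans _ _ (4 * q%:R ^+ 2 * invsqrt X.+1)).
      by rewrite le_eqVlt; apply/orP; left; apply/eqP; ring.
    by rewrite ler_wpM2l ?invsqrt_le// mulr_ge0 ?exprn_ge0.
  apply: le_trans (normc_sum _ _ _) _.
  rewrite mulr_natl -[X in _ <= _ *+ X]card_ord -sumr_const; apply: ler_sum => x _.
  apply: le_trans (@abel_bound _ (fun i => B ((X + x).+1 + i)%N) (fun i => dinvsqrt ((X + x).+1 + i)) _ _ (sumB_le _) _ _) _.
  - by move=> i; rewrite addnS dinvsqrt_dec// addSn.
  - by move=> i; rewrite dinvsqrt_ge0// addSn.
  rewrite addn0; apply: (@le_trans _ _ (4 * q%:R ^+ 2 * dinvsqrt (X + x).+1)).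
    by rewrite -mulr_natl le_eqVlt; apply/orP; left; apply/eqP; ring.
  apply: ler_wpM2l; first by rewrite mulr_ge0 ?exprn_ge0.
  apply: le_trans (dinvsqrt_le _) _ => //.
  apply: ler_pM; rewrite ?invsqrt_ge0 ?invr_ge0//.
    by rewrite invsqrt_le// ltnW// ltnS leq_addr.
  by rewrite lef_pV2 ?posrE ?ltr0n// ler_nat ltnW// ltnS leq_addr.
apply: (ccvg_le_eps HB _ HD).
have -> : (fun Y => 2 * q%:R * invsqrt (X + X + Y).+1) =
    (fun n => 2 * q%:R * invsqrt n.+1) \o (fun Y => X + X + Y)%N by [].
apply: (@cvg_comp _ _ _ _ _ \oo \oo); first exact: cvg_addnl.
have invsqrt0 : (fun n => invsqrt n.+1) @ \oo --> (0 : R).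
  have -> : (fun n => invsqrt n.+1) = (fun n => expR (- 2^-1 * ln (n * 1).+1%:R)).
    by apply/funext => n; rewrite muln1 invsqrtE.
  by apply: expR_ln_cvg0; rewrite ?invr_gt0.
have H : (fun n => 2 * q%:R * invsqrt n.+1) @ \oo --> (2 * q%:R * 0 : R).
  by apply: cvgM => //; exact: cvg_cst.
by rewrite mulr0 in H.
Qed.

End SmoothedPartialSums.

(** * The resonance inequality *)

Section Resonance.
Variables (R : realType) (q : nat).
Hypothesis q_prime : prime q.
Local Notation dchar := (dirichlet_char R q).
Implicit Types (chi psi : dchar).

Variables (I : finType) (P : pred I) (nu : I -> nat) (r : I -> R) (N : nat).
Hypothesis N_lt : (N < q)%N.
Hypothesis nu_gt0 : forall i, P i -> (0 < nu i)%N.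
Hypothesis nu_le : forall i, P i -> (nu i <= N)%N.
Hypothesis nu_inj : forall i j, P i -> P j -> nu i = nu j -> i = j.
Hypothesis r_ge0 : forall i, 0 <= r i.

Let q_gt0 : (0 < q)%N := prime_gt0 q_prime.

Definition resonator chi : R[i] := \sum_(i | P i) (r i)%:C * chi (nu i).
Definition rho chi : R := normc (resonator chi) ^+ 2.
Definition resW : R := \sum_(i | P i) r i ^+ 2.

(** The terms with [nu j = n * nu i] of the sum of [r i * r j / sqrt n], the only
   ones kept in the lower bound. *)
Definition resV : R := \sum_(i | P i) \sum_(j | P j && (nu i %| nu j)%N)
  r i * r j * invsqrt R (nu j %/ nu i).

Let coprime_lt n : (0 < n)%N -> (n < q)%N -> coprime n q.
Proof. by move=> n0 nq; rewrite coprime_sym prime_coprime// gtnNdvd. Qed.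

Let nu_coprime i : P i -> coprime (nu i) q.
Proof. by move=> Pi; rewrite coprime_lt ?nu_gt0// (leq_ltn_trans (nu_le Pi)). Qed.

Let rhoE chi : (rho chi)%:C = \sum_(i | P i) \sum_(j | P j)
  (r i * r j)%:C * (chi (nu i) * (chi (nu j))^*%C).
Proof.
rewrite /rho rmorphXn /= -normcE_norm sqr_normc /resonator rmorph_sum big_distrl /=.
apply: eq_bigr => i _; rewrite big_distrr /=; apply: eq_bigr => j _.
have cE (x : R) (z : R[i]) : (x%:C * z)^*%C = x%:C * z^*%C.
  by rewrite (rmorphM (@conjc R)); congr (_ * _); exact: conjc_real.
transitivity ((r i)%:C * chi (nu i) * ((r j)%:C * (chi (nu j))^*%C)).
  by congr (_ * _); exact: cE.
by rewrite rmorphM /=; ring.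
Qed.

Lemma rho_ge0 chi : 0 <= rho chi. Proof. by rewrite exprn_ge0 ?normc_ge0. Qed.

(** The integers [nu i] are distinct and less than [q], so the resonator is an
   orthogonal sum over the full group of characters. *)
Lemma sum_rho : \sum_(chi : dchar) rho chi = q.-1%:R * resW.
Proof.
apply: (@complexI R); rewrite rmorph_sum /= (eq_bigr _ (fun chi _ => rhoE chi)).
rewrite exchange_big /= rmorphM rmorph_nat rmorph_sum big_distrr /=.
apply: eq_bigr => i Pi; rewrite exchange_big /= (bigD1 i)//= [X in _ + X]big1 ?addr0.
  rewrite -mulr_sumr (eq_bigr (fun=> 1)); last first.
    by move=> chi _; rewrite char_mulJ// nu_coprime.
  rewrite sumr_const -[#|_|]/#|{: dchar}| card_dirichlet_char//.
  by rewrite mulrC expr2.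
move=> j /andP[Pj ji]; rewrite -mulr_sumr sum_all_characters ?mulr0 ?nu_coprime//.
rewrite !modn_small ?(leq_ltn_trans (nu_le _))// => /(nu_inj Pi Pj) ij.
by rewrite ij eqxx in ji.
Qed.

(** All terms are nonnegative by [sum_subgroup_ge0]; those with [nu j = n * nu i]
   contribute [#|H|] each.  The partial sum has to be as long as the resonator. *)
Lemma resonance_lower (H : {group dchar}) x : (N <= x)%N ->
  (#|H|%:R * resV)%:C <= \sum_(chi in H) psum chi x * (rho chi)%:C.
Proof.
move=> Nx.
pose t i j n : R[i] := (invsqrt R n.+1 * (r i * r j))%:C *
  \sum_(chi in H) chi (n.+1 * nu i)%N * (chi (nu j))^*%C.
have t_ge0 i j n : P i -> P j -> 0 <= t i j n.
  move=> Pi Pj; apply: mulr_ge0.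
    by rewrite ler0c mulr_ge0 ?invsqrt_ge0// mulr_ge0.
  have [cn|ncn] := boolP (coprime n.+1 q).
    by apply: sum_subgroup_ge0 => //; rewrite ?coprimeMl ?cn nu_coprime.
  by rewrite big1// => chi _; rewrite dirichlet_charM dirichlet_char0// !mul0r.
have -> : \sum_(chi in H) psum chi x * (rho chi)%:C =
    \sum_(i | P i) \sum_(j | P j) \sum_(n < x) t i j n.
  transitivity (\sum_(chi in H) \sum_(i | P i) \sum_(j | P j) \sum_(n < x)
      (invsqrt R n.+1 * (r i * r j))%:C * (chi (n.+1 * nu i)%N * (chi (nu j))^*%C)).
    apply: eq_bigr => chi _; rewrite rhoE mulr_sumr; apply: eq_bigr => i _.
    rewrite mulr_sumr; apply: eq_bigr => j _; rewrite /psum mulr_suml.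
    by apply: eq_bigr => n _; rewrite dirichlet_charM rmorphM /=; ring.
  rewrite exchange_big; apply: eq_bigr => i _; rewrite exchange_big; apply: eq_bigr => j _.
  by rewrite exchange_big; apply: eq_bigr => n _; rewrite /t mulr_sumr.
rewrite rmorphM /= rmorph_sum /= mulr_sumr; apply: ler_sum => i Pi.
rewrite rmorph_sum /= mulr_sumr big_mkcondr /=; apply: ler_sum => j Pj.
case: ifP => [/dvdnP[k kij]|_]; last by apply: sumr_ge0 => n _; exact: t_ge0.
have k0 : (0 < k)%N by have := nu_gt0 Pj; rewrite kij muln_gt0 => /andP[].
have kx : (k.-1 < x)%N.
  rewrite prednK//; apply: leq_trans Nx; apply: leq_trans (nu_le Pj).
  by rewrite kij leq_pmulr ?nu_gt0.
rewrite (bigD1 (Ordinal kx))//= -[X in X <= _]addr0; apply: lerD; last first.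
  by apply: sumr_ge0 => n _; exact: t_ge0.
rewrite /t prednK// -kij sum_subgroup_eq ?nu_coprime//.
rewrite kij mulnK ?nu_gt0// -(rmorph_nat (real_complex R) #|H|) -!rmorphM lecR.
by rewrite le_eqVlt; apply/orP; left; apply/eqP; ring.
Qed.

Lemma sum_invsqrt_le x : \sum_(n < x) invsqrt R n.+1 <= 2 * Num.sqrt x%:R.
Proof.
elim: x => [|x IH]; first by rewrite big_ord0 sqrtr0 mulr0.
rewrite big_ord_recr /=; apply: le_trans (lerD IH (lexx _)) _.
rewrite /invsqrt; set a := Num.sqrt x%:R; set b := Num.sqrt x.+1%:R.
have a0 : 0 <= a by rewrite sqrtr_ge0.
have b0 : 0 < b by rewrite sqrtr_gt0 ltr0n.
have ab : b ^+ 2 = a ^+ 2 + 1 by rewrite !sqr_sqrtr// natr1.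
rewrite -(ler_pM2r b0) mulrDl mulVf ?gt_eqF//.
have := sqr_ge0 (b - a); rewrite -subr_ge0 => H.
rewrite -subr_ge0 [X in 0 <= X](_ : _ = (b - a) ^+ 2); first exact: sqr_ge0.
have -> : 2 * b * b = b ^+ 2 + b ^+ 2 by ring.
by rewrite {1}ab; ring.
Qed.

Lemma normc_psum_le chi x : normc (psum chi x) <= 2 * Num.sqrt x%:R.
Proof.
apply: le_trans (normc_sum _ _ _) _; apply: le_trans (sum_invsqrt_le x).
apply: ler_sum => n _; rewrite normcM normc_real ger0_norm ?invsqrt_ge0//.
by rewrite ler_piMl ?invsqrt_ge0// normc_char_le1.
Qed.

(** The Cauchy-Schwarz inequality over at most [N] integers. *)
Lemma rho_le chi : rho chi <= N%:R * resW.
Proof.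
rewrite /rho; apply: (@le_trans _ _ ((\sum_(i | P i) r i) ^+ 2)).
  rewrite lerXn2r ?nnegrE ?normc_ge0 ?sumr_ge0//.
  apply: le_trans (normc_sum _ _ _) _; apply: ler_sum => i _.
  by rewrite normcM normc_real ger0_norm// ler_piMr// normc_char_le1.
have card_le : (#|P| <= N)%N.
  rewrite cardE -(size_map nu) -[leqRHS](size_iota 1); apply: uniq_leq_size.
    rewrite map_inj_in_uniq ?enum_uniq// => i j; rewrite !mem_enum => Pi Pj.
    exact: nu_inj.
  move=> _ /mapP[i + ->]; rewrite mem_enum mem_iota add1n ltnS => Pi.
  by rewrite nu_gt0// nu_le.
have -> : (\sum_(i | P i) r i) ^+ 2 = \sum_(i | P i) \sum_(j | P j) r i * r j.
  by rewrite expr2 big_distrl; apply: eq_bigr => i _; rewrite big_distrr.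
apply: (@le_trans _ _ (\sum_(i | P i) \sum_(j | P j) (r i ^+ 2 / 2 + r j ^+ 2 / 2))).
  apply: ler_sum => i _; apply: ler_sum => j _.
  by have := sqr_ge0 (r i - r j); rewrite sqrrB => ?; lra.
have -> : \sum_(i | P i) \sum_(j | P j) (r i ^+ 2 / 2 + r j ^+ 2 / 2) =
    #|P|%:R * resW.
  under eq_bigr do rewrite big_split /= sumr_const -mulr_suml -/resW.
  rewrite big_split /= sumr_const sumrMnl -mulr_suml -/resW.
  by rewrite -mulrnDl -splitr mulr_natl.
by rewrite ler_wpM2r ?ler_nat// sumr_ge0// => i _; rewrite sqr_ge0.
Qed.

(** The averaged partial sums replace the central values at the cost [E]; the
   principal character is estimated trivially. *)
Lemma resonance (H : {group dchar}) (X : nat) (L : dchar -> R[i]) (E M : R) :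
  (0 < X)%N -> (N <= X)%N -> 0 <= M + E ->
  (forall chi, chi \in H -> chi != 1%g ->
     normc (L chi - (\sum_(x < X) psum chi (X + x)) / X%:R) <= E) ->
  (forall chi, chi \in H -> chi != 1%g -> normc (L chi) <= M) ->
  #|H|%:R * resV <= (2 * Num.sqrt (X + X)%:R * N%:R + (M + E) * q.-1%:R) * resW.
Proof.
move=> X0 NX ME0 LE LM.
pose p chi := (\sum_(x < X) psum chi (X + x)) / X%:R.
have X0' : 0 < X%:R :> R by rewrite ltr0n.
have lower : (#|H|%:R * resV)%:C <= \sum_(chi in H) p chi * (rho chi)%:C.
  have -> : \sum_(chi in H) p chi * (rho chi)%:C =
      (X%:R)^-1%:C * \sum_(x < X) \sum_(chi in H) psum chi (X + x) * (rho chi)%:C.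
    rewrite exchange_big mulr_sumr; apply: eq_bigr => chi _.
    by rewrite /p -!mulr_suml fmorphV rmorph_nat; ring.
  have cX : X%:R%:C * (X%:R^-1)%:C = 1 :> R[i] by rewrite -rmorphM divff ?gt_eqF.
  rewrite -(@ler_pM2l _ X%:R%:C) ?ltcR// [leRHS]mulrA cX mul1r.
  have -> : X%:R%:C * (#|H|%:R * resV)%:C = \sum_(x < X) (#|H|%:R * resV)%:C.
    by rewrite sumr_const card_ord -[RHS]mulr_natl rmorph_nat.
  by apply: ler_sum => x _; apply: resonance_lower; rewrite (leq_trans NX) ?leq_addr.
have resV0 : 0 <= #|H|%:R * resV.
  by rewrite mulr_ge0// sumr_ge0// => i _; rewrite sumr_ge0// => j _; rewrite !mulr_ge0 ?invsqrt_ge0.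
have lower' : #|H|%:R * resV <= normc (\sum_(chi in H) p chi * (rho chi)%:C).
  rewrite -lecR -normcE_norm; apply: (le_trans lower); apply: real_ler_norm.
  have S0 : 0 <= \sum_(chi in H) p chi * (rho chi)%:C.
    by apply: le_trans lower; rewrite ler0c.
  exact: ger0_real.
apply: le_trans lower' _; apply: le_trans (normc_sum _ _ _) _.
have nterm chi : normc (p chi * (rho chi)%:C) = normc (p chi) * rho chi.
  by rewrite normcM normc_real ger0_norm ?rho_ge0.
rewrite (bigD1 (1%g : dchar)) ?group1//= mulrDl; apply: lerD.
  rewrite nterm -mulrA; apply: ler_pM; rewrite ?normc_ge0 ?rho_ge0 ?rho_le//.
  rewrite /p normcM normcV normc_nat ler_pdivrMr//.
  apply: le_trans (normc_sum _ _ _) _.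
  rewrite mulr_natr -[X in _ <= _ *+ X]card_ord -sumr_const; apply: ler_sum => x _.
  apply: le_trans (normc_psum_le _ _) _; rewrite ler_wpM2l// ler_sqrt ?ler_nat//.
  by rewrite leq_add2l ltnW.
rewrite -mulrA -sum_rho mulr_sumr.
apply: (@le_trans _ _ (\sum_(chi in H | chi != 1%g) (M + E) * rho chi)).
  apply: ler_sum => chi /andP[chiH chi1]; rewrite nterm ler_wpM2r ?rho_ge0//.
  have -> : p chi = L chi - (L chi - p chi) by ring.
  by apply: le_trans (normcB _ _) _; rewrite lerD ?LM ?LE.
rewrite big_mkcond /=; apply: ler_sum => chi _.
by case: ifP => // _; rewrite mulr_ge0 ?rho_ge0.
Qed.

End Resonance.

(** * The product of the primes up to n *)

Section Primorial.

Lemma prod_primes_dvd m n c : (forall p, prime p -> (m <= p < n)%N -> (p %| c)%N) ->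
  (\prod_(m <= p < n | prime p) p %| c)%N.
Proof.
elim: n => [|n IH] H; first by rewrite big_geq// dvd1n.
have [mn|nm] := leqP m n; last by rewrite big_geq// dvd1n.
have IH' : (\prod_(m <= p < n | prime p) p %| c)%N.
  by apply: IH => p pp /andP[mp pn]; rewrite H// mp ltnS ltnW.
rewrite big_mkcond big_nat_recr//= -big_mkcond /=; case: ifP => pn; last by rewrite muln1.
rewrite Gauss_dvd; first by rewrite IH' H// mn ltnSn.
rewrite coprime_sym big_seq_cond; elim/big_ind: _ => [|a b ca cb|p].
- exact: coprimen1.
- by rewrite coprimeMr ca.
- rewrite mem_index_iota => /andP[/andP[_ pn'] pp].
  rewrite prime_coprime// dvdn_prime2//; by rewrite gtn_eqF.
Qed.

Lemma binS_le n k : ('C(n.+1, k) <= 2 ^ n)%N.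
Proof.
elim: n k => [|n IH] [|k]; rewrite ?bin0 ?expn_gt0//.
  by rewrite binS bin0n; case: k.
by rewrite binS expnS mul2n -addnn leq_add.
Qed.

Lemma bin_middle_le m : ('C(m.*2.+1, m) <= 4 ^ m)%N.
Proof.
have E : 'C(m.*2.+1, m.+1) = 'C(m.*2.+1, m).
  rewrite -[in RHS]bin_sub; last by rewrite ltnW// ltnS -addnn leq_addr.
  by congr ('C(_, _)); rewrite -addnn -addSn addnK.
have := binS_le m.*2.+1 m.+1; rewrite binS E addnn -mul2n expnS leq_pmul2l//.
by rewrite -[4%N]/(2 ^ 2)%N -expnM mul2n.
Qed.

(** Erdos's argument: the primes between [m + 2] and [2 m + 1] divide the binomial
   coefficient of [2 m + 1] over [m], which is at most [4 ^ m]. *)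
Lemma primorial_le n : (\prod_(0 <= p < n.+1 | prime p) p <= 4 ^ n)%N.
Proof.
elim/ltn_ind: n => -[|[|n]] IH.
- by rewrite big_mkcond big_nat1.
- by rewrite big_mkcond !big_nat_recr//= big_geq.
have [E|n2] := eqVneq n 0%N.
  by rewrite E big_mkcond !big_nat_recr//= big_geq.
rewrite big_mkcond big_nat_recr//= -big_mkcond /=.
have [od|ev] := boolP (odd n); last first.
  have np : prime n.+2 = false.
    apply/negP => pn; have := even_prime pn; rewrite /= negbK (negbTE ev) => -[] // [].
    by move/eqP: n2.
  rewrite np muln1; apply: leq_trans (IH n.+1 _) _ => //.
  by rewrite leq_exp2l.
pose m := n.+1./2.
have nm : n.+2 = m.*2.+1.
  by rewrite -[in LHS](odd_double_half n.+1) /= od add0n.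
have m0 : (0 < m)%N by rewrite half_gt0 ltnS lt0n.
have -> : (\prod_(0 <= i < n.+2 | prime i) i * (if prime n.+2 then n.+2 else 1) =
    \prod_(0 <= i < m.+2 | prime i) i * \prod_(m.+2 <= i < m.*2.+2 | prime i) i)%N.
  rewrite -big_cat_nat//=; last by rewrite !ltnS -addnn leq_addr.
  by rewrite -nm big_mkcond [in RHS]big_mkcond [in RHS]big_nat_recr.
have -> : (4 ^ n.+2 = 4 ^ m.+1 * 4 ^ m)%N by rewrite -expnD nm addSn addnn.
apply: leq_mul; first by apply: IH; rewrite nm ltnS -addnn -addn1 leq_add2l.
apply: leq_trans (bin_middle_le m).
apply: dvdn_leq; first by rewrite bin_gt0 ltnW// ltnS -addnn leq_addr.
apply: prod_primes_dvd => p pp /andP[mp pm].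
have := bin_fact (_ : m <= m.*2.+1)%N; rewrite ltnW ?ltnS -?addnn ?leq_addr// => /(_ isT) BF.
have pd : (p %| (m + m).+1`!)%N by rewrite dvdn_fact// prime_gt0//= addnn.
move: pd; rewrite -BF !Euclid_dvdM//; case/orP => //.
have small k : (k < p)%N -> (p %| k`!)%N = false.
  move=> kp; apply/negbTE; elim: k kp => [|k IHk] kp.
    by rewrite fact0 dvdn1 gtn_eqF// prime_gt1.
  by rewrite factS Euclid_dvdM// gtnNdvd//= IHk// ltnW.
have -> : ((m + m).+1 - m = m.+1)%N by lia.
by rewrite !small// ltnW.
Qed.

End Primorial.

(** * Mertens' estimate and sums of 1 / (p ln p) *)

Section Mertens.
Variable R : realType.
Local Notation lnn n := (ln (n%:R : R)).

Lemma lnn_ge0 n : 0 <= lnn n.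
Proof. by case: n => [|n]; [rewrite ln0 | rewrite ln_ge0// ler1n]. Qed.

Lemma lnnM m n : (0 < m)%N -> (0 < n)%N -> lnn (m * n) = lnn m + lnn n.
Proof. by move=> m0 n0; rewrite natrM lnM ?posrE ?ltr0n. Qed.

Lemma lnnX m n : (0 < m)%N -> lnn (m ^ n) = n%:R * lnn m.
Proof.
move=> m0; elim: n => [|n IH]; first by rewrite ln1 mul0r.
by rewrite expnS lnnM ?expn_gt0 ?m0// IH -natr1; ring.
Qed.

Lemma lnn_prod (I : eqType) (s : seq I) (P : pred I) (F : I -> nat) :
  (forall i, P i -> (0 < F i)%N) ->
  lnn (\prod_(i <- s | P i) F i) = \sum_(i <- s | P i) lnn (F i).
Proof.
move=> F0; elim: s => [|i s IH]; first by rewrite !big_nil ln1.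
rewrite !big_cons; case: ifP => Pi; last exact: IH.
rewrite lnnM ?F0 ?IH// big_seq_cond; elim/big_ind: _ => // [a b a0 b0|j].
  by rewrite muln_gt0 a0.
by move=> /andP[_ Pj]; exact: F0.
Qed.

Lemma lnn_le m n : (0 < m)%N -> (m <= n)%N -> lnn m <= lnn n.
Proof.
by move=> m0 mn; rewrite ler_ln ?posrE ?ltr0n ?ler_nat// (leq_trans m0).
Qed.

Definition mertens n : R := \sum_(0 <= p < n.+1 | prime p) lnn p / p%:R.
Definition chebyshev n : R := \sum_(0 <= p < n.+1 | prime p) lnn p.

Lemma chebyshev_le n : chebyshev n <= n%:R * lnn 4.
Proof.
rewrite /chebyshev -(@lnn_prod _ _ prime (fun p => p)); last by move=> p; exact: prime_gt0.
rewrite -lnnX//; apply: lnn_le; last exact: primorial_le.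
rewrite big_seq_cond; elim/big_ind: _ => // [a b a0 b0|p /andP[_ /prime_gt0//]].
by rewrite muln_gt0 a0.
Qed.

Lemma lnn_factor m n : (0 < m)%N -> (m <= n)%N ->
  lnn m = \sum_(0 <= p < n.+1 | prime p) (logn p m)%:R * lnn p.
Proof.
move=> m0 mn; rewrite -[in LHS](partnT m0) (widen_partn _ mn) lnn_prod; last first.
  by move=> [|p] _; rewrite ?expn_gt0.
rewrite big_mkcond [in RHS]big_mkcond /=; apply: eq_bigr => -[|p] _.
  by rewrite lognE /= ln1.
by case: ifP => [pp|pp] /=; [rewrite lnnX | rewrite lognE pp /= expn0 ln1].
Qed.

(** Both inequalities of Mertens come from evaluating [ln n`!] in two ways, by
   Stirling's elementary bounds and by its prime factorization. *)
Lemma lnn_fact n :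
  lnn n`! = \sum_(0 <= p < n.+1 | prime p) (logn p n`!)%:R * lnn p.
Proof.
suff H m : (m <= n)%N ->
    lnn m`! = \sum_(0 <= p < n.+1 | prime p) (logn p m`!)%:R * lnn p by exact: H.
elim: m => [_|m IH mn].
  by rewrite ln1 big1// => p _; rewrite logn1 mul0r.
rewrite factS lnnM ?fact_gt0// IH 1?ltnW// (lnn_factor (ltn0Sn m) mn).
rewrite -big_split /=; apply: eq_bigr => p _.
by rewrite lognM ?fact_gt0// natrD mulrDl.
Qed.

Lemma lnn_fact_le n : lnn n`! <= n%:R * lnn n.
Proof.
elim: n => [|n IH]; first by rewrite ln1 mul0r.
rewrite factS lnnM ?fact_gt0// -natr1 mulrDl mul1r addrC lerD2r.
apply: le_trans IH _; apply: ler_wpM2l => //.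
rewrite natr1; case: n => [|n]; last exact: lnn_le.
by rewrite ln1 ln0.
Qed.

Lemma lnn_fact_ge n : n%:R * lnn n - n%:R <= lnn n`!.
Proof.
case: n => [|n]; first by rewrite mul0r subrr ln1.
elim: n => [|n IH]; first by rewrite mul1r ln1; lra.
rewrite factS lnnM ?fact_gt0//.
have H : lnn n.+2 - lnn n.+1 <= n.+1%:R^-1.
  rewrite -ln_div ?posrE ?ltr0n//.
  have -> : n.+2%:R / n.+1%:R = 1 + n.+1%:R^-1 :> R.
    by rewrite -natr1 mulrDl divff ?pnatr_eq0// mul1r.
  by apply: le_ln1Dx; rewrite (lt_trans (ltrN10 _))// invr_gt0.
have {}H : n.+1%:R * (lnn n.+2 - lnn n.+1) <= 1.
  by rewrite -ler_pdivlMl// mulr1.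
have E : n.+2%:R = n.+1%:R + 1 :> R by rewrite natr1.
move: IH H; set a := lnn n.+2; set b := lnn n.+1; set c := lnn n.+1`!.
by rewrite E; move: a b c (n.+1%:R : R) => a b c d; lra.
Qed.

Lemma mertens_le n : (0 < n)%N -> mertens n <= lnn n + lnn 4.
Proof.
move=> n0; have n0' : 0 < n%:R :> R by rewrite ltr0n.
rewrite -(ler_pM2l n0') mulrDr.
apply: (@le_trans _ _ (lnn n`! + chebyshev n)); last first.
  by apply: lerD; [exact: lnn_fact_le | exact: chebyshev_le].
rewrite lnn_fact /chebyshev -big_split /mertens mulr_sumr /=; apply: ler_sum => p pp.
rewrite -[X in _ + X]mul1r -mulrDl mulrCA mulrC ler_wpM2r ?lnn_ge0//.
have p0 : 0 < p%:R :> R by rewrite ltr0n prime_gt0.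
rewrite ler_pdivrMr//.
rewrite natr1 -natrM ler_nat logn_fact// big_nat_recl//= expn1.
rewrite -addSn mulnDl; apply: leq_trans (leq_addr _ _).
by rewrite {1}(divn_eq n p) mulSn addnC leq_add2r ltnW// ltn_pmod// prime_gt0.
Qed.

Lemma logn_fact_le p n : prime p -> (logn p n`!)%:R <= n%:R / (p%:R - 1) :> R.
Proof.
move=> pp; have p1 : 0 < p%:R - 1 :> R by rewrite subr_gt0 ltr1n prime_gt1.
have p0 : 0 < p%:R :> R by rewrite ltr0n prime_gt0.
rewrite logn_fact// natr_sum.
apply: (@le_trans _ _ (\sum_(1 <= k < n.+1) n%:R * (p%:R ^+ k)^-1)).
  apply: ler_sum => k _; rewrite ler_pdivlMr ?exprn_gt0//.
  by rewrite -natrX -natrM ler_nat leq_trunc_div.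
rewrite -mulr_sumr ler_wpM2l//.
have -> : \sum_(1 <= k < n.+1) (p%:R ^+ k)^-1 = (1 - (p%:R ^+ n)^-1) / (p%:R - 1) :> R.
  elim: n => [|n IH]; first by rewrite big_geq// expr0 invr1 subrr mul0r.
  rewrite big_nat_recr//= IH exprS.
  have := exprn_gt0 n p0; move: (p%:R ^+ n) => x x0; field.
  by rewrite !gt_eqF.
by rewrite ler_pdivrMr// mulVf ?gt_eqF// gerBl invr_ge0 exprn_ge0// ltW.
Qed.

(** The right-hand side is chosen so that the inequality telescopes; it bounds the
   contribution of the higher prime powers to [ln n`!]. *)
Lemma sum_ln_telescope n : \sum_(2 <= m < n.+2) lnn m / (m%:R * (m%:R - 1)) <= 2 - (lnn n.+1 + 2) / n.+1%:R.
Proof.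
elim: n => [|n IH]; first by rewrite big_geq// ln1 add0r divr1 subrr.
rewrite big_nat_recr//=; apply: le_trans (lerD IH (lexx _)) _.
have H : lnn n.+2 - lnn n.+1 <= n.+1%:R^-1.
  rewrite -ln_div ?posrE ?ltr0n//.
  have -> : n.+2%:R / n.+1%:R = 1 + n.+1%:R^-1 :> R.
    by rewrite -natr1 mulrDl divff ?pnatr_eq0// mul1r.
  by apply: le_ln1Dx; rewrite (lt_trans (ltrN10 _))// invr_gt0.
have x1 : 1 <= n.+1%:R :> R by rewrite ler1n.
have E : n.+2%:R = n.+1%:R + 1 :> R by rewrite natr1.
move: H; set a := lnn n.+2; set b := lnn n.+1; rewrite E.
move: a b (n.+1%:R : R) x1 => a b x x1 H.
have x0 : 0 < x by lra.
have H' : x * (a - b) <= 1 by rewrite -ler_pdivlMl// mulr1.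
rewrite -subr_ge0.
rewrite [X in 0 <= X](_ : _ = (2 - (x + 1) * (a - b)) / (x * (x + 1))); last first.
  by field; rewrite !gt_eqF ?addr_gt0.
apply: divr_ge0; last by nra.
have : a - b <= 1 by apply: le_trans H _; rewrite invf_le1.
by nra.
Qed.

Lemma mertens_ge n : (0 < n)%N -> lnn n - 3 <= mertens n.
Proof.
move=> n0; have n0' : 0 < n%:R :> R by rewrite ltr0n.
suff : lnn n`! <= n%:R * (mertens n + 2).
  have := lnn_fact_ge n => A B.
  have := le_trans A B; rewrite -[X in _ - X]mulr1 -mulrBr ler_pM2l//; lra.
rewrite lnn_fact.
apply: (@le_trans _ _ (\sum_(0 <= p < n.+1 | prime p) n%:R * (lnn p / p%:R + lnn p / (p%:R * (p%:R - 1))))).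
  apply: ler_sum => p pp; apply: le_trans (ler_wpM2r (lnn_ge0 p) (logn_fact_le n pp)) _.
  have p1 : 1 < p%:R :> R by rewrite ltr1n prime_gt1.
  rewrite le_eqVlt; apply/orP; left; apply/eqP; field.
  by rewrite !gt_eqF; lra.
rewrite -mulr_sumr ler_wpM2l// big_split lerD2l.
have T2 : \sum_(2 <= m < n.+2) lnn m / (m%:R * (m%:R - 1)) <= 2.
  apply: le_trans (sum_ln_telescope n) _; rewrite gerBl.
  by rewrite divr_ge0// addr_ge0 ?lnn_ge0.
apply: le_trans T2.
rewrite big_mkcond /= (@big_cat_nat _ _ _ 2%N 0%N) ?ltnS//=.
rewrite [X in X + _](_ : _ = 0) ?add0r; last first.
  by rewrite big_mkord !big_ord_recl big_ord0 /= !addr0.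
have pos m : (2 <= m)%N -> 0 <= lnn m / (m%:R * (m%:R - 1)).
  move=> m2; rewrite divr_ge0 ?lnn_ge0// mulr_ge0// subr_ge0 ler1n.
  by rewrite ltnW.
rewrite [leRHS]big_nat_recr//=; apply: (@le_trans _ _ (\sum_(2 <= i < n.+1) lnn i / (i%:R * (i%:R - 1)))).
  apply: ler_sum_nat => i /andP[i2 _]; case: ifP => // _; exact: pos.
by rewrite lerDl pos.
Qed.

(** The exponent of the resonator's gain is a multiple of such a sum.  The range is
   written with powers of one integer [z], so that it is cut into the ranges
   [z ^ j < p <= z ^ j.+1] without rounding. *)
Definition sigma z D K : R :=
  \sum_((z ^ D).+1 <= p < (z ^ K).+1 | prime p) (p%:R * lnn p)^-1.

Lemma ln4_le2 : lnn 4 <= 2.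
Proof.
rewrite -ler_expR lnK ?posrE//.
have := @expR_ge1Dxn R 2 1 ltac:(lra).
have -> : (2`! = 2)%N by [].
have E : expR 2 = expR 1 ^+ 2 :> R by rewrite -expRM_natl mulr1.
have := expR_ge1Dx (1 : R) => h _.
by rewrite E; nra.
Qed.

(** On [z ^ j < p <= z ^ j.+1] the weight [1 / (p ln p)] is at least
   [(ln p / p) / (j.+1 * ln z) ^ 2], and the difference of two Mertens sums is
   [ln z - O(1)].  Since the error [O(1)] is paid on each range, [ln z] has to be
   large. *)
Lemma sigma_step z j : (1 < z)%N ->
  (lnn z - 5) / (j.+1%:R * lnn z) ^+ 2 <= sigma z j j.+1.
Proof.
move=> z1; have z0 : (0 < z)%N by rewrite ltnW.
have lz0 : 0 < lnn z by rewrite ln_gt0// ltr1n.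
have zj : (z ^ j <= z ^ j.+1)%N by rewrite leq_exp2l.
have M : lnn z - 5 <= \sum_((z ^ j).+1 <= p < (z ^ j.+1).+1 | prime p) lnn p / p%:R.
  have -> : \sum_((z ^ j).+1 <= p < (z ^ j.+1).+1 | prime p) lnn p / p%:R =
      mertens (z ^ j.+1) - mertens (z ^ j).
    rewrite /mertens (@big_cat_nat _ _ _ (z ^ j).+1 0%N) ?ltnS//=.
    by rewrite addrAC subrr add0r.
  have := @mertens_ge (z ^ j.+1) ltac:(by rewrite expn_gt0 z0).
  have := @mertens_le (z ^ j) ltac:(by rewrite expn_gt0 z0).
  rewrite !lnnX// -(natr1 j) => A B; have := ln4_le2; lra.
have c0 : 0 < j.+1%:R * lnn z by rewrite mulr_gt0.
rewrite ler_pdivrMr ?exprn_gt0//; apply: le_trans M _.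
rewrite /sigma mulr_suml big_nat_cond [leRHS]big_nat_cond; apply: ler_sum => p.
move=> /andP[/andP[pj pj1] pp].
have p1 : (1 < p)%N := prime_gt1 pp.
have lp0 : 0 < lnn p by rewrite ln_gt0// ltr1n.
have p0 : 0 < p%:R :> R by rewrite ltr0n prime_gt0.
rewrite ler_pdivlMl ?mulr_gt0//.
have -> : p%:R * lnn p * (lnn p / p%:R) = lnn p ^+ 2 by field; rewrite gt_eqF.
have lp : lnn p <= j.+1%:R * lnn z by rewrite -lnnX// lnn_le// ltnW.
by rewrite lerXn2r ?nnegrE// ltW.
Qed.

(** The bounds on the ranges are compared with the telescoping sum of
   [1 / (j.+1 * j.+2)]. *)
Lemma sigma_lower z D K : (D <= K)%N -> (1 < z)%N -> 5 <= lnn z ->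
  (1 - 5 / lnn z) / lnn z * (D.+1%:R^-1 - K.+1%:R^-1) <= sigma z D K.
Proof.
move=> DK z1 z5; have z0 : (0 < z)%N by rewrite ltnW.
have lz0 : 0 < lnn z by lra.
elim: K DK => [|K IH]; first by rewrite leqn0 => /eqP ->; rewrite subrr mulr0 /sigma big_geq.
rewrite leq_eqVlt => /orP[/eqP <-|]; first by rewrite subrr mulr0 /sigma big_geq.
rewrite ltnS => DK; have {}IH := IH DK.
have -> : sigma z D K.+1 = sigma z D K + sigma z K K.+1.
  by rewrite /sigma -big_cat_nat//= ltnS leq_exp2l// ltnW.
apply: le_trans (lerD IH (sigma_step K z1)).
have H : 0 < K.+1%:R :> R by [].
have -> : K.+2%:R = K.+1%:R + 1 :> R by rewrite natr1.
rewrite -subr_ge0; move: (K.+1%:R : R) H (lnn z) z5 lz0 (D.+1%:R^-1 : R) => x x0 l l5 l0 d.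
rewrite [X in 0 <= X](_ : _ = (l - 5) / (l ^+ 2 * x ^+ 2 * (x + 1))); last first.
  by field; rewrite !gt_eqF ?addr_gt0.
by rewrite divr_ge0 ?subr_ge0// !mulr_ge0 ?exprn_ge0 ?addr_ge0 ?ltW.
Qed.

End Mertens.

(** * Squarefree resonators *)

Section SquarefreeResonator.
Variables (R : realType) (J : finType) (pr : J -> nat) (rho1 : J -> R) (N : nat).
Hypothesis pr_prime : forall j, prime (pr j).
Hypothesis pr_inj : injective pr.
Hypothesis rho1_ge0 : forall j, 0 <= rho1 j.
Hypothesis N_gt0 : (0 < N)%N.
Implicit Types (A B : {set J}).

(** The resonator is supported on squarefree integers, which are products over sets
   of primes. *)
Definition nuS A : nat := (\prod_(j in A) pr j)%N.
Definition rS A : R := \prod_(j in A) rho1 j.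

Let pr_gt0 j : (0 < pr j)%N. Proof. exact: prime_gt0. Qed.

Lemma nuS_gt0 A : (0 < nuS A)%N.
Proof. by apply: prodn_gt0. Qed.

Lemma rS_ge0 A : 0 <= rS A.
Proof. by apply: prodr_ge0. Qed.

Lemma dvdn_nuS j A : (pr j %| nuS A)%N = (j \in A).
Proof.
apply/idP/idP => [|jA]; last by rewrite /nuS (bigD1 j)//= dvdn_mulr.
apply: contraTT => jA; rewrite -prime_coprime//.
rewrite /nuS; elim/big_ind: _ => [|a b ca cb|i iA].
- exact: coprimen1.
- by rewrite coprimeMr ca.
- rewrite prime_coprime// dvdn_prime2//; apply: contra jA => /eqP/pr_inj ->.
  exact: iA.
Qed.

Lemma nuS_inj : injective nuS.
Proof. by move=> A B AB; apply/setP => j; rewrite -!dvdn_nuS AB. Qed.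

Lemma nuS_setD A B : B \subset A -> nuS A = (nuS B * nuS (A :\: B))%N.
Proof.
move=> BA; rewrite /nuS (big_setID B)/=; congr (_ * _)%N.
by rewrite (finset.setIidPr BA).
Qed.

Lemma rS_setD A B : B \subset A -> rS A = rS B * rS (A :\: B).
Proof.
move=> BA; rewrite /rS (big_setID B)/=; congr (_ * _).
by rewrite (finset.setIidPr BA).
Qed.

Lemma invsqrtM m n : invsqrt R (m * n) = invsqrt R m * invsqrt R n.
Proof. by rewrite /invsqrt natrM sqrtrM// invfM. Qed.

Lemma invsqrt_nuS A : invsqrt R (nuS A) = \prod_(j in A) invsqrt R (pr j).
Proof.
rewrite /nuS; elim/big_ind2: _ => // [|m a n b <- <-]; last by rewrite invsqrtM.
by rewrite /invsqrt sqrtr1 invr1.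
Qed.

Lemma prodrD_subset (x y : J -> R) A :
  \prod_(j in A) (x j + y j) =
  \sum_(B : {set J} | B \subset A) (\prod_(j in B) x j) * \prod_(j in A :\: B) y j.
Proof.
rewrite big_mkcond /=.
rewrite (eq_bigr (fun j => (if j \in A then x j else 0) + (if j \in A then y j else 1))); last first.
  by move=> j _; case: ifP => // _; rewrite add0r.
rewrite bigA_distr [RHS]big_mkcond /=; apply: eq_bigr => B _.
case: ifP => [BA|/negbT/subsetPn[j jB jA]]; last first.
  by rewrite (bigD1 j)//= jB (negbTE jA) mul0r.
rewrite [X in _ = X * _]big_mkcond [X in _ = _ * X]big_mkcond -big_split /=.
apply: eq_bigr => j _; rewrite finset.in_setD.
have [jB|jB] := boolP (j \in B); last by rewrite mul1r.
by rewrite (fintype.subsetP BA _ jB) /= mulr1.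
Qed.

Lemma sum_prod_set (x : J -> R) :
  \sum_(A : {set J}) \prod_(j in A) x j = \prod_j (1 + x j).
Proof.
rewrite (eq_bigr (fun j => x j + 1)); last by move=> j _; rewrite addrC.
rewrite bigA_distr; apply: eq_bigr => A _.
by rewrite big_mkcond.
Qed.

(** The factor at [p] of the sum over [n m = m'] for a multiplicative weight: either
   [p] divides both [m] and [m'], or it divides [n] and [m']. *)
Definition gS j : R := rho1 j ^+ 2 + rho1 j * invsqrt R (pr j).

Let PN : pred {set J} := fun A => (nuS A <= N)%N.

(** Only the pairs [B], [A] with [B] included in [A] contribute, and the sum over [B]
   factors over the primes of [A]. *)
Lemma resV_lower : \sum_(A : {set J} | PN A) \prod_(j in A) gS j <=
  resV PN nuS rS.
Proof.
rewrite /resV (exchange_big_dep PN) /=; last by move=> A B _ /andP[].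
apply: ler_sum => A PA.
rewrite /gS prodrD_subset.
rewrite [leRHS](bigID (fun B => B \subset A)) /= -[leLHS]addr0; apply: lerD; last first.
  by apply: sumr_ge0 => B _; rewrite !mulr_ge0 ?rS_ge0// invsqrt_ge0.
rewrite le_eqVlt; apply/orP; left; apply/eqP; apply: eq_big => [B|B BA].
  have [BA|BA] := boolP (B \subset A); last by rewrite andbF.
  rewrite PA (nuS_setD BA) dvdn_mulr// !andbT; apply/esym.
  by apply: leq_trans PA; rewrite (nuS_setD BA) leq_pmulr// nuS_gt0.
rewrite (nuS_setD BA) mulKn ?nuS_gt0// invsqrt_nuS (rS_setD BA) /rS.
by rewrite prodrXl big_split /=; ring.
Qed.

Lemma resW_upper : resW PN rS <= \prod_j (1 + rho1 j ^+ 2).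
Proof.
rewrite -sum_prod_set /resW big_mkcond; apply: ler_sum => A _.
rewrite /rS prodrXl; case: ifP => // _; exact: sqr_ge0.
Qed.

(** Rankin's trick: the factor [(nuS A / N) ^ al] is at least 1 on the sets with
   [N < nuS A], and the sum over all sets with this factor inserted is an Euler
   product. *)
Lemma rankin (al : R) : 0 <= al ->
  \prod_j (1 + gS j) - expR (- al * ln N%:R) * \prod_j (1 + expR (al * ln (pr j)%:R) * gS j)
  <= \sum_(A : {set J} | PN A) \prod_(j in A) gS j.
Proof.
move=> al0; rewrite -!sum_prod_set (bigID PN) /= lerBlDr lerD2l.
have g0 j : 0 <= gS j by rewrite addr_ge0 ?sqr_ge0// mulr_ge0// invsqrt_ge0.
rewrite mulr_sumr big_mkcond; apply: ler_sum => A _.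
have pos : 0 <= \prod_(j in A) gS j by apply: prodr_ge0.
have -> : \prod_(j in A) (expR (al * ln (pr j)%:R) * gS j) =
    expR (al * ln (nuS A)%:R) * \prod_(j in A) gS j.
  rewrite big_split /=; congr (_ * _).
  rewrite /nuS lnn_prod; last by move=> j _; exact: pr_gt0.
  by rewrite mulr_sumr expR_sum.
rewrite mulrA -expRD; case: ifP => [NA|_]; last by rewrite mulr_ge0 ?expR_ge0.
rewrite -[leLHS]mul1r ler_wpM2r// -[X in X <= _]expR0 ler_expR mulNr addrC subr_ge0.
by rewrite ler_wpM2l// lnn_le// ltnW// ltnNge.
Qed.

End SquarefreeResonator.

Section ResonatorGain.
Variable R : realType.
Implicit Types x y : R.

Lemma expR_le_inv x : x < 1 -> expR x <= (1 - x)^-1.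
Proof.
move=> x1; rewrite -[leLHS]invrK -expRN lef_pV2 ?posrE ?expR_gt0 ?subr_gt0//.
exact: expR_ge1Dx.
Qed.

(** Soundararajan's weight: up to the scale [lam] it maximizes the gain, the sum of
   the [r p / sqrt p], for a given length, the sum of the [r p ^ 2 * ln p]. *)
Definition res_weight (J : finType) (pr : J -> nat) (lam : R) (j : J) : R :=
  lam * invsqrt R (pr j) / ln (pr j)%:R.

(** Without the condition [nuS A <= N] the ratio of the two sums is the product of
   [(1 + r(p) ^ 2 + x) / (1 + r(p) ^ 2)], with [x = lam / (p ln p)], about
   [expR (lam * sg)] because the [r(p) ^ 2] and [x] are small.  Rankin's trick with
   exponent [al = de / Y] shows that the condition loses at most half: the
   logarithm of the tail, relative to the full product, is at most
   [al * (lam ^ 2 * sg - ln N)] up to factors [1 + O(de)], and [lam ^ 2 * sg] stays below [(1 - de) * ln N]. *)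
Lemma resonator_gain (J : finType) (pr : J -> nat) (N : nat) (lam de Y : R) :
  (forall j, prime (pr j)) -> injective pr -> (0 < N)%N ->
  let sg := \sum_j ((pr j)%:R * ln (pr j)%:R)^-1 in
  0 < de -> de <= 4^-1 -> 0 < Y -> Y <= de * lam ->
  (forall j, ln (pr j)%:R <= Y) ->
  (forall j, lam ^+ 2 <= de * (pr j)%:R * ln (pr j)%:R ^+ 2) ->
  (forall j, lam <= de * (pr j)%:R * ln (pr j)%:R) ->
  (1 + 2 * de) * (1 + de) * lam ^+ 2 * sg <= (1 - de) * ln N%:R ->
  Y <= de ^+ 2 * ln N%:R ->
  2^-1 * expR ((1 - de) ^+ 2 * lam * sg) * resW (fun A => nuS pr A <= N)%N (rS (res_weight pr lam))
    <= resV (fun A => nuS pr A <= N)%N (nuS pr) (rS (res_weight pr lam)).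
Proof.
move=> prp pinj N0 sg de0 de4 Y0 Yl pY la2 la1 lenN YN.
set rr := res_weight pr lam.
have lam0 : 0 < lam by rewrite -(pmulr_rgt0 _ de0) (lt_le_trans Y0).
have p0 j : 0 < (pr j)%:R :> R by rewrite ltr0n prime_gt0.
have lp0 j : 0 < ln (pr j)%:R :> R by rewrite ln_gt0// ltr1n prime_gt1.
have rr0 j : 0 <= rr j by rewrite /rr /res_weight divr_ge0 ?mulr_ge0 ?invsqrt_ge0// ltW.
have invsqrt2 j : invsqrt R (pr j) ^+ 2 = (pr j)%:R^-1 by rewrite exprVn sqr_sqrtr// ltW.
pose x j := lam / ((pr j)%:R * ln (pr j)%:R).
have x0 j : 0 < x j by rewrite divr_gt0 ?mulr_gt0.
have xde j : x j <= de by rewrite ler_pdivrMr ?mulr_gt0// mulrA.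
have gE j : gS pr rr j = rr j ^+ 2 + x j.
  rewrite /gS /rr /res_weight /x; congr (_ + _).
  have -> : lam * invsqrt R (pr j) / ln (pr j)%:R * invsqrt R (pr j) =
    lam * invsqrt R (pr j) ^+ 2 / ln (pr j)%:R by ring.
  by rewrite invsqrt2 invfM; ring.
have rr2 j : rr j ^+ 2 = lam ^+ 2 / ((pr j)%:R * ln (pr j)%:R ^+ 2).
  by rewrite /rr /res_weight !exprMn invsqrt2 exprVn; field; rewrite !gt_eqF.
have rr2de j : rr j ^+ 2 <= de.
  by rewrite rr2 ler_pdivrMr ?mulr_gt0 ?exprn_gt0// mulrA.
have g0 j : 0 <= gS pr rr j by rewrite gE addr_ge0 ?sqr_ge0// ltW.
apply: le_trans (resV_lower N prp rr0).
pose al := de / Y.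
have al0 : 0 <= al by rewrite divr_ge0 ?ltW.
apply: le_trans (rankin prp rr0 N0 al0).
have PW := resW_upper pr rr N.
set G := \prod_j (1 + gS pr rr j).
have G0 : 0 <= G by apply: prodr_ge0 => j _; rewrite addr_ge0.
have tail : expR (- al * ln N%:R) * \prod_j (1 + expR (al * ln (pr j)%:R) * gS pr rr j) <= 2^-1 * G.
  have sumle : \sum_j (expR (al * ln (pr j)%:R) - 1) * gS pr rr j <= al * ((1 - de) * ln N%:R).
    apply: (@le_trans _ _ (\sum_j al * ((1 + 2 * de) * (1 + de) * lam ^+ 2 * ((pr j)%:R * ln (pr j)%:R)^-1))).
      apply: ler_sum => j _.
      have y0 : 0 <= al * ln (pr j)%:R by rewrite mulr_ge0// ltW.
      have yde : al * ln (pr j)%:R <= de.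
        by rewrite /al mulrAC ler_pdivrMr// ler_wpM2l// ltW.
      have e1 : expR (al * ln (pr j)%:R) - 1 <= (1 + 2 * de) * (al * ln (pr j)%:R).
        move: y0 yde; move: (al * _) => y y0 yde.
        rewrite lerBlDr; apply: le_trans (expR_le_inv _) _; first lra.
        have y1 : 0 < 1 - y by lra.
        rewrite -[leLHS]mul1r ler_pdivrMr//.
        rewrite -subr_ge0 [X in 0 <= X](_ : _ = y * (2 * de - (1 + 2 * de) * y)); last by ring.
        by rewrite mulr_ge0//; nra.
      apply: le_trans (ler_wpM2r (g0 j) e1) _.
      have lg : ln (pr j)%:R * gS pr rr j <= (1 + de) * lam ^+ 2 * ((pr j)%:R * ln (pr j)%:R)^-1.
        rewrite gE rr2 /x.
        have -> : ln (pr j)%:R * (lam ^+ 2 / ((pr j)%:R * ln (pr j)%:R ^+ 2) + lam / ((pr j)%:R * ln (pr j)%:R)) =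
          (lam ^+ 2 + lam * ln (pr j)%:R) * ((pr j)%:R * ln (pr j)%:R)^-1.
          by field; rewrite !gt_eqF.
        apply: ler_wpM2r; first by rewrite invr_ge0 mulr_ge0 ?ltW.
        rewrite mulrDl mul1r lerD2l expr2 mulrCA; apply: ler_wpM2l; first exact: ltW.
        exact: le_trans (pY j) Yl.
      rewrite [leLHS](_ : _ = al * (1 + 2 * de) * (ln (pr j)%:R * gS pr rr j)); last by ring.
      rewrite [leRHS](_ : _ = al * (1 + 2 * de) * ((1 + de) * lam ^+ 2 * ((pr j)%:R * ln (pr j)%:R)^-1)); last by ring.
      by apply: ler_wpM2l => //; rewrite mulr_ge0// addr_ge0// mulr_ge0// ltW.
    by rewrite -mulr_sumr -mulr_sumr ler_wpM2l.
  apply: (@le_trans _ _ (expR (- al * ln N%:R) * (G * expR (al * ((1 - de) * ln N%:R))))).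
    apply: ler_wpM2l; first exact: expR_ge0.
    apply: (@le_trans _ _ (G * expR (\sum_j (expR (al * ln (pr j)%:R) - 1) * gS pr rr j))); last first.
      by rewrite ler_wpM2l// ler_expR.
    rewrite expR_sum /G -big_split /=; apply: ler_prod => j _.
    rewrite addr_ge0 ?mulr_ge0 ?expR_ge0//=.
    have e0 : 0 <= expR (al * ln (pr j)%:R) - 1.
      by rewrite subr_ge0; apply: le_trans (expR_ge1Dx _); rewrite lerDl mulr_ge0// ltW.
    have := expR_ge1Dx ((expR (al * ln (pr j)%:R) - 1) * gS pr rr j).
    move: (gS pr rr j) (g0 j) e0 => g gg.
    move: (expR (al * _)) => e e0 H.
    apply: (@le_trans _ _ ((1 + g) * (1 + (e - 1) * g))).
      rewrite -subr_ge0 [X in 0 <= X](_ : _ = (e - 1) * g ^+ 2); last by ring.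
      by rewrite mulr_ge0// exprn_ge0.
    by rewrite ler_wpM2l// addr_ge0.
  rewrite mulrCA mulrC -expRD; apply: ler_wpM2r => //.
  have -> : - al * ln N%:R + al * ((1 - de) * ln N%:R) = - (de ^+ 2 * ln N%:R / Y).
    by rewrite /al; field; rewrite gt_eqF.
  rewrite expRN lef_pV2 ?posrE ?expR_gt0//.
  apply: le_trans (expR_ge1Dx _); rewrite -lerBlDl.
  have -> : 2 - 1 = 1 :> R by ring.
  by rewrite ler_pdivlMr// mul1r.
apply: (@le_trans _ _ (2^-1 * G)); last by have := tail; lra.
rewrite -mulrA ler_wpM2l//.
apply: (@le_trans _ _ (expR ((1 - de) ^+ 2 * lam * sg) * \prod_j (1 + rr j ^+ 2))).
  by rewrite ler_wpM2l ?expR_ge0.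
rewrite mulr_sumr expR_sum -big_split /= /G; apply: ler_prod => j _.
rewrite mulr_ge0 ?expR_ge0 ?addr_ge0 ?sqr_ge0//= gE.
have -> : (1 - de) ^+ 2 * lam / ((pr j)%:R * ln (pr j)%:R) = (1 - de) ^+ 2 * x j by rewrite /x mulrA.
have := xde j; have := x0 j; have := rr2de j; have := sqr_ge0 (rr j).
move: (x j) (rr j ^+ 2) => y a a0 ade y0 yde.
have t0 : (1 - de) ^+ 2 * (1 + a + y) <= 1.
  apply: (@le_trans _ _ ((1 - de) ^+ 2 * (1 + 2 * de))).
    by rewrite ler_wpM2l ?sqr_ge0//; lra.
  rewrite -subr_ge0 [X in 0 <= X](_ : _ = de ^+ 2 * (3 - 2 * de)); last by ring.
  by rewrite mulr_ge0 ?sqr_ge0//; lra.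
have t1 : (1 - de) ^+ 2 <= 1 by nra.
have y1 : (1 - de) ^+ 2 * y < 1 by nra.
apply: le_trans (ler_wpM2r _ (expR_le_inv y1)) _; first by lra.
rewrite ler_pdivrMl ?subr_gt0//.
by nra.
Qed.

End ResonatorGain.

(** * Resonance for the central values *)

Section MainInequality.
Variables (R : realType) (q : nat).
Hypothesis q_prime : prime q.
Local Notation dchar := (dirichlet_char R q).

Definition maxL (H : {group dchar}) : R :=
  \big[Num.max/0]_(chi in H) normc (Lfun q_prime chi 2^-1).

Lemma maxL_ge0 H : 0 <= maxL H.
Proof. by rewrite /maxL; exact: bigmax_ge_id. Qed.

Lemma Lfun_half_cvg (chi : dchar) : chi <> 1%g ->
  ccvg (psum chi) (Lfun q_prime chi 2^-1).
Proof.
move=> chi1.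
have E : (2^-1 : R[i]) = (2^-1)%:C by rewrite fmorphV rmorph_nat.
have H : 0 < complex.Re (2^-1 : R[i]) by rewrite E /= invr_gt0.
have := Lfun_series q_prime chi1 H; congr (ccvg _ _); apply/funext => N.
apply: eq_bigr => n _; congr (_ * _).
by rewrite nat_cpowNE E -rmorphN /= -rmorphM /= cexp_real invsqrtE.
Qed.

(** Two errors have to be bounded, the second one after division by [q - 1].
   Averaging the partial sums over a range [X] costs [q ^ 2 / X ^ (3/2)],
   which is bounded when [X] is about [q ^ (4/3)]; the principal character then
   contributes at most [N * sqrt X], which is bounded by [q] when [N] is about
   [q ^ (1/3)].  This cube root is the source of the constant [1 / sqrt 3]. *)
Lemma main_inequality (H : {group dchar}) N (I : finType) (nu : I -> nat) (r : I -> R) :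
  (2 <= N)%N -> (N ^ 3 <= q)%N -> (q < N.+1 ^ 3)%N ->
  (forall i, 0 < nu i)%N -> injective nu -> (forall i, 0 <= r i) ->
  resV (fun i => nu i <= N)%N nu r <=
  (maxL H + 16) * #|[set: dchar]%SET : H|%g%:R * resW (fun i => nu i <= N)%N r.
Proof.
move=> N2 N3 Nq nu0 nuI r0.
have q1 : (1 < q)%N := prime_gt1 q_prime.
have Nltq : (N < q)%N.
  by apply: leq_trans N3; rewrite -[X in (X < _)%N]expn1 ltn_exp2l.
pose X := (N.+1 ^ 4)%N.
have X0 : (0 < X)%N by rewrite expn_gt0.
have NX : (N <= X)%N by rewrite (leq_trans (leqnSn N))// -[leqLHS]expn1 leq_exp2l// ltnS ltnW.
have sX : Num.sqrt X%:R = N.+1%:R ^+ 2 :> R.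
  by rewrite /X natrX (exprM _ 2 2) sqrtr_sqr ger0_norm ?exprn_ge0.
have q1r : 0 < q.-1%:R :> R by rewrite ltr0n -subn1 subn_gt0.
have ME0 : 0 <= maxL H + 8 by rewrite addr_ge0 ?maxL_ge0.
have HE chi : chi \in H -> chi != 1%g ->
    normc (Lfun q_prime chi 2^-1 - (\sum_(x < X) psum chi (X + x)) / X%:R) <= 8.
  move=> _ /eqP chi1.
  apply: le_trans (smoothed_psum (prime_gt0 q_prime) (dirichlet_char_period chi)
    (normc_char_le1 q_prime chi) _ X0 (Lfun_half_cvg chi1)) _.
    by rewrite sum_charS sum_char.
  rewrite -[leRHS]mulr1 ler_wpM2l// mulrA ler_pdivrMr ?ltr0n// mul1r.
  rewrite /invsqrt sX ler_pdivrMr ?exprn_gt0//.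
  rewrite -!natrX -natrM ler_nat /X -expnD (expnM _ 3 2).
  by rewrite leq_exp2r// ltnW.
have HM chi : chi \in H -> chi != 1%g -> normc (Lfun q_prime chi 2^-1) <= maxL H.
  by move=> chiH _; rewrite /maxL; apply: (le_bigmax_cond _ (fun chi => normc (Lfun q_prime chi 2^-1))).
have := @resonance R q q_prime I (fun i => nu i <= N)%N nu r N Nltq
  (fun i _ => nu0 i) (fun i Pi => Pi) (fun i j _ _ => @nuI i j) r0 H X
  (fun chi => Lfun q_prime chi 2^-1) 8 (maxL H) X0 NX ME0 HE HM.
set V := resV _ _ _; set W := resW _ _ => res.
have W0 : 0 <= W by rewrite sumr_ge0// => i _; exact: sqr_ge0.
have err : 2 * Num.sqrt (X + X)%:R * N%:R <= 8 * q.-1%:R :> R.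
  have -> : (X + X)%:R = 2 * X%:R :> R by rewrite natrD; ring.
  rewrite sqrtrM// sX.
  have s2 : Num.sqrt 2 <= 3 / 2 :> R.
    have h : 0 <= 3 / 2 :> R by lra.
    rewrite -[leRHS](ger0_norm h) -sqrtr_sqr ler_sqrt ?exprn_ge0//; lra.
  have s0 : 0 <= Num.sqrt 2 :> R by exact: sqrtr_ge0.
  have n2 : 2 <= N%:R :> R by rewrite (ler_nat R 2).
  have nq : N%:R ^+ 3 - 1 <= q.-1%:R :> R.
    by rewrite -natrX -subn1 natrB ?prime_gt0// lerD2r ler_nat.
  apply: le_trans (_ : 8 * (N%:R ^+ 3 - 1) <= _); last by rewrite ler_wpM2l.
  rewrite -(natr1 N); move: (N%:R : R) n2 (Num.sqrt 2 : R) s0 s2 => n n2 s s0 s2.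
  apply: (@le_trans _ _ (3 * (n + 1) ^+ 2 * n)).
    rewrite ler_wpM2r//; first by lra.
    rewrite mulrA ler_wpM2r ?sqr_ge0//; lra.
  rewrite -subr_ge0 [leRHS](_ : _ = (n - 2) * (5 * n ^+ 2 + 4 * n + 5) + 2); last by ring.
  by rewrite addr_ge0// mulr_ge0; nra.
have cH : (#|H| * #|[set: dchar]%SET : H|%g = q.-1)%N.
  by rewrite (@Lagrange _ [set: dchar]%G H (finset.subsetT _)) cardsT card_dirichlet_char.
have H0 : 0 < #|H|%:R :> R by rewrite ltr0n cardG_gt0.
rewrite -(ler_pM2l H0); apply: le_trans res _.
apply: (@le_trans _ _ ((maxL H + 16) * q.-1%:R * W)).
  by apply: ler_wpM2r => //; lra.
by rewrite -cH natrM le_eqVlt; apply/orP; left; apply/eqP; ring.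
Qed.

End MainInequality.

(** * The choice of the resonator *)

Section ResonatorChoice.
Variable R : realType.
Implicit Types (x w l : R).

Lemma expR_ge_pow x n : 0 <= x -> x ^+ n.+1 / n.+1`!%:R <= expR x.
Proof. by move=> x0; apply: le_trans (expR_ge1Dxn n x0); rewrite lerDr. Qed.

Lemma ln2_le1 : ln 2 <= 1 :> R.
Proof. by rewrite -ler_expR lnK ?posrE//; have := expR_ge1Dx (1 : R); lra. Qed.

(** As [1 / ln p <= ln p] on the range, the sum is bounded by a Mertens sum.  This
   crude bound serves only to show that [lam] is not too small. *)
Lemma sigma_upper z D K : (0 < z)%N -> 1 <= D%:R * ln (z%:R : R) ->
  sigma R z D K <= K%:R * ln z%:R + 2.
Proof.
move=> z0 D1.
apply: (@le_trans _ _ (mertens R (z ^ K))); last first.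
  have := mertens_le R (_ : (0 < z ^ K)%N); rewrite expn_gt0 z0 => /(_ isT).
  by rewrite lnnX// => H; have := ln4_le2 R; lra.
have pos p : prime p -> 0 <= ln p%:R / p%:R :> R.
  by move=> pp; rewrite divr_ge0 ?lnn_ge0.
have [DK|KD] := leqP (z ^ D).+1 (z ^ K).+1; last first.
  by rewrite /sigma big_geq ?(ltnW KD)//; apply: sumr_ge0 => p; exact: pos.
rewrite /mertens (@big_cat_nat _ _ _ (z ^ D).+1 0%N)//= -[leLHS]add0r; apply: lerD.
  by apply: sumr_ge0 => p; exact: pos.
rewrite /sigma [leLHS]big_nat_cond [leRHS]big_nat_cond; apply: ler_sum => p.
move=> /andP[/andP[zp _] pp].
have lp1 : 1 <= ln p%:R :> R.
  apply: le_trans D1 _; rewrite -lnnX//; apply: lnn_le; last exact: ltnW.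
  by rewrite expn_gt0 z0.
have p0 : 0 < p%:R :> R by rewrite ltr0n prime_gt0.
rewrite invfM mulrC; apply: ler_wpM2r; first by rewrite invr_ge0 ltW.
by apply: (le_trans _ lp1); rewrite invf_le1//; exact: lt_le_trans lp1.
Qed.

Lemma sigma_sig z D K (A := [pred p : 'I_(z ^ K).+1 | prime p && (z ^ D < p)%N]) :
  \sum_(j : {p : 'I_(z ^ K).+1 | p \in A})
     ((nat_of_ord (\val j))%:R * ln (nat_of_ord (\val j))%:R)^-1 = sigma R z D K.
Proof.
rewrite -(big_sub A (fun p => ((nat_of_ord p)%:R * ln (nat_of_ord p)%:R)^-1)).
rewrite /sigma (big_nat_widenl _ 0%N)// big_mkord.
by apply: eq_bigl => p; rewrite inE.
Qed.

Lemma scale_w16 (d w : R) : 8 <= d -> 4000 * d ^+ 4 <= w -> 16 * d ^+ 2 <= w.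
Proof.
move=> d8; apply: le_trans; rewrite (_ : d ^+ 4 = d ^+ 2 * d ^+ 2); last by rewrite -exprD.
have d2 : 64 <= d ^+ 2 by nra.
by move: (d ^+ 2) d2; clear; move=> b b1; nra.
Qed.

Lemma scale_w1 (d w : R) : 8 <= d -> 4000 * d ^+ 4 <= w -> 1 <= w.
Proof. by move=> d8 w4; have := scale_w16 d8 w4; clear w4; nra. Qed.

Lemma scale_exp (d w : R) : 8 <= d -> 1 <= w ->
  [/\ 12 <= expR (d * w), 3 * d <= expR (d * w),
      d ^+ 2 * w ^+ 2 / 2 <= expR (d * w) & d ^+ 4 * w ^+ 4 / 24 <= expR (d * w)].
Proof.
move=> d8 w1; have dw0 : 0 <= d * w by nra.
have e2 := @expR_ge_pow (d * w) 1 dw0; have e4 := @expR_ge_pow (d * w) 3 dw0.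
rewrite !exprMn in e2 e4; have d2 : 8 * d <= d ^+ 2 by nra.
have w2 : 1 <= w ^+ 2 by nra.
have ab : d ^+ 2 <= d ^+ 2 * w ^+ 2 by rewrite ler_peMr// sqr_ge0.
split=> //; apply: le_trans e2; rewrite (_ : 2`!%:R = 2 :> R)//; clear -d8 d2 ab; lra.
Qed.

(** The real inequalities between the parameters of the resonator.  For a prime
   [q], they are used with [l = ln q], [n = ln N] and [w = ln l / d]; the primes
   allowed lie between [expR (d * L)] and [expR (d ^+ 2 * L)], and [sg] is the sum of
   [1 / (p ln p)] over them.  All losses are of the form [1 + O(1 / d)], and the
   constant 4000 leaves room for the powers of [d] that come with them. *)
Record scales (d w l n L sg : R) : Prop := Scales {
  sc_d8 : 8 <= d;
  sc_w4 : 4000 * d ^+ 4 <= w;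
  sc_lE : l = expR (d * w);
  sc_nl : n <= l;
  sc_ln : l / 3 - 1 <= n;
  sc_wL : w <= L;
  sc_Lw : L <= 2 * w;
  sc_sg_low : (1 - 4 / d) ^+ 5 <= sg * (d * w);
  sc_sg_up : sg <= d ^+ 2 * L + 2 }.

Section Scales.
Variables (d w l n L sg : R).
Hypothesis S : scales d w l n L sg.
Local Notation u := (1 - 4 / d).
Local Notation Y := (d ^+ 2 * L).
Local Notation lam2 := (u * n / sg).

Lemma sc_d0 : 0 < d. Proof. exact: lt_le_trans (sc_d8 S). Qed.

Lemma sc_id : 0 < d^-1 <= 8^-1.
Proof. by rewrite invr_gt0 sc_d0 lef_pV2 ?posrE ?sc_d0// (sc_d8 S). Qed.

Lemma sc_d2 : 64 <= d ^+ 2. Proof. by have := sc_d8 S; nra. Qed.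

Lemma sc_w16 : 16 * d ^+ 2 <= w. Proof. exact: scale_w16 (sc_d8 S) (sc_w4 S). Qed.

Lemma sc_w1 : 1 <= w. Proof. exact: scale_w1 (sc_d8 S) (sc_w4 S). Qed.

Lemma sc_dw0 : 0 < d * w.
Proof. by rewrite mulr_gt0 ?sc_d0// (lt_le_trans _ sc_w1). Qed.

Lemma sc_exp : [/\ 12 <= l, 3 * d <= l, d ^+ 2 * w ^+ 2 / 2 <= l &
  d ^+ 4 * w ^+ 4 / 24 <= l].
Proof. by rewrite (sc_lE S); apply: scale_exp (sc_d8 S) sc_w1. Qed.

Lemma sc_n4 : l / 4 <= n.
Proof. by have [l12 _ _ _] := sc_exp; have := sc_ln S; lra. Qed.

Lemma sc_n0 : 0 < n.
Proof. by have [l12 _ _ _] := sc_exp; have := sc_n4; lra. Qed.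

Lemma sc_u : 2^-1 <= u <= 1 - d^-1.
Proof. by have /andP[e0 e8] := sc_id; apply/andP; split; lra. Qed.

Lemma sc_nu : u * (l / 3) <= n.
Proof.
apply: le_trans (sc_ln S); have /andP[_ u1] := sc_u; have [l12 ld _ _] := sc_exp.
have dl : 1 <= d^-1 * (l / 3) by rewrite ler_pdivlMl ?sc_d0//; lra.
have l3 : 0 <= l / 3 by lra.
by have := ler_wpM2r l3 u1; lra.
Qed.

Lemma sc_sg32 : 1 <= sg * (32 * (d * w)).
Proof.
have /andP[u2 _] := sc_u.
have u5 : (2^-1) ^+ 5 <= u ^+ 5 by apply: lerXn2r => //; rewrite nnegrE// (le_trans _ u2).
by have := le_trans u5 (sc_sg_low S); lra.
Qed.

Lemma sc_sg0 : 0 < sg.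
Proof.
have dw0 : 0 <= 32 * (d * w) by have := sc_dw0; lra.
rewrite ltNge; apply/negP => sg0.
have := sc_sg32; have : sg * (32 * (d * w)) <= 0 by rewrite mulr_le0_ge0.
by lra.
Qed.

Lemma sc_lam2 : 0 <= lam2.
Proof.
have /andP[u2 _] := sc_u.
by rewrite divr_ge0 ?mulr_ge0 ?(ltW sc_n0) ?(ltW sc_sg0)// (le_trans _ u2).
Qed.

Lemma sc_sg3 : sg <= 3 * d ^+ 2 * w.
Proof.
apply: le_trans (sc_sg_up S) _; have := sc_d2; have := sc_w1; have := sc_Lw S.
by nra.
Qed.

Lemma sc_Y0 : 1 <= Y.
Proof. by have := sc_d2; have := sc_w1; have := sc_wL S; nra. Qed.

Lemma sc_Yw : Y <= 2 * d ^+ 2 * w.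
Proof. by have := sc_d2; have := sc_Lw S; nra. Qed.

Lemma sc_Y_lam : Y <= d^-1 * Num.sqrt lam2.
Proof.
have d0 := sc_d0; have [l12 _ _ l4] := sc_exp.
have Y0 : 0 <= Y by exact: le_trans sc_Y0.
have w0 : 0 <= w by exact: le_trans sc_w1.
have dY0 : 0 <= Y * d by rewrite mulr_ge0// ltW.
rewrite [leRHS]mulrC ler_pdivlMr// -(ger0_norm dY0) -sqrtr_sqr ler_sqrt ?sc_lam2//.
rewrite ler_pdivlMr ?sc_sg0//.
have h1 : l / 8 <= u * n.
  have /andP[u2 _] := sc_u; have := sc_n4.
  by move: u u2 => v; nra.
apply: le_trans h1.
apply: (@le_trans _ _ ((2 * d ^+ 2 * w * d) ^+ 2 * (3 * d ^+ 2 * w))).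
  apply: ler_pM; rewrite ?sqr_ge0 ?(ltW sc_sg0) ?sc_sg3//.
  rewrite lerXn2r ?nnegrE//; first by rewrite !mulr_ge0 ?exprn_ge0// ltW.
  by rewrite ler_pM2r// sc_Yw.
rewrite ler_pdivlMr//; apply: le_trans l4.
rewrite [leLHS](_ : _ = 96 * d ^+ 8 * w ^+ 3); last by ring.
rewrite [leRHS](_ : _ = (d ^+ 4 * w / 24) * w ^+ 3); last by field.
apply: ler_wpM2r; first by rewrite exprn_ge0.
rewrite (_ : d ^+ 8 = d ^+ 4 * d ^+ 4); last by rewrite -exprD.
have d4 : 0 <= d ^+ 4 by rewrite exprn_ge0// ltW.
have w4 := sc_w4 S.
by rewrite ler_pdivlMr// [leRHS]mulrC; nra.
Qed.

Lemma sc_lam1 : 1 <= Num.sqrt lam2.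
Proof.
have /andP[e0 e8] := sc_id.
by apply: le_trans (le_trans sc_Y0 sc_Y_lam) _; rewrite ler_piMl ?sqrtr_ge0//; lra.
Qed.

Lemma sc_lam2_le : lam2 <= d^-1 * (l * expR (2 * w)).
Proof.
have d0 := sc_d0; have [l12 _ _ _] := sc_exp.
have l0 : 0 <= l by lra.
rewrite ler_pdivlMl// mulrA ler_pdivrMr ?sc_sg0//.
apply: (@le_trans _ _ (d * l)).
  rewrite ler_pM2l//; apply: le_trans (sc_nl S).
  have /andP[_ u1] := sc_u; rewrite ler_piMl ?(ltW sc_n0)//.
  by apply: le_trans u1 _; rewrite gerBl invr_ge0 ltW.
rewrite [leLHS]mulrC -mulrA ler_wpM2l//.
have ew : 32 * d ^+ 2 * w <= expR (2 * w).
  have w0 : 0 <= 2 * w by have := sc_w1; lra.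
  apply: le_trans (@expR_ge_pow (2 * w) 1 w0); rewrite exprMn (_ : 2`!%:R = 2 :> R)//.
  have w1 : 0 <= w by exact: le_trans sc_w1.
  by have := ler_wpM2r w1 sc_w16; lra.
apply: (@le_trans _ _ (d * (sg * (32 * (d * w))))).
  by rewrite ler_peMr ?sc_sg32// ltW.
rewrite [leLHS](_ : _ = 32 * d ^+ 2 * w * sg); last by ring.
by rewrite ler_wpM2r// ltW// sc_sg0.
Qed.

Lemma sc_Yn : Y <= d^-1 ^+ 2 * n.
Proof.
have [_ _ l2 _] := sc_exp.
rewrite exprVn ler_pdivlMl ?exprn_gt0 ?sc_d0//; apply: le_trans sc_n4.
rewrite ler_pdivlMr//; apply: le_trans l2.
have := sc_Yw; have := sc_w16; have := sc_w1; have := sc_d2.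
move: (d ^+ 2) Y => b y b1 w1 bw yb.
have bw0 : 0 <= b * w by nra.
have b0 : 0 <= b by lra.
by have := ler_wpM2l bw0 bw; have := ler_wpM2l b0 yb; lra.
Qed.

Lemma sc_len :
  (1 + 2 * d^-1) * (1 + d^-1) * (Num.sqrt lam2) ^+ 2 * sg <= (1 - d^-1) * n.
Proof.
rewrite sqr_sqrtr ?sc_lam2// -[leLHS]mulrA divfK ?gt_eqF ?sc_sg0//.
rewrite mulrA ler_wpM2r// ?(ltW sc_n0)//.
by have := sc_id; move: d^-1 => e /andP[e0 e8]; nra.
Qed.

(** Compare squares: [(lam * sg) ^ 2] is [u * n * sg], where [n] is at least
   [u * l / 3] and [sg] at least [u ^ 5 / ln l]. *)
Lemma sc_gain : u ^+ 6 * ((Num.sqrt 3)^-1 * Num.sqrt (l / (d * w))) <=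
  (1 - d^-1) ^+ 2 * Num.sqrt lam2 * sg.
Proof.
have /andP[u2 u1] := sc_u; have u0 : 0 <= u by exact: le_trans u2.
have dw0 := sc_dw0; have /andP[e0 e8] := sc_id.
have l0 : 0 <= l by have [l12 _ _ _] := sc_exp; lra.
have n0 := ltW sc_n0; have sg0 := sc_sg0.
have lhs0 : 0 <= (Num.sqrt 3)^-1 * Num.sqrt (l / (d * w)).
  by rewrite mulr_ge0 ?invr_ge0 ?sqrtr_ge0.
have rhs0 : 0 <= Num.sqrt lam2 * sg by rewrite mulr_ge0 ?sqrtr_ge0 ?ltW.
have u_le1 : u <= 1 by apply: le_trans u1 _; lra.
rewrite [u ^+ 6](exprD u 2 4) -[leLHS]mulrA -[leRHS]mulrA.
apply: ler_pM; rewrite ?exprn_ge0 ?mulr_ge0//.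
  by apply: lerXn2r; rewrite ?nnegrE//; exact: le_trans u1.
rewrite -(@ler_pXn2r _ 2%N)// ?nnegrE ?mulr_ge0 ?exprn_ge0//.
rewrite [leLHS]exprMn -[(u ^+ 4) ^+ 2]exprM [(_^-1 * _) ^+ 2]exprMn exprVn.
rewrite [leRHS]exprMn !sqr_sqrtr ?sc_lam2 ?divr_ge0 ?(ltW dw0)//.
rewrite (_ : lam2 * sg ^+ 2 = u * n * sg); last first.
  by rewrite expr2 mulrA divfK// gt_eqF.
apply: (@le_trans _ _ (u ^+ 7 * (3^-1 * (l / (d * w))))).
  apply: ler_wpM2r; first by rewrite mulr_ge0 ?invr_ge0 ?divr_ge0 ?(ltW dw0).
  by rewrite ler_wiXn2l.
rewrite !mulrA ler_pdivrMr// -!mulrA.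
apply: (@le_trans _ _ (u * (u * (l / 3)) * (sg * (d * w)))).
  rewrite [leLHS](_ : _ = u * (u * (l / 3)) * u ^+ 5); last by move: u => v; ring.
  by rewrite ler_wpM2l ?(sc_sg_low S)// !mulr_ge0// divr_ge0.
rewrite [leRHS]mulrA; apply: ler_wpM2r; first by rewrite mulr_ge0 ?ltW.
by rewrite ler_wpM2l// sc_nu.
Qed.

End Scales.

(** The primes of the resonator run over [y < p <= y ^ D] with [y = z ^ D].  They
   have to exceed [ln q] by a little for the weights to be small, whence
   [ln y] about [(1 + 2 / d) * ln (ln q)]; and the upper end may be a fixed power of
   [y], as the sum of [1 / (p ln p)] over [p > y ^ D] is only [1 / D] of the whole.
   The whole sum is then about [1 / ln (ln q)], and [lam] is chosen to use the
   available length [ln N], so that [lam * sg], the exponent of the gain, is about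
   [sqrt (ln N / ln (ln q))]. *)
Lemma resonator_exists (D q N : nat) :
  let d : R := D%:R in let l : R := ln q%:R in
  (8 <= D)%N -> 4000 * d ^+ 5 <= ln l ->
  (N ^ 3 <= q)%N -> (q < N.+1 ^ 3)%N ->
  (2 <= N)%N /\ exists (J : finType) (pr : J -> nat) (lam : R),
    [/\ forall j, prime (pr j), injective pr, 0 <= lam &
     2^-1 * expR ((1 - 4 / d) ^+ 6 * ((Num.sqrt 3)^-1 * calL R q)) *
       resW (fun A => nuS pr A <= N)%N (rS (res_weight pr lam))
     <= resV (fun A => nuS pr A <= N)%N (nuS pr) (rS (res_weight pr lam))].
Proof.
move=> d l D8 xD N3 Nq.
have d8 : 8 <= d by rewrite (ler_nat R 8).
have d0 : 0 < d by exact: lt_le_trans d8.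
have id0 : 0 < d^-1 by rewrite invr_gt0.
have id8 : d^-1 <= 8^-1 by rewrite lef_pV2 ?posrE.
have [w xw] : exists w, ln l = d * w.
  by exists (ln l / d); rewrite mulrC divfK// gt_eqF.
have w4 : 4000 * d ^+ 4 <= w.
  rewrite -(ler_pM2l d0) -xw; apply: le_trans xD.
  by rewrite (exprSr d 4) [leLHS]mulrC mulrA.
have w1 : 1 <= w by exact: scale_w1 w4.
have w0 : 0 < w by exact: lt_le_trans w1.
have l0 : 0 < l.
  rewrite ltNge; apply/negP => l0; move: xw; rewrite ln0// => /esym/eqP.
  by rewrite mulf_eq0 !gt_eqF.
have lE : l = expR (d * w) by rewrite -xw lnK.
have [l12 _ _ _] : [/\ 12 <= l, 3 * d <= l, d ^+ 2 * w ^+ 2 / 2 <= l & d ^+ 4 * w ^+ 4 / 24 <= l].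
  by rewrite lE; exact: scale_exp.
have q0 : (0 < q)%N.
  by rewrite lt0n; apply/eqP => q0; move: l0; rewrite /l q0 ln0 ?ltxx.
have lN1 : l <= 3 * ln N.+1%:R.
  by rewrite -(lnnX R 3)//; apply: lnn_le => //; exact: ltnW.
have N2 : (2 <= N)%N.
  rewrite ltnNge; apply/negP => N1.
  have : ln N.+1%:R <= ln 2%:R :> R by apply: lnn_le.
  by have := ln2_le1; clear -lN1 l12; lra.
split => //.
have N0 : (0 < N)%N by rewrite ltnW.
have lnN : l / 3 - 1 <= ln N%:R.
  have : ln N.+1%:R <= ln (2 * N)%:R :> R.
    by apply: lnn_le => //; rewrite mul2n -addnn -addn1 leq_add2l.
  by rewrite lnnM//; have := ln2_le1; clear -lN1; lra.
have lnNl : ln N%:R <= l.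
  apply: lnn_le => //; apply: leq_trans N3.
  by rewrite -[leqLHS]expn1 leq_exp2l.
pose a := (1 + 2 / d) * w.
have a0 : 0 <= a by rewrite mulr_ge0 ?ltW// addr_gt0// mulr_gt0.
pose z := (Num.trunc (expR a)).+1.
have /andP[tz1 tz2] := truncn_itv (expR_ge0 a).
have z0 : (0 < z)%N by [].
pose L := ln (z%:R : R).
have aL : a <= L by rewrite -ler_expR lnK ?posrE ?ltr0n// ltW.
have e1 : 1 <= expR a by apply: le_trans (expR_ge1Dx a); rewrite lerDl.
have La : L <= a + 1.
  rewrite -ler_expR lnK ?posrE ?ltr0n// expRD.
  have z2 : z%:R <= 2 * expR a by rewrite /z -natr1; clear -tz1 e1; lra.
  apply: le_trans z2 _; rewrite mulrC ler_wpM2l ?expR_ge0//.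
  by have := expR_ge1Dx (1 : R); clear; lra.
have wL : w <= L.
  by apply: le_trans aL; rewrite /a ler_peMl ?ltW// ltrDl mulr_gt0.
have w16 : 16 * d ^+ 2 <= w by exact: scale_w16 d8 w4.
have Lw : L <= (1 + 3 / d) * w.
  apply: le_trans La _; rewrite /a -subr_ge0.
  rewrite [leRHS](_ : _ = (w - d) / d); last by field; rewrite gt_eqF.
  rewrite divr_ge0 ?(ltW d0)// subr_ge0; apply: le_trans w16.
  by clear -d8; nra.
have L2w : L <= 2 * w.
  by apply: le_trans Lw _; rewrite ler_pM2r//; clear -id8; lra.
have L0 : 0 < L by exact: lt_le_trans wL.
have z1 : (1 < z)%N.
  rewrite ltnNge; apply/negP => z1; move: L0; rewrite /L (_ : z = 1%N) ?ln1 ?ltxx//.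
  by apply/eqP; rewrite eqn_leq z1.
have L5 : 5 * d <= L.
  by apply: le_trans wL; apply: le_trans w16; clear -d8; nra.
pose K := (D * D)%N.
have KE : K%:R = d ^+ 2 :> R by rewrite /K natrM expr2.
pose Y := d ^+ 2 * L.
pose sg := sigma R z D K.
pose u : R := 1 - 4 / d.
have u0 : 0 <= u by rewrite /u; clear -id8; lra.
have sg_low : u ^+ 5 <= sg * (d * w).
  have dw0 : 0 < d * w by rewrite mulr_gt0.
  rewrite -ler_pdivrMr//; apply: le_trans (sigma_lower _ z1 _); last 2 first.
  - by rewrite /K leq_pmulr// (leq_trans _ D8).
  - by rewrite -/L; apply: le_trans L5; clear -d8; lra.
  rewrite -/L -[D.+1%:R]natr1 -[K.+1%:R]natr1 KE -/d.
  have -> : u ^+ 5 / (d * w) = u * (u / w) * (u * u * u / d) by field; rewrite !gt_eqF.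
  have v5 : 5 / L <= d^-1 by rewrite ler_pdivrMr// ler_pdivlMl// mulrC.
  have uL : u / w <= L^-1.
    rewrite ler_pdivrMr// ler_pdivlMl//; apply: le_trans (_ : (1 + 3 / d) * w * u <= _).
      by rewrite ler_wpM2r.
    by rewrite mulrAC ler_piMl ?(ltW w0)// /u; clear -id0 id8; move: d^-1 id0 id8 => e; nra.
  apply: ler_pM.
  - by rewrite mulr_ge0// divr_ge0// ltW.
  - by rewrite divr_ge0 ?mulr_ge0// ltW.
  - by apply: ler_pM => //; rewrite ?divr_ge0// ?(ltW w0)// /u; clear -v5 id0; lra.
  have -> : (d + 1)^-1 - (d ^+ 2 + 1)^-1 =
      (1 - d^-1) / ((1 + d^-1) * (1 + d^-1 ^+ 2)) / d.
    by field; rewrite !gt_eqF ?addr_gt0 ?exprn_gt0.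
  rewrite ler_pM2r ?invr_gt0// ler_pdivlMr ?mulr_gt0 ?addr_gt0 ?exprn_gt0// /u.
  by clear -id0 id8; move: d^-1 id0 id8 => e; nra.
have sg_up : sg <= Y + 2.
  have := @sigma_upper z D K z0; rewrite KE -/L -/d -/Y; apply.
  by clear -L5 d8; nra.
have S : scales d w l (ln N%:R) L sg by split.
pose lam := Num.sqrt ((1 - 4 / d) * ln N%:R / sg).
pose A := [pred p : 'I_(z ^ K).+1 | prime p && (z ^ D < p)%N].
pose J : finType := {p : 'I_(z ^ K).+1 | p \in A}.
pose pr (j : J) : nat := nat_of_ord (\val j).
have prA j : prime (pr j) && (z ^ D < pr j)%N by have := valP j; rewrite inE.
have prp j : prime (pr j) by case/andP: (prA j).
have pinj : injective pr by move=> i j /val_inj/val_inj.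
have sgE : \sum_j ((pr j)%:R * ln (pr j)%:R)^-1 = sg by exact: sigma_sig.
have lpY j : ln (pr j)%:R <= Y.
  rewrite /Y -KE /L -lnnX//; apply: lnn_le; first exact: prime_gt0.
  by rewrite -ltnS ltn_ord.
have lpD j : d * L <= ln (pr j)%:R.
  have /andP[_ zp] := prA j.
  by rewrite /d /L -lnnX//; apply: lnn_le; [rewrite expn_gt0 | exact: ltnW].
have lp1 j : 1 <= ln (pr j)%:R :> R.
  by apply: le_trans (lpD j); clear -L5 d8; nra.
have py j : l * expR (2 * w) <= (pr j)%:R.
  rewrite -[leRHS]lnK ?posrE ?ltr0n ?prime_gt0// lE -expRD ler_expR.
  apply: le_trans (lpD j).
  have -> : d * w + 2 * w = d * a by rewrite /a; field; rewrite gt_eqF.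
  by rewrite ler_wpM2l// ltW.
have p0 j : 0 < (pr j)%:R :> R by rewrite ltr0n prime_gt0.
have lam2p j : lam ^+ 2 <= d^-1 * (pr j)%:R.
  rewrite /lam sqr_sqrtr; last exact: sc_lam2 S.
  apply: le_trans (sc_lam2_le S) _.
  by rewrite ler_pM2l.
have lam1 : 1 <= lam by exact: sc_lam1 S.
have lp0 j : 0 <= d^-1 * (pr j)%:R by rewrite mulr_ge0 ?ltW.
exists J, pr, lam; split => //; first exact: le_trans lam1.
apply: le_trans (@resonator_gain R J pr N lam d^-1 Y prp pinj N0 id0 _ _ _ lpY _ _ _ _).
- apply: ler_wpM2r; first by apply: sumr_ge0 => i _; exact: sqr_ge0.
  rewrite ler_pM2l// ler_expR sgE /calL -/l xw.
  exact: sc_gain S.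
- by apply: le_trans id8 _; clear; lra.
- by apply: lt_le_trans (sc_Y0 S).
- exact: sc_Y_lam S.
- move=> j; apply: le_trans (lam2p j) _; rewrite ler_peMr//.
  by rewrite exprn_ege1.
- move=> j; apply: le_trans (le_trans (lam2p j) _); last by rewrite ler_peMr.
  by rewrite expr2 ler_peMl// (le_trans _ lam1).
- by rewrite sgE; exact: sc_len S.
- exact: sc_Yn S.
Qed.

End ResonatorChoice.

(** * Uniformity in the modulus *)

Section Conclusion.
Variable R : realType.

Lemma cube_root q : exists N, (N ^ 3 <= q < N.+1 ^ 3)%N.
Proof.
elim: q => [|q [N /andP[N1 N2]]]; first by exists 0%N.
have [lt|ge] := ltnP q.+1 (N.+1 ^ 3).
  by exists N; rewrite lt (leq_trans N1).
by exists N.+1; rewrite ge/= (leq_ltn_trans N2)// ltn_exp2r.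
Qed.

Lemma calL_ge (q : nat) (b : R) : 0 <= b -> 2 * b ^+ 2 <= ln (ln q%:R) -> b <= calL R q.
Proof.
move=> b0; have [->|bn0] := eqVneq b 0; first by rewrite /calL sqrtr_ge0.
set x := ln (ln _) => bx.
have b2 : 0 < b ^+ 2 by rewrite exprn_gt0// lt_def bn0.
have x0 : 0 < x by apply: lt_le_trans bx; rewrite mulr_gt0.
have l0 : 0 < ln q%:R :> R.
  by rewrite ltNge; apply/negP => l0; move: x0; rewrite /x ln0 ?ltxx.
rewrite -(ger0_norm b0) -sqrtr_sqr /calL ler_sqrt ?(divr_ge0 (ltW l0) (ltW x0))// -/x.
rewrite ler_pdivlMr// -[leRHS]lnK ?posrE// -/x.
apply: le_trans (@expR_ge_pow R x 1 (ltW x0)); rewrite (_ : 2`!%:R = 2 :> R)//.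
by have := ler_wpM2r (ltW x0) bx; lra.
Qed.

Lemma sqrt3_bounds : 2^-1 <= (Num.sqrt 3 : R)^-1 <= 1.
Proof.
have s0 : 0 < Num.sqrt 3 :> R by rewrite sqrtr_gt0.
have s2 : Num.sqrt 3 <= 2 :> R.
  rewrite -[leRHS]ger0_norm// -sqrtr_sqr ler_sqrt// expr2; lra.
have s1 : 1 <= Num.sqrt 3 :> R.
  by rewrite -[leLHS]sqrtr1 ler_sqrt//; lra.
by rewrite lef_pV2 ?posrE// s2 invf_le1// s1.
Qed.

Lemma bernoulli6 (x : R) : 0 <= x <= 1 -> 1 - 6 * x <= (1 - x) ^+ 6.
Proof.
move=> /andP[x0 x1]; have y2 : 1 - 2 * x <= (1 - x) ^+ 2 by nra.
rewrite (exprM _ 2 3); move: ((1 - x) ^+ 2) (sqr_ge0 (1 - x)) y2 => y y0 y2.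
apply: (@le_trans _ _ (1 - 3 * (1 - y))); first by lra.
rewrite -subr_ge0 [leRHS](_ : _ = (1 - y) ^+ 2 * (y + 2)); last by ring.
by rewrite mulr_ge0 ?sqr_ge0// addr_ge0.
Qed.

Lemma resW_gt0 (J : finType) (pr : J -> nat) (rr : J -> R) N :
  (0 < N)%N -> 0 < resW (fun A : {set J} => nuS pr A <= N)%N (rS rr).
Proof.
move=> N0; rewrite /resW (bigD1 finset.set0)/=; last by rewrite /nuS big_set0.
rewrite {1}/rS big_set0 expr1n ltr_wpDr//.
by apply: sumr_ge0 => A _; exact: sqr_ge0.
Qed.

(** The loss [1 / (k + 2)] in the exponent is shared by the parameter [d] of the
   resonator, the index of [H], and the constants [1 / 2] and [16]; the last two are
   absorbed because [calL R q] is at least [d], hence large against [k + 2]. *)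
Lemma maxL_large q (q_prime : prime q) (H : {group dirichlet_char R q}) (k : nat) (e : R) :
  let d : R := (96 * k.+2)%:R in
  4000 * d ^+ 5 <= ln (ln q%:R) -> e <= k.+2%:R^-1 / 4 ->
  ln (#|[set: dirichlet_char R q]%SET : H|%g%:R) <= e * calL R q ->
  expR (((Num.sqrt 3)^-1 - k.+2%:R^-1) * calL R q) <= maxL q_prime H.
Proof.
move=> d dq ek idx.
have k2 : 2 <= k.+2%:R :> R by rewrite (ler_nat R 2).
have dE : d = 96 * k.+2%:R by rewrite /d natrM.
have d1 : 192 <= d by rewrite dE; lra.
have d0 : 0 < d by lra.
set c := calL R q; set s := (Num.sqrt 3)^-1; set h := k.+2%:R^-1.
have /andP[s2 s1] := sqrt3_bounds; rewrite -/s in s2 s1.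
have h0 : 0 < h by rewrite invr_gt0.
have h2 : h <= 2^-1 by rewrite lef_pV2 ?posrE.
have hk : h * k.+2%:R = 1 by rewrite mulVf.
have cd : d <= c.
  apply: calL_ge; first exact: ltW.
  apply: le_trans dq; rewrite (exprD d 3 2) mulrA ler_wpM2r ?sqr_ge0//.
  have : 1 <= d ^+ 3 by rewrite exprn_ege1//; lra.
  by lra.
have c0 : 0 <= c by lra.
have hc : 96 <= h * c.
  apply: le_trans (_ : h * d <= _); last by rewrite ler_pM2l.
  by rewrite dE mulrCA hk mulr1.
have [N /andP[N3 Nq]] := cube_root q.
have D8 : (8 <= 96 * k.+2)%N by rewrite (leq_trans _ (leq_pmulr 96 (ltn0Sn k.+1))).
have [N2 [J [pr [lam [prp prI lam0 gain]]]]] := resonator_exists D8 dq N3 Nq.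
have rho0 A : 0 <= rS (res_weight pr lam) A
  by apply: rS_ge0 => j; rewrite /res_weight divr_ge0 ?mulr_ge0 ?invsqrt_ge0 ?lnn_ge0.
have := main_inequality q_prime H N2 N3 Nq (@nuS_gt0 _ pr prp) (nuS_inj prp prI) rho0.
move=> /(le_trans gain); rewrite ler_pM2r; last by apply: resW_gt0; exact: ltnW.
set M := maxL q_prime H => MI.
have M0 : 0 <= M by exact: maxL_ge0.
have i0 : 0 < #|[set: dirichlet_char R q]%SET : H|%g%:R :> R by rewrite ltr0n indexg_gt0.
have idx' : #|[set: dirichlet_char R q]%SET : H|%g%:R <= expR (h / 4 * c).
  rewrite -[leLHS]lnK ?posrE// ler_expR; apply: le_trans idx _.
  by rewrite ler_wpM2r.
have gainE : (s - h / 4) * c <= (1 - 4 / d) ^+ 6 * (s * c).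
  apply: (@le_trans _ _ ((1 - 6 * (4 / d)) * (s * c))); last first.
    rewrite ler_wpM2r ?mulr_ge0//; first by lra.
    by apply: bernoulli6; rewrite divr_ge0 ?ler_pdivrMr ?(ltW d0)//=; lra.
  rewrite (_ : 6 * (4 / d) = h / 4); last first.
    by rewrite dE /h; field; rewrite gt_eqF//; lra.
  rewrite mulrA ler_wpM2r// mulrBl mul1r lerD2l lerN2.
  by rewrite ler_piMr// divr_ge0// ltW.
have {MI} MI : 2^-1 * expR ((s - h / 4) * c) <= (M + 16) * expR (h / 4 * c).
  apply: le_trans (_ : _ <= 2^-1 * expR ((1 - 4 / d) ^+ 6 * (s * c))) _.
    by rewrite ler_pM2l// ler_expR.
  by apply: le_trans MI _; rewrite ler_wpM2l// addr_ge0.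
have E : (s - h / 4) * c = (s - h) * c + h * c / 2 + h / 4 * c by field.
rewrite E expRD mulrA ler_pM2r ?expR_gt0// expRD in MI.
have A1 : 1 <= expR ((s - h) * c).
  apply: le_trans (expR_ge1Dx _); rewrite lerDl mulr_ge0// subr_ge0.
  exact: le_trans s2.
have B1 : 34 <= expR (h * c / 2).
  by apply: le_trans (expR_ge1Dx _); lra.
by move: (expR ((s - h) * c)) (expR (h * c / 2)) A1 B1 MI => A B A1 B1 MI; nra.
Qed.

(** A sequence of eventual properties holds along some index tending to infinity:
   take for [kq q] the greatest [k <= q] whose threshold is at most [q]. *)
Lemma eventually_diagonal (P : nat -> nat -> Prop) :
  (forall k, \forall q \near \oo, P k q) ->
  exists kq : nat -> nat, kq q @[q --> \oo] --> \oo /\ \forall q \near \oo, P (kq q) q.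
Proof.
move=> HP.
have /choice[M HM] : forall k, exists M, forall q, (M <= q)%N -> P k q.
  by move=> k; have [M _ HM] := HP k; exists M.
pose kq q := (\max_(k < q.+1 | (M k <= q)%N) k)%N.
exists kq; split.
  move=> A [K _ KA]; exists (maxn K (M K)) => // q /=; rewrite geq_max => /andP[Kq MKq].
  apply: KA => /=; rewrite /kq.
  exact: (@leq_bigmax_cond _ (fun k : 'I_q.+1 => (M k <= q)%N) (fun k => nat_of_ord k) (Ordinal (Kq : (K < q.+1)%N)) MKq).
exists (M 0%N) => // q /= Mq.
have [|k kM kE] := @eq_bigmax_cond _ [pred k : 'I_q.+1 | (M k <= q)%N] (fun k => nat_of_ord k).
  by apply/card_gt0P; exists ord0.
have -> : kq q = k by rewrite /kq -kE; apply: eq_bigl => j; rewrite inE.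
exact: HM.
Qed.

Lemma near_lnln_ge (b : R) : \forall q \near \oo, b <= ln (ln q%:R).
Proof.
have /andP[_ t] := truncn_itv (expR_ge0 (expR b)).
exists (Num.trunc (expR (expR b))).+1 => // q /= tq.
have lq : expR b <= ln q%:R.
  rewrite -ler_expR lnK ?posrE ?ltr0n; last exact: leq_trans tq.
  by apply: ltW; apply: lt_le_trans t _; rewrite ler_nat.
by rewrite -ler_expR lnK// posrE (lt_le_trans _ lq) ?expR_gt0.
Qed.

End Conclusion.

Theorem theorem1 (R : realType) (eps : nat -> R)
    (eps_cvg0 : eps n @[n --> \oo] --> (0 : R)) :
  exists eta : nat -> R,
    (eta n @[n --> \oo] --> (0 : R)) /\
    (\forall q \near \oo, prime q ->
      forall H : {group dirichlet_char R q},
        ln (#|[set: dirichlet_char R q]%SET : H|%g%:R) <= eps q * calL R q ->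
        exists L : dirichlet_char R q -> R[i] -> R[i],
          (forall chi : dirichlet_char R q, is_dirichlet_L chi (L chi)) /\
          expR (((Num.sqrt 3)^-1 + eta q) * calL R q)
            <= \big[Num.max/0]_(chi in H)
                 ComplexField.Normc.normc (L chi 2^-1)).
Proof.
pose P (k q : nat) := forall (q_prime : prime q) (H : {group dirichlet_char R q}),
  ln (#|[set: dirichlet_char R q]%SET : H|%g%:R) <= eps q * calL R q ->
  expR (((Num.sqrt 3)^-1 - k.+2%:R^-1) * calL R q) <= maxL q_prime H.
have /eventually_diagonal[kq [kq_oo Hkq]] : forall k, \forall q \near \oo, P k q.
  move=> k; near=> q => q_prime H; apply: maxL_large.
    by near: q; exact: near_lnln_ge.
  by near: q; apply: (cvgr_le _ eps_cvg0); rewrite divr_gt0.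
exists (fun q => - (kq q).+2%:R^-1); split.
  rewrite -oppr0; apply: cvgN.
  apply: (@cvg_comp _ _ _ kq (fun k : nat => k.+2%:R^-1 : R) _ _ _ kq_oo).
  have := @cvg_harmonic R; rewrite -cvg_shiftS; exact.
near=> q => q_prime H idx; exists (Lfun q_prime); split.
  exact: Lfun_is_dirichlet_L.
by move: q_prime H idx; near: q; exact: Hkq.
Unshelve. all: by end_near. Qed.
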